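(* Let $N_0=\max\{2.67\times 9^{17},\ 10.2\times 2^{tl-3}+2\}$. \begin{description} \item[(i)] If $t=1$, $l\ge 6$, $N=\max\{N_0,\ \tfrac{625}{32}\lfloor \tfrac{l-3}{3}\rfloor^2+2\}$ and $n\ge N+\tfrac{3}{2}\sqrt{2N-6}$, then the extremal graph to $\mathrm{spex}_{\mathcal{P}}(n,tP_l)$ is $K_2\vee H_{\mathcal{P}}(l-3-2\lfloor \tfrac{l-3}{3}\rfloor,\lfloor \tfrac{l-3}{3}\rfloor)$. \item[(ii)] If $t=2$, $l\ge 4$, $N=\max\{N_0,\ \tfrac{625}{32}\lfloor \tfrac{l-2}{2}\rfloor^2+2\}$ and $n\ge N+\tfrac{3}{2}\sqrt{2N-6}$, then the extremal graph to $\mathrm{spex}_{\mathcal{P}}(n,tP_l)$ is $K_2\vee H_{\mathcal{P}}(l-1,\lceil \tfrac{l-2}{2}\rceil,\lfloor \tfrac{l-2}{2}\rfloor)$. \item[(iii)] If $t\ge 3$, $l\ge 3$, $N=\max\{N_0,\ \tfrac{625}{32}(\lfloor \tfrac{l-2}{2}\rfloor+1)^2+2\}$ and $n\ge N+\tfrac{3}{2}\sqrt{2N-6}$, then the extremal graph to $\mathrm{spex}_{\mathcal{P}}(n,tP_l)$ is $K_2\vee H_{\mathcal{P}}(tl-2l-1,\,l-1)$. \end{description} Here ''the extremal graph to $\mathrm{spex}_{\mathcal{P}}(n,F)$ is $X$'' means that $X$ is an $n$-vertex $F$-free planar graph and every $n$-vertex $F$-free planar graph of maximum spectral radius is isomorphic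 to $X$.
   Context: All graphs are finite and simple. The spectral radius of a graph is the largest eigenvalue of its adjacency matrix. A graph is $F$-free if it contains no subgraph isomorphic to $F$. $\mathrm{spex}_{\mathcal{P}}(n,F)$ denotes the maximum spectral radius over all $n$-vertex $F$-free planar graphs. $P_l$ denotes the path on $l$ vertices, $tP_l$ the disjoint union of $t$ vertex-disjoint copies of $P_l$, $K_2$ a single edge, and $G_1\vee G_2$ the join (disjoint union plus all edges between $G_1$ and $G_2$); $kP_m$ denotes $k$ vertex-disjoint copies of $P_m$. For positive integers $n,n_1,n_2$ with $n\ge n_1\ge n_2\ge 1$, $H_{\mathcal{P}}(n_1,n_2)$ (depending on $n$) is the disjoint union of paths on $n-2$ vertices: $P_{n_1}\cup \frac{n-2-n_1}{n_2}P_{n_2}$ if $n_2\mid (n-2-n_1)$, and otherwise $P_{n_1}\cup \lfloor \frac{n-2-n_1}{n_2}\rfloor P_{n_2}\cup P_{\,n-2-n_1-\lfloor \frac{n-2-n_1}{n_2}\rfloor n_2}$. For positive integers $n,n_1,n_2,n_3$ with $n\ge n_1\ge n_2\ge n_3\ge 1$, $H_{\mathcal{P}}(n_1,n_2,n_3)$ (depending on $n$) is the disjoint union of paths on $n-2$ vertices: $P_{n_1}\cup P_{n_2}\cup \frac{n-2-n_1-n_2}{n_3}P_{n_3}$ if $n_3\mid (n-2-n_1-n_2)$, and otherwise $P_{n_1}\cup P_{n_2}\cup \lfloor \frac{n-2-n_1-n_2}{n_3}\rfloor P_{n_3}\cup P_{\,n-2-n_1-n_2-\lfloor \frac{n-2-n_1-n_2}{n_3}\rfloor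 n_3}$. *)

(* Defs.v *)
From HB Require Import structures.
From mathcomp Require Import all_boot all_order all_algebra.
From mathcomp Require Import reals Rstruct.
From Stdlib Require Rdefinitions.



Unset Printing Implicit Defensive.

Import Order.TTheory GRing.Theory Num.Theory.
Local Open Scope ring_scope.

Notation RR := Rdefinitions.R.

Definition simple_graph {T : finType} (e : rel T) : Prop :=
  irreflexive e /\ symmetric e.

Definition contains_sub {T1 T2 : finType} (F : rel T1) (G : rel T2) : Prop :=
  exists f : T1 -> T2, injective f /\ forall x y, F x y -> G (f x) (f y).

Definition isomorphic {T1 T2 : finType} (G1 : rel T1) (G2 : rel T2) : Prop :=
  exists f : T1 -> T2, bijective f /\ forall x y, G1 x y = G2 (f x) (f y).

(* Disjoint union of paths P_{s_1} u P_{s_2} u ... on vertices 0 .. sumn s - 1: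
   the k-th path occupies a consecutive block; i ~ i+1 iff i+1 does not start a block. *)
Definition block_starts (s : seq nat) : seq nat :=
  [seq sumn (take k s) | k <- iota 1 (size s)].

Definition path_adj (s : seq nat) (i j : nat) : bool :=
  ((j == i.+1) && (j \notin block_starts s)) ||
  ((i == j.+1) && (i \notin block_starts s)).

Definition paths_graph (s : seq nat) : rel 'I_(sumn s) :=
  fun x y => path_adj s x y.

Definition tP (t l : nat) : rel 'I_(sumn (nseq t l)) := @paths_graph (nseq t l).

(* K_2 \vee (paths given by s): vertices 0,1 form the K_2, vertex i+2 is vertex i of the paths. *)
Definition K2_join (s : seq nat) : rel 'I_(sumn s).+2 :=
  fun x y => (x != y) && [|| (x < 2)%N, (y < 2)%N | path_adj s (x - 2) (y - 2)].

(* H_P(n1,n2) (depending on n) as a list of path orders *)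
Definition HP2 (n n1 n2 : nat) : seq nat :=
  let m := (n - 2 - n1)%N in
  (n1 :: nseq (m %/ n2) n2 ++ (if m %% n2 == 0 then [::] else [:: m %% n2]))%N.

Definition HP3 (n n1 n2 n3 : nat) : seq nat :=
  let m := (n - 2 - n1 - n2)%N in
  (n1 :: n2 :: nseq (m %/ n3) n3 ++ (if m %% n3 == 0 then [::] else [:: m %% n3]))%N.

Definition pt := (RR * RR)%type.
Definition sqdist (p q : pt) : RR := (p.1 - q.1) ^+ 2 + (p.2 - q.2) ^+ 2.
Definition in01 (s : RR) : bool := (0 <= s) && (s <= 1).
Definition in01o (s : RR) : bool := (0 < s) && (s < 1).

Definition cont01 (f : RR -> pt) : Prop :=
  forall t, in01 t -> forall eps : RR, 0 < eps ->
    exists2 d : RR, 0 < d &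
      forall s, in01 s -> `|s - t| < d -> sqdist (f s) (f t) < eps ^+ 2.

Definition inj01 (f : RR -> pt) : Prop :=
  forall s t, in01 s -> in01 t -> f s = f t -> s = t.

Definition planar {T : finType} (e : rel T) : Prop :=
  exists (pos : T -> pt) (arc : T -> T -> RR -> pt),
    injective pos /\
    (forall x y, e x y ->
       [/\ cont01 (arc x y), inj01 (arc x y),
           arc x y 0 = pos x, arc x y 1 = pos y &
           forall s z, in01o s -> arc x y s <> pos z]) /\
    (forall x y u v, e x y -> e u v ->
       ~~ (((x == u) && (y == v)) || ((x == v) && (y == u))) ->
       forall s r, in01o s -> in01o r -> arc x y s <> arc u v r).

Definition adj_mx {n : nat} (e : rel 'I_n) : 'M[RR]_n :=
  \matrix_(i, j) (e i j)%:R.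

Definition spectral_radius {n : nat} (e : rel 'I_n) (rho : RR) : Prop :=
  eigenvalue (adj_mx e) rho /\ forall a, eigenvalue (adj_mx e) a -> a <= rho.

Definition admissible (n t l : nat) (e : rel 'I_n) : Prop :=
  simple_graph e /\ planar e /\ ~ contains_sub (tP t l) e.

Definition spex_extremal (n t l : nat) (e : rel 'I_n) : Prop :=
  admissible n t l e /\
  exists rho, spectral_radius e rho /\
    forall h : rel 'I_n, admissible n t l h ->
      forall r, spectral_radius h r -> r <= rho.

Definition extremal_graph_is (n t l : nat) (s : seq nat) : Prop :=
  [/\ (sumn s).+2 = n,
      simple_graph (K2_join s), planar (K2_join s),
      ~ contains_sub (tP t l) (K2_join s) &
      forall e : rel 'I_n, spex_extremal n t l e -> isomorphic e (K2_join s)].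

Definition N0 (t l : nat) : RR :=
  Num.max (267 / 100 * 9 ^+ 17) (102 / 10 * 2 ^+ (t * l - 3) + 2).
Definition Nth (t l c : nat) : RR :=
  Num.max (N0 t l) (625 / 32 * (c%:R) ^+ 2 + 2).
Definition n_large (n : nat) (N : RR) : Prop :=
  N + 3 / 2 * Num.sqrt (2 * N - 6) <= n%:R.

(* Main.v *)
From Stdlib Require Import Ring Bool.
Require Import Defs.
From mathcomp Require Import all_boot all_order all_algebra zify.

(* For a planar drawing, record mod 2 how often the arc xy crosses the half-line issued from the
   position of z: disjoint arcs then satisfy a linear relation over F_2, which passes to minors and
   fails for K_5 and K_(3,3). It yields the edge bounds of a planar graph, without the Jordan curve
   theorem.

   The join of K_2 with n - 2 vertices forces rho^2 >= 2n - 4 for an extremal graph. Counting walks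
   of length two, weighted by a Perron vector x of maximum 1, then gives two vertices u, v with
   x_u = 1, x_v >= 98/100 and at least 9n/10 common neighbours, while x <= 1/10 elsewhere. Deleting
   the edges at the few vertices that are not common neighbours and joining u and v to everything
   increases the Rayleigh quotient and creates no tP_l, because there are enough spare common
   neighbours to reroute through. Planarity makes the result a join of K_2 with a linear forest.

   On such a join with rho = q + 1/q the eigenvalue equation is solved path by path, and a path on
   a vertices costs zeta q a, up to an affine function of a: a larger spectral radius means a
   smaller total of zeta q over the path orders. As zeta q is strictly concave, the total is
   minimal for the sequence of orders that majorizes the others. All but boundedly many paths of an
   extremal graph have order at least that of the repeated part, and then the absence of tP_l bounds
   the prefix sums of the decreasing sequence of orders by those of the claimed extremal sequence. *)

Set Implicit Arguments.
Unset Strict Implicit.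
Import Order.TTheory GRing.Theory Num.Theory.

(** * The van Kampen obstruction of a planar graph *)

(** Euler's formula would need faces, so the bound of 3n - 6 edges comes from an induction by
    deletion and contraction in the manner of Mader, using only the exclusion of K_5.

    The rearranged graph contains the edge uv, which the extremal graph may lack, so only copies of
    tP_l that avoid uv can be carried back. The Perron vector of the extremal graph is thus also an
    eigenvector of the rearranged one, which forces the two graphs to be equal.

    With rho = q + 1/q the recurrence along a path has the characteristic roots q and 1/q. As q is
    tiny, zeta q a lies just below 1 for every a >= 1: to first order the cost counts the paths, so
    enough of them must be long, and strict concavity decides the rest.

    The bound n >= 4 * 10^16 serves one tight estimate, that twice the cube of the number of heavy
    vertices, at most 12000, stays below n / 10^4. *)

Lemma addb_ring : @Ring_theory.ring_theory bool false true addb andb addb id eq.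
Proof. by split=> //; do ?case. Qed.

Ltac bool_constant t :=
  match t with
  | true => constr:(true)
  | false => constr:(false)
  | _ => constr:(InitialRing.NotConstant)
  end.

Add Ring addb_ring : addb_ring (decidable Bool.eqb_prop, constants [bool_constant]).

(* In a drawing, [M x y z] is the parity of the crossings of the arc xy with the horizontal half-line
   to the right of z, and [h x y] tells whether y lies above x. The relation says that the difference
   of two disjoint arcs, seen on the boundary of the square of parameters, does not wind around 0. *)
Definition van_kampen {T : finType} (e : rel T) : Prop :=
  exists (M : T -> T -> T -> bool) (h : T -> T -> bool),
    (forall x y, x != y -> h y x = ~~ h x y) /\
    forall x y u v, e x y -> e u v -> uniq [:: x; y; u; v] ->
      M x y u (+) M x y v (+) M u v x (+) M u v y (+) (h x u (+) h x v (+) h y u (+) h y v) = false.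

Lemma van_kampen_sub (T : finType) (e e' : rel T) :
  subrel e' e -> van_kampen e -> van_kampen e'.
Proof.
by move=> sub [M [h [hh H]]]; exists M, h; split=> // x y u v /sub exy /sub euv; apply: H.
Qed.

(** [b] is merged into [a] and stays behind as an isolated vertex, so that the vertex type does not
    change along a minor. *)
Definition contract {T : finType} (e : rel T) (a b : T) : rel T := fun x y =>
  [&& x != b, y != b, x != y & [|| e x y, (x == a) && e b y | (y == a) && e x b]].

Lemma contract_van_kampen (T : finType) (e : rel T) (a b : T) :
  a != b -> symmetric e -> e a b -> van_kampen e -> van_kampen (contract e a b).
Proof.
move=> ab symE eab [M [h [hh H]]].
have eba : e b a by rewrite symE.
(* An edge inherited from [b] stands for the path through [b]: parities of crossings add along that
   path, and the values of [h] at [b] occur twice. *)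
pose M' x y z := if e x y then M x y z else
  if x == a then M a b z (+) M b y z else M x b z (+) M b a z.
exists M', h; split=> // x y u v.
have key x1 y1 u1 v1 : contract e a b x1 y1 -> e u1 v1 -> u1 != b -> v1 != b ->
    uniq [:: x1; y1; u1; v1] ->
    M' x1 y1 u1 (+) M' x1 y1 v1 (+) M u1 v1 x1 (+) M u1 v1 y1 (+)
    (h x1 u1 (+) h x1 v1 (+) h y1 u1 (+) h y1 v1) = false.
  rewrite /contract /M' => /and4P[xb yb xy]; case: ifP => [exy _|nexy /=].
    by move=> euv _ _; apply: H.
  case: (eqVneq x1 a) => [->|xa] /=.
    move=> eby euv ub vb /=; rewrite !inE !negb_or => /and4P[/and3P[ay au av] /andP[yu yv] uv _].
    have {}eby : e b y1.
      case/orP: eby => // /andP[/eqP ya]; by move: ay; rewrite ya eqxx.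
    have := H a b u1 v1 eab euv; rewrite /= !inE !negb_or ab au av eq_sym ub (eq_sym b) vb uv.
    move=> /(_ isT) E1.
    have := H b y1 u1 v1 eby euv; rewrite /= !inE !negb_or (eq_sym b y1) yb (eq_sym b u1) ub (eq_sym b) vb yu yv uv.
    move=> /(_ isT) E2.
    rewrite -[RHS](addbb false) -{1}E1 -E2.
    ring.
  move=> /andP[/eqP ya exb] euv ub vb /=; rewrite !inE !negb_or => /and4P[/and3P[_ xu xv] /andP[yu yv] uv _].
  subst y1.
  have := H x1 b u1 v1 exb euv; rewrite /= !inE !negb_or xb xu xv (eq_sym b u1) ub (eq_sym b) vb uv.
  move=> /(_ isT) E1.
  have := H b a u1 v1 eba euv; rewrite /= !inE !negb_or (eq_sym b a) ab (eq_sym b u1) ub (eq_sym b) vb yu yv uv.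
  move=> /(_ isT) E2.
  rewrite -[RHS](addbb false) -{1}E1 -E2.
  ring.
move=> cxy cuv un.
have [/and4P[xb yb xy exy] /and4P[ub vb uv euv]] := (cxy, cuv).
(* Two disjoint edges cannot both end at [a], so at least one of them is an edge of [e]. *)
case: (boolP (e u v)) => [euv'|neuv].
  have E z : M' u v z = M u v z by rewrite /M' euv'.
  by have := key x y u v cxy euv' ub vb un; rewrite !E.
have un' : uniq [:: u; v; x; y].
  by move: un; rewrite -(rot_uniq 2).
have exy' : e x y.
  case/or3P: exy => // /andP[/eqP xa _]; case/or3P: euv => // [euv|/andP[/eqP ua _]|/andP[/eqP ua _]];
    try (by rewrite euv in neuv); by move: un; rewrite xa ua /= !inE eqxx ?orbT ?andbF.
have E z : M' x y z = M x y z by rewrite /M' exy'.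
have := key u v x y cuv exy' xb yb un'; rewrite !E.
move: un; rewrite /= !inE !negb_or => /and4P[/and3P[_ xu xv] /andP[yu yv] _ _].
(* Exchanging the two edges reverses four values of [h], and four negations cancel. *)
rewrite (hh x u) // (hh y u) // (hh x v) // (hh y v) // -!addTb => <-.
ring.
Qed.

Lemma addb8_even (b1 b2 b3 b4 b5 b6 b7 b8 : bool) :
  b1 (+) b2 (+) b3 (+) b4 (+) (b5 (+) b6 (+) b7 (+) b8) = false ->
  exists k : nat, b1 + b2 + b3 + b4 + (b5 + b6 + b7 + b8) = k.*2.
Proof.
move=> E; exists (b1 + b2 + b3 + b4 + (b5 + b6 + b7 + b8))./2.
by rewrite -[LHS]odd_double_half !oddD !oddb E.
Qed.

(** Over the naturals a parity relation is an equation with an unknown half [k], a form in which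
    [lia] refutes many relations at once. *)
Lemma van_kampen_even (T : finType) (e : rel T) : van_kampen e ->
  exists (M : T -> T -> T -> nat) (h : T -> T -> nat),
    (forall x y, x != y -> h y x + h x y = 1) /\
    forall x y u v, e x y -> e u v -> x != u -> x != v -> y != u -> y != v -> x != y -> u != v ->
      exists k, M x y u + M x y v + M u v x + M u v y + (h x u + h x v + h y u + h y v) = k.*2.
Proof.
move=> [M [h [hh H]]]; exists (fun x y z => M x y z), (fun x y => h x y); split.
  by move=> x y /hh ->; case: (h x y).
move=> x y u v exy euv h1 h2 h3 h4 h5 h6; apply/addb8_even/H => //.
by rewrite /= !inE !negb_or h1 h2 h3 h4 h5 h6.
Qed.

Ltac even_equation H x y u v :=
  let k := fresh "k" in let E := fresh "E" in
  have [k E] := H x y u v ltac:(assumption) ltac:(assumption)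
    ltac:(auto) ltac:(auto) ltac:(auto) ltac:(auto) ltac:(auto) ltac:(auto);
  move: E.

Ltac parity_contradiction M h :=
  repeat (let x := fresh in match goal with |- context [M ?a ?b ?c] =>
    generalize (M a b c); intro x end);
  repeat (let x := fresh in match goal with |- context [h ?a ?b] =>
    generalize (h a b); intro x end);
  lia.

(** Over the 15 pairs of disjoint edges every value of [M] occurs twice and drops out of the sum.
    Each unordered pair of vertices occurs six times among the values of [h]; as 15 of these are in
    reversed order, the relations sum to 1. *)
Lemma van_kampen_K5 (T : finType) (e : rel T) (a b c d f : T) :
  van_kampen e -> uniq [:: a; b; c; d; f] ->
  e a b -> e a c -> e a d -> e a f -> e b c -> e b d -> e b f -> e c d -> e c f -> e d f -> False.
Proof.
move=> /van_kampen_even[M [h [hh H]]] + ab ac ad af bc bd bf cd cf df.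
rewrite /= !inE !negb_or.
move=> /and5P[/and4P[nab nac nad naf] /and3P[nbc nbd nbf] /andP[ncd ncf] ndf _].
have n2 x y : x != y -> y != x by rewrite eq_sym.
even_equation H a b c d; even_equation H a b c f; even_equation H a b d f.
even_equation H a c b d; even_equation H a c b f; even_equation H a c d f.
even_equation H a d b c; even_equation H a d b f; even_equation H a d c f.
even_equation H a f b c; even_equation H a f b d; even_equation H a f c d.
even_equation H b c d f; even_equation H b d c f; even_equation H b f c d.
move: (hh _ _ nab) (hh _ _ nac) (hh _ _ nad) (hh _ _ naf) (hh _ _ nbc) (hh _ _ nbd)
  (hh _ _ nbf) (hh _ _ ncd) (hh _ _ ncf) (hh _ _ ndf).
clear; parity_contradiction M h.
Qed.

(** The same summation over the 18 pairs of disjoint edges: each value of [M] occurs twice, each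
    pair of vertices an even number of times in [h], and an odd number of the latter is reversed. *)
Lemma van_kampen_K33 (T : finType) (e : rel T) (a b c x y z : T) :
  van_kampen e -> uniq [:: a; b; c; x; y; z] ->
  e a x -> e a y -> e a z -> e b x -> e b y -> e b z -> e c x -> e c y -> e c z -> False.
Proof.
move=> /van_kampen_even[M [h [hh H]]] + ax ay az bx By bz cx cy cz.
rewrite /= !inE !negb_or.
move=> /and5P[/and5P[nab nac nax nay naz] /and4P[nbc nbx nby nbz] /and3P[ncx ncy ncz] /andP[nxy nxz] /andP[nyz _]].
have n2 u v : u != v -> v != u by rewrite eq_sym.
even_equation H a x b y; even_equation H a x b z; even_equation H a x c y; even_equation H a x c z.
even_equation H a y b x; even_equation H a y b z; even_equation H a y c x; even_equation H a y c z.
even_equation H a z b x; even_equation H a z b y; even_equation H a z c x; even_equation H a z c y.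
even_equation H b x c y; even_equation H b x c z; even_equation H b y c x; even_equation H b y c z.
even_equation H b z c x; even_equation H b z c y.
move: (hh _ _ nab) (hh _ _ nac) (hh _ _ nbc) (hh _ _ nxy) (hh _ _ nxz) (hh _ _ nyz).
move: (hh _ _ nax) (hh _ _ nay) (hh _ _ naz) (hh _ _ nbx) (hh _ _ nby) (hh _ _ nbz)
  (hh _ _ ncx) (hh _ _ ncy) (hh _ _ ncz).
clear; parity_contradiction M h.
Qed.

(** * Edge counts under deletion and contraction *)

Definition nbrs {T : finType} (e : rel T) (V : {set T}) (x : T) : {set T} := [set y in V | e x y].
(** Twice the number of edges inside [V]; with ordered pairs it is a plain double sum. *)
Definition arcs {T : finType} (e : rel T) (V : {set T}) : nat := \sum_(x in V) #|nbrs e V x|.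

Lemma card_set_sum (T : finType) (V : {set T}) (P : pred T) :
  #|[set y in V | P y]| = \sum_(y in V) P y.
Proof. by rewrite -sum1dep_card big_mkcondr /=; apply: eq_bigr => y _; case: (P y). Qed.

Lemma arcsE (T : finType) (e : rel T) (V : {set T}) :
  arcs e V = \sum_(x in V) \sum_(y in V) e x y.
Proof. by apply: eq_bigr => x _; rewrite card_set_sum. Qed.

Lemma arcs_del (T : finType) (e : rel T) (V : {set T}) v :
  irreflexive e -> symmetric e -> v \in V ->
  arcs e V = arcs e (V :\ v) + (#|nbrs e V v|).*2.
Proof.
move=> irr sym vV; rewrite !arcsE (big_setD1 v) //= (big_setD1 v (A := V)) //= irr add0n.
rewrite card_set_sum (big_setD1 v (A := V)) //= irr add0n -addnn.
under [in X in _ + X]eq_bigr do rewrite (big_setD1 v) //=.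
rewrite big_split /= addnA addnC; congr (_ + (_ + _)).
by apply: eq_bigr => x _; rewrite sym.
Qed.

(** The contraction loses the edge [ab] itself, and the two edges to each common neighbour merge
    into one. *)
Lemma arcs_contract (T : finType) (e : rel T) (V : {set T}) a b :
  irreflexive e -> symmetric e -> a \in V -> b \in V -> e a b ->
  arcs e V = arcs (contract e a b) (V :\ b) + 2 + (#|nbrs e (nbrs e V a) b|).*2.
Proof.
move=> irr sym aV bV eab.
have ab : a != b by apply: contraTneq eab => ->; rewrite irr.
have aVb : a \in V :\ b by rewrite !inE ab.
have irr' : irreflexive (contract e a b) by move=> x; rewrite /contract eqxx !andbF.
have sym' : symmetric (contract e a b).
  move=> x y; rewrite /contract (eq_sym y x) (sym y x) (sym y b) (sym x b).
  by case: (x != b); case: (y != b); rewrite //= [in RHS](orbC (_ && e b x)).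
rewrite (arcs_del irr sym bV) (arcs_del irr sym aVb) (arcs_del irr' sym' aVb).
have -> : arcs (contract e a b) (V :\ b :\ a) = arcs e (V :\ b :\ a).
  rewrite !arcsE; apply: eq_bigr => x; rewrite !inE => /and3P[/negbTE xa xb _].
  apply: eq_bigr => y; rewrite !inE => /and3P[/negbTE ya yb _].
  rewrite /contract xb yb xa ya !orbF /=.
  by case: eqP => // ->; rewrite irr.
rewrite -!addnA; congr (_ + _).
suff : #|nbrs e (V :\ b) a| + #|nbrs e V b| =
   #|nbrs (contract e a b) (V :\ b) a| + 1 + #|nbrs e (nbrs e V a) b| by lia.
have -> : #|nbrs e (nbrs e V a) b| = \sum_(y in V :\ b :\ a) (e a y && e b y).
  rewrite -card_set_sum; apply: eq_card => y; rewrite !inE.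
  case: (eqVneq y a) => [->|] /=; first by rewrite irr andbF.
  by case: (eqVneq y b) => [->|] /=; rewrite ?irr ?andbF // andbA.
rewrite /nbrs !card_set_sum (big_setD1 a (A := V :\ b)) //= irr add0n.
rewrite (big_setD1 b (A := V)) //= irr add0n (big_setD1 a (A := V :\ b)) //= (sym b a) eab.
rewrite (big_setD1 a (A := V :\ b)) //= irr' add0n.
rewrite addnCA [in RHS]addnAC addn1 add1n; congr _.+1.
rewrite -!big_split /=; apply: eq_bigr => y; rewrite !inE => /and3P[ya yb _].
rewrite /contract ab yb (eq_sym a y) ya eqxx (negbTE ya) /= orbF.
by case: (e a y); case: (e b y).
Qed.

Lemma contract_irr (T : finType) (e : rel T) a b : irreflexive (contract e a b).
Proof. by move=> x; rewrite /contract eqxx !andbF. Qed.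

Lemma contract_sym (T : finType) (e : rel T) a b : symmetric e -> symmetric (contract e a b).
Proof.
move=> sym x y; rewrite /contract (eq_sym y x) (sym y x) (sym y b) (sym x b).
by case: (x != b); case: (y != b); rewrite //= [in RHS](orbC (_ && e b x)).
Qed.

(** The non-edges inside [S] form a matching. Either [S] contains a K_4, which [v] completes to K_5,
    or [S] is K_5 without two disjoint edges, and contracting one edge restores a K_4 inside [S]. *)
Lemma van_kampen_wheel (T : finType) (e : rel T) (S : {set T}) v :
  irreflexive e -> symmetric e -> van_kampen e ->
  (forall y, y \in S -> e v y) -> 4 <= #|S| <= 5 ->
  (forall y, y \in S -> 3 <= #|nbrs e S y|) -> False.
Proof.
move=> irr sym vk vS cS dS.
have nev x y : e x y -> x != y by apply: contraTneq => ->; rewrite irr.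
have vnS y : y \in S -> v != y by move=> /vS /nev.
have K4 s : uniq s -> size s = 4 -> {subset s <= S} -> (forall x y, x \in s -> y \in s -> x != y -> e x y) -> False.
  case: s => [|a [|b [|c [|d [|f s]]]]] //= un _ sS se.
  have mem x : x \in [:: a; b; c; d] -> v != x /\ e v x by move=> /sS xS; split; [apply: vnS|apply: vS].
  have [[na va] [nb vb] [nc vc] [nd vd]] : [/\ v != a /\ e v a, v != b /\ e v b, v != c /\ e v c & v != d /\ e v d].
    by split; apply: mem; rewrite !inE eqxx ?orbT.
  move: (un); rewrite !inE !negb_or => /and4P[/and3P[ab ac ad] /andP[bc bd] cd _].
  apply: (van_kampen_K5 (a := v) (b := a) (c := b) (d := c) (f := d) vk) => //;
    try (by apply: se => //; rewrite !inE eqxx ?orbT).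
  by rewrite /= !inE !negb_or na nb nc nd ab ac ad bc bd cd.
have nonadj y : y \in S -> #|[set z in S | ~~ e y z]| + 3 <= #|S|.
  move=> yS; have := cardsID (nbrs e S y) S.
  have -> : S :&: nbrs e S y = nbrs e S y by apply/setIidPr/subsetP => z; rewrite inE => /andP[].
  have -> : S :\: nbrs e S y = [set z in S | ~~ e y z].
    by apply/setP => z; rewrite !inE; case: (z \in S); rewrite ?andbT ?andbF.
  by have := dS y yS; lia.
have one y z z' : y \in S -> z \in S -> z' \in S -> y != z -> y != z' -> z != z' ->
    ~~ e y z -> ~~ e y z' -> False.
  move=> yS zS z'S yz yz' zz' eyz eyz'.
  have : #|[set y; z; z']| <= #|[set z in S | ~~ e y z]|.
    apply: subset_leq_card; apply/subsetP => x; rewrite !inE => /orP[/orP[]|] /eqP ->;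
    by rewrite ?yS ?zS ?z'S ?irr.
  have := nonadj y yS; rewrite -setUA cardsU1 cards2 !inE negb_or yz yz' zz' /=; lia.
case: (boolP [exists y in S, [exists z in S, (y != z) && ~~ e y z]]) => [|/existsPn noE]; last first.
  have full x y : x \in S -> y \in S -> x != y -> e x y.
    move=> xS yS xy; have := noE x; rewrite xS /= => /existsPn/(_ y).
    by rewrite yS xy /= negbK.
  apply: (K4 (take 4 (enum S))).
  - exact/take_uniq/enum_uniq.
  - by rewrite size_takel // -cardE; case/andP: cS.
  - by move=> x /mem_take; rewrite mem_enum.
  - by move=> x y /mem_take + /mem_take; rewrite !mem_enum; apply: full.
move=> /existsP[y /andP[yS /existsP[z /and3P[zS yz neyz]]]].
have c5 : #|S| = 5.
  have : #|[set y; z]| <= #|[set z in S | ~~ e y z]|.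
    by apply: subset_leq_card; apply/subsetP => x; rewrite !inE => /orP[] /eqP ->; rewrite ?yS ?zS ?irr.
  have := nonadj y yS; rewrite cards2 yz /=; lia.
have [p [q [r [Sp Sq Sr]]]] : exists p q r, [/\ p \in S :\ y :\ z, q \in S :\ y :\ z :\ p & r \in S :\ y :\ z :\ p :\ q].
  have c3 : #|S :\ y :\ z| = 3.
    have := cardsD1 y S; have := cardsD1 z (S :\ y); rewrite !inE eq_sym yz yS zS c5 /=; lia.
  have [p Sp] : exists p, p \in S :\ y :\ z by apply/card_gt0P; rewrite c3.
  have c2 : #|S :\ y :\ z :\ p| = 2 by have := cardsD1 p (S :\ y :\ z); rewrite Sp c3; lia.
  have [q Sq] : exists q, q \in S :\ y :\ z :\ p by apply/card_gt0P; rewrite c2.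
  have c1 : #|S :\ y :\ z :\ p :\ q| = 1 by have := cardsD1 q (S :\ y :\ z :\ p); rewrite Sq c2; lia.
  have [r Sr] : exists r, r \in S :\ y :\ z :\ p :\ q by apply/card_gt0P; rewrite c1.
  by exists p, q, r.
move: Sp Sq Sr; rewrite !inE => /and3P[pz py pS] /and4P[qp qz qy qS] /and5P[rq rp rz ry rS].
have adj x : x \in S -> x != z -> x != y -> e y x /\ e z x.
  move=> xS xz xy; split; apply/negPn/negP => ne.
    by apply: (one y z x) => //; rewrite eq_sym.
  by apply: (one z y x) => //; rewrite 1?eq_sym // sym.
have [[[yp zp] [yq zq]] [yr zr]] := (adj p pS pz py, adj q qS qz qy, adj r rS rz ry).
(* Contracting [y] into [p'] supplies the missing edge between [p'] and [q']; then [v], [p'], [q'],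
   [r'], [z] form a K_5. *)
have minor p' q' r' : p' \in S -> q' \in S -> r' \in S -> e y p' -> e z p' -> e y q' -> e z q' ->
   e y r' -> e z r' -> e p' r' -> e q' r' -> p' != q' -> False.
  move=> p'S q'S r'S yp' zp' yq' zq' yr' zr' pr' qr' pq'.
  have cvk : van_kampen (contract e p' y).
    by apply: contract_van_kampen => //; [rewrite eq_sym nev|rewrite sym].
  have c1 x w : x != y -> w != y -> e x w -> contract e p' y x w.
    by move=> xy wy exw; rewrite /contract xy wy exw nev.
  have [vy zy] : v != y /\ z != y by rewrite vnS // eq_sym.
  have [p'y q'y r'y] : [/\ p' != y, q' != y & r' != y] by rewrite !(eq_sym _ y) !nev.
  have [vp vq vr vz] : [/\ v != p', v != q', v != r' & v != z] by rewrite !vnS.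
  have [pz' qz' rz'] : [/\ z != p', z != q' & z != r'] by rewrite !nev.
  have [pr1 qr1] : p' != r' /\ q' != r' by rewrite !nev.
  apply: (van_kampen_K5 (a := v) (b := p') (c := q') (d := r') (f := z) cvk) => //;
    try (by apply: c1 => //; first [exact: vS | by rewrite sym]).
  - by rewrite /= !inE !negb_or vp vq vr vz pq' pr1 qr1 !(eq_sym _ z) pz' qz' rz'.
  - by rewrite /contract p'y q'y pq' yq' eqxx /= orbT.
case: (boolP (e p q)) => [pq|npq].
  case: (boolP (e p r)) => [pr|npr].
    case: (boolP (e q r)) => [qr|nqr].
      apply: (K4 [:: y; p; q; r]) => //.
      - by rewrite /= !inE !negb_or !(eq_sym y) py qy ry eq_sym qp eq_sym rp eq_sym rq.
      - by move=> x; rewrite !inE => /or4P[] /eqP ->.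
      - by move=> x w; rewrite !inE => /or4P[] /eqP -> /or4P[] /eqP ->; rewrite ?eqxx // => _; rewrite // sym.
    by apply: (minor q r p); rewrite // 1?eq_sym // sym.
  have qr : e q r by apply/negPn/negP => nqr; apply: (one r p q); rewrite // 1?eq_sym // sym.
  by apply: (minor p r q); rewrite // 1?eq_sym // sym.
have pr : e p r by apply/negPn/negP => npr; apply: (one p q r); rewrite // eq_sym.
have qr : e q r by apply/negPn/negP => nqr; apply: (one q p r); rewrite // 1?eq_sym // sym.
by apply: (minor p q r); rewrite // eq_sym.
Qed.

Lemma arcs_complete (T : finType) (e : rel T) (V : {set T}) :
  irreflexive e -> arcs e V <= #|V| * #|V|.-1.
Proof.
move=> irr; rewrite -sum_nat_const; apply: leq_sum => x xV.
rewrite [#|V|](cardsD1 x) xV /=; apply: subset_leq_card.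
by apply/subsetP => y; rewrite !inE => /andP[->]; rewrite andbT; apply: contraTneq => ->; rewrite irr.
Qed.

Lemma arcs_pairs (T : finType) (e : rel T) (V : {set T}) :
  arcs e V = #|[set p in setX V V | e p.1 p.2]|.
Proof.
rewrite card_set_sum arcsE pair_big /=; apply: eq_bigl => -[x y]; by rewrite !inE.
Qed.

(** Mader's argument on a minimal counterexample. A vertex of degree at most 3 could be deleted, and
    an edge in at most two triangles could be contracted. So a vertex of degree at most 5 has 4 or 5
    neighbours, each adjacent to at least three of the others, which [van_kampen_wheel] excludes. *)
Theorem van_kampen_arcs (T : finType) (e : rel T) (V : {set T}) :
  irreflexive e -> symmetric e -> van_kampen e -> 3 <= #|V| -> arcs e V + 12 <= 6 * #|V|.
Proof.
have [m] := ubnP (#|V| + arcs e V); elim: m e V => // m IH e V.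
rewrite ltnS => hm irr sym vk V3; rewrite leqNgt; apply/negP => big.
have [V4|Vle] := ltnP 3 #|V|; last first.
  have e3 : #|V| = 3 by lia.
  by have := arcs_complete V irr; rewrite e3; move: big; rewrite e3; lia.
(* With at least one whole edge to spare, deleting an edge leaves a smaller counterexample;
   otherwise the excess is so small that the average degree is below 6. *)
have [small|large] := leqP (arcs e V) (6 * #|V| - 10); last first.
  have [x xV [y yV exy]] : exists2 x, x \in V & exists2 y, y \in V & e x y.
    case: (boolP [exists x in V, [exists y in V, e x y]]) => [|/existsPn no].
      by move=> /existsP[x /andP[xV /existsP[y /andP[yV exy]]]]; exists x => //; exists y.
    suff : arcs e V = 0 by move: large; lia.
    rewrite /arcs big1 // => x xV; apply/eqP; rewrite cards_eq0; apply/eqP/setP => y; rewrite !inE.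
    by have := no x; rewrite xV /= => /existsPn/(_ y) /negbTE.
  have xy : x != y by apply: contraTneq exy => ->; rewrite irr.
  pose e' : rel T := fun a b => e a b && ~~ (((a == x) && (b == y)) || ((a == y) && (b == x))).
  have sub : subrel e' e by move=> a b /andP[].
  have irr' : irreflexive e' by move=> a; rewrite /e' irr.
  have sym' : symmetric e'.
    by move=> a b; rewrite /e' sym orbC (andbC (a == y)) (andbC (a == x)).
  have E : arcs e V = arcs e' V + 2.
    rewrite !arcs_pairs (cardsD1 (x, y)) (cardsD1 (y, x) (_ :\ _)) !inE /= xV yV exy sym exy.
    rewrite xpair_eqE eq_sym (negbTE xy) /= addnA addnC; congr (_ + 2).
    apply: eq_card => -[a b]; rewrite !inE /= !xpair_eqE /e' /=.
    by case: (a == x); case: (b == y); case: (a == y); case: (b == x); rewrite ?andbT ?andbF.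
  have := IH e' V ltac:(lia) irr' sym' (van_kampen_sub sub vk) V3; lia.
have [v vV dv] : exists2 v, v \in V & #|nbrs e V v| <= 5.
  case: (boolP [exists v in V, #|nbrs e V v| <= 5]) => [/existsP[v /andP[]]|/existsPn no].
    by move=> vV dv; exists v.
  have : #|V| * 6 <= arcs e V.
    rewrite -sum_nat_const; apply: leq_sum => x xV.
    by have := no x; rewrite xV /= -ltnNge.
  by move: small; lia.
have cdel := cardsD1 v V; rewrite vV in cdel.
have dlow : 4 <= #|nbrs e V v|.
  have := arcs_del irr sym vV; have := IH e (V :\ v) ltac:(have := arcs_del irr sym vV; lia) irr sym vk ltac:(lia).
  lia.
apply: (van_kampen_wheel (S := nbrs e V v) (v := v) irr sym vk).
- by move=> y; rewrite inE => /andP[].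
- by rewrite dlow.
move=> y; rewrite inE => /andP[yV evy].
have vy : v != y by apply: contraTneq evy => ->; rewrite irr.
have E := arcs_contract irr sym vV yV evy.
have cdy := cardsD1 y V; rewrite yV in cdy.
have := IH (contract e v y) (V :\ y) ltac:(lia) (@contract_irr _ _ _ _) (contract_sym _ _ sym)
  (contract_van_kampen vy sym evy vk) ltac:(lia).
lia.
Qed.

Lemma van_kampen_arcs_linear (T : finType) (e : rel T) (V : {set T}) :
  irreflexive e -> symmetric e -> van_kampen e -> arcs e V <= 6 * #|V|.
Proof.
move=> irr sym vk; have [V3|V3] := leqP 3 #|V|.
  by have := van_kampen_arcs irr sym vk V3; lia.
apply: leq_trans (arcs_complete V irr) _.
by rewrite mulnC leq_mul2r; apply/orP; right; lia.
Qed.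

Lemma van_kampen_degenerate (T : finType) (e : rel T) (V : {set T}) :
  irreflexive e -> symmetric e -> van_kampen e -> V != set0 ->
  exists2 v, v \in V & #|nbrs e V v| <= 5.
Proof.
move=> irr sym vk; rewrite -card_gt0 => V0.
case: (boolP [exists v in V, #|nbrs e V v| <= 5]) => [/existsP[v /andP[]]|/existsPn no].
  by move=> vV dv; exists v.
have low : #|V| * 6 <= arcs e V.
  rewrite -sum_nat_const; apply: leq_sum => x xV.
  by have := no x; rewrite xV /= -ltnNge.
have [V3|V3] := leqP 3 #|V|.
  by have := van_kampen_arcs irr sym vk V3; lia.
have := arcs_complete V irr; have : #|V| * #|V|.-1 <= #|V| * 1 by rewrite leq_mul2l; lia.
lia.
Qed.

Lemma van_kampen_common3 (T : finType) (e : rel T) (V : {set T}) (a b c : T) :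
  irreflexive e -> van_kampen e -> uniq [:: a; b; c] ->
  #|[set x in V | [&& e a x, e b x & e c x]]| <= 2.
Proof.
move=> irr vk un; rewrite leqNgt; apply/negP => /card_gt2P[x [y [z [[]]]]].
rewrite !inE => /and4P[_ ax bx cx] /and4P[_ ay By cy] /and4P[_ az bz cz] [xy yz zx].
have nev u v : e u v -> u != v by apply: contraTneq => ->; rewrite irr.
apply: (van_kampen_K33 vk (a := a) (b := b) (c := c) (x := x) (y := y) (z := z)) => //.
move: un; rewrite /= !inE !negb_or => /andP[/andP[-> ->] /andP[-> _]].
by rewrite xy yz (eq_sym x z) zx (nev _ _ ax) (nev _ _ ay) (nev _ _ az) (nev _ _ bx) (nev _ _ By)
  (nev _ _ bz) (nev _ _ cx) (nev _ _ cy) (nev _ _ cz).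
Qed.

(* Contracting w into u would turn C and u, v into a graph with too many edges. *)
Lemma van_kampen_no_cycle (T : finType) (e : rel T) (u v w : T) (C : {set T}) :
  irreflexive e -> symmetric e -> van_kampen e -> u != v -> e u w -> e v w ->
  w \notin C -> (forall x, x \in C -> e u x && e v x) -> C != set0 ->
  exists2 x, x \in C & #|nbrs e C x| <= 1.
Proof.
move=> irr sym vk uv uw vw wC CN; rewrite -card_gt0 => C0.
case: (boolP [exists x in C, #|nbrs e C x| <= 1]) => [/existsP[x /andP[]]|/existsPn no].
  by move=> xC dx; exists x.
have nev x y : e x y -> x != y by apply: contraTneq => ->; rewrite irr.
have uC : u \notin C by apply/negP => /CN/andP[]; rewrite irr.
have vC : v \notin C by apply/negP => /CN/andP[_]; rewrite irr.
have irr' := @contract_irr _ e u w.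
have sym' := contract_sym u w sym.
have vk' := contract_van_kampen (nev _ _ uw) sym uw vk.
have sub x y : x != w -> y != w -> e x y -> contract e u w x y.
  by move=> xw yw exy; rewrite /contract xw yw exy nev.
have cw x : x \in C -> x != w by apply: contraTneq => ->.
have vu : v \notin u |: C by rewrite !inE negb_or eq_sym uv vC.
(* The contraction creates the edge [uv]. If all degrees inside [C] were at least two, there would
   be at least [6 * #|C| + 2] arcs, while [6 * (#|C| + 2) - 12] are allowed. *)
have := @van_kampen_arcs T (contract e u w) (v |: (u |: C)) irr' sym' vk'.
rewrite !cardsU1 vu uC /= => /(_ ltac:(lia)).
have vV : v \in v |: (u |: C) by rewrite !inE eqxx.
have uV : u \in u |: C by rewrite !inE eqxx.
rewrite (arcs_del irr' sym' vV) setU1K // (arcs_del irr' sym' uV) setU1K //.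
have : #|C| * 2 <= arcs (contract e u w) C.
  rewrite -sum_nat_const; apply: leq_sum => x xC.
  have := no x; rewrite xC /= -ltnNge => /leq_trans; apply; apply: subset_leq_card.
  by apply/subsetP => y; rewrite !inE => /andP[yC xy]; rewrite yC sub ?cw.
have : #|C| <= #|nbrs (contract e u w) (u |: C) u|.
  apply: subset_leq_card; apply/subsetP => y yC; rewrite !inE yC orbT /=.
  have /andP[uy _] := CN _ yC; by apply: sub => //; first [exact: cw | exact: nev].
have : #|u |: C| <= #|nbrs (contract e u w) (v |: (u |: C)) v|.
  apply: subset_leq_card; apply/subsetP => y; rewrite !inE => /orP[/eqP ->|yC].
    by rewrite eqxx orbT /= /contract (eq_sym v u) uv (nev _ _ vw) (nev _ _ uw) eqxx vw !orbT.
  rewrite yC !orbT /=; have /andP[_ vy] := CN _ yC; by apply: sub => //; first [exact: cw | exact: nev].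
rewrite cardsU1 uC; lia.
Qed.

From mathcomp Require boolp classical_sets functions topology normedtype derive.
From mathcomp Require Import reals Rstruct ring lra.

(** * Planar graphs have vanishing obstruction *)

Local Open Scope ring_scope.

Section PlanarVanKampen.
Import classical_sets.

(** Compactness of the unit interval, for tolerances [d]: the [x] up to which one tolerance serves
    have a supremum, and local validity at the supremum pushes it to 1. *)
Lemma unit_interval_compact (P : RR -> RR -> Prop) :
    (forall d d' t, d' <= d -> P d t -> P d' t) ->
    (forall t0, in01 t0 -> exists2 d : RR, 0 < d & exists2 eta : RR, 0 < eta &
       forall t, in01 t -> `|t - t0| < eta -> P d t) ->
  exists2 d : RR, 0 < d & forall t, in01 t -> P d t.
Proof.
move=> Pmono Ploc.
pose S : set RR := fun x => in01 x /\ exists2 d : RR, 0 < d & forall t, 0 <= t <= x -> P d t.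
have S0 : S 0.
  split; first by rewrite /in01 lexx ler01.
  have [|d d0 [eta e0 H]] := Ploc 0; first by rewrite /in01 lexx ler01.
  exists d => // t t0; have -> : t = 0 by lra.
  by apply: H; rewrite ?/in01 ?lexx ?ler01 ?subrr ?normr0.
have hS : has_sup S.
  split; first by exists 0.
  by exists 1 => x [/andP[]].
have s0 : 0 <= sup S by apply: sup_upper_bound.
have s1 : sup S <= 1 by apply: ge_sup; [exists 0|move=> x [/andP[]]].
have [|d d0 [eta e0 H]] := Ploc (sup S); first by rewrite /in01 s0 s1.
have [x Sx xs] := sup_adherent e0 hS.
have xle : x <= sup S by apply: sup_upper_bound.
have step y : in01 y -> y < sup S + eta -> S y.
  move=> y01 ys; split => //.
  have [_ [dx dx0 Hx]] := Sx.
  exists (Num.min d dx); first by rewrite lt_min d0 dx0.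
  move=> t /andP[t0 ty].
  have [tx|tx] := leP t x.
    by apply: Pmono (Hx t _); rewrite ?ge_min ?lexx ?orbT ?t0.
  apply: Pmono (H t _ _); rewrite ?ge_min ?lexx //.
    by move/andP: y01 => [? ?]; rewrite /in01 t0 /=; lra.
  by rewrite ltr_norml; apply/andP; split; lra.
have S1 : S 1.
  apply: (step 1); first by rewrite /in01 ler01 lexx.
  have [//|h] := ltP 1 (sup S + eta); clearbody S.
  have Sy : S (sup S + eta / 2).
    apply: step; last by lra.
    by rewrite /in01; apply/andP; split; lra.
  have : sup S + eta / 2 <= sup S by apply: sup_upper_bound.
  by lra.
by have [_ [d' d'0 H']] := S1; exists d'.
Qed.

(** The maximum norm replaces the Euclidean one of [sqdist], so that all estimates are linear in the
    coordinates. *)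
Definition close_pt (d : RR) (p q : pt) : Prop :=
  `|p.1 - q.1| < d /\ `|p.2 - q.2| < d.

Lemma sqdist_close (d : RR) (p q : pt) : 0 < d -> sqdist p q < d ^+ 2 -> close_pt d p q.
Proof.
rewrite /sqdist => d0 H; split.
  rewrite -(ltr_pXn2r (n := 2)) ?nnegrE ?normr_ge0 ?(ltW d0) // real_normK ?num_real //.
  by have := sqr_ge0 (p.2 - q.2); lra.
rewrite -(ltr_pXn2r (n := 2)) ?nnegrE ?normr_ge0 ?(ltW d0) // real_normK ?num_real //.
by have := sqr_ge0 (p.1 - q.1); lra.
Qed.

Lemma cont01_uniform (f : RR -> pt) (eps : RR) : cont01 f -> 0 < eps ->
  exists2 d : RR, 0 < d & forall s t, in01 s -> in01 t -> `|s - t| < d -> close_pt eps (f s) (f t).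
Proof.
move=> cf e0.
have [||d d0 H] := @unit_interval_compact
  (fun d t => forall s, in01 s -> `|s - t| < d -> close_pt eps (f s) (f t)).
- by move=> d d' t dd H s s01 st; apply: H => //; lra.
- move=> t0 t01.
  have e2 : 0 < eps / 2 by lra.
  have [d d0 H] := cf _ t01 _ e2.
  exists (d / 2); first by lra.
  exists (d / 2); first by lra.
  move=> t tI tt0 s sI st.
  have /(sqdist_close e2)[a1 a2] : sqdist (f t) (f t0) < (eps / 2) ^+ 2 by apply: H => //; lra.
  have /(sqdist_close e2)[b1 b2] : sqdist (f s) (f t0) < (eps / 2) ^+ 2.
    apply: H => //; have := ler_normD (s - t) (t - t0).
    have -> : s - t + (t - t0) = s - t0 by ring.
    by lra.
  move: a1 a2 b1 b2; rewrite !ltr_norml => /andP[? ?] /andP[? ?] /andP[? ?] /andP[? ?].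
  by split; rewrite ltr_norml; apply/andP; split; lra.
by exists d => // s t sI tI; apply: H.
Qed.

Definition far_pt (d : RR) (p q : pt) : Prop :=
  d <= `|p.1 - q.1| \/ d <= `|p.2 - q.2|.

Lemma far_pt_close d d' p q r :
  far_pt d p q -> close_pt d' q r -> far_pt (d - d') p r.
Proof.
case=> H [h1 h2]; [left|right].
  have := ler_normD (p.1 - r.1) (r.1 - q.1).
  rewrite (_ : p.1 - r.1 + (r.1 - q.1) = p.1 - q.1); last by ring.
  rewrite (distrC r.1); lra.
have := ler_normD (p.2 - r.2) (r.2 - q.2).
rewrite (_ : p.2 - r.2 + (r.2 - q.2) = p.2 - q.2); last by ring.
rewrite (distrC r.2); lra.
Qed.

Lemma far_pt_sym d p q : far_pt d p q -> far_pt d q p.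
Proof. by rewrite /far_pt [in X in X -> _]distrC (distrC p.2). Qed.

Lemma close_pt_sym d p q : close_pt d p q -> close_pt d q p.
Proof. by rewrite /close_pt [in X in X -> _]distrC (distrC p.2). Qed.

Lemma point_curve_dist (g : RR -> pt) (p : pt) : cont01 g ->
    (forall t, in01 t -> p <> g t) ->
  exists2 d : RR, 0 < d & forall t, in01 t -> far_pt d p (g t).
Proof.
move=> cg ne.
have [||d d0 H] := @unit_interval_compact (fun d t => far_pt d p (g t)).
- by move=> d d' t dd [H|H]; [left|right]; lra.
- move=> t0 t01.
  have [d d0 H] : exists2 d : RR, 0 < d & far_pt d p (g t0).
    case: (eqVneq p.1 (g t0).1) => e1; last first.
      by exists `|p.1 - (g t0).1|; [rewrite normr_gt0 subr_eq0|left].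
    case: (eqVneq p.2 (g t0).2) => e2; last first.
      by exists `|p.2 - (g t0).2|; [rewrite normr_gt0 subr_eq0|right].
    by case: (ne _ t01); apply/eqP; rewrite -pair_eqE /= /pair_eq e1 e2 !eqxx.
  have d2 : 0 < d / 2 by lra.
  have [eta eta0 He] := cg _ t01 _ d2.
  exists (d / 2) => //; exists eta => // t tI tt.
  have /far_pt_close := H => /(_ (d / 2) (g t)).
  have -> : d - d / 2 = d / 2 by lra.
  by apply; apply: close_pt_sym; apply: sqdist_close => //; apply: He.
by exists d.
Qed.

(** The compactness of the square of parameters is used one parameter at a time: first for a point
    and a curve, then along the other curve. *)
Lemma disjoint_curves_dist (f g : RR -> pt) : cont01 f -> cont01 g ->
    (forall s t, in01 s -> in01 t -> f s <> g t) ->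
  exists2 d : RR, 0 < d & forall s t, in01 s -> in01 t -> far_pt d (f s) (g t).
Proof.
move=> cf cg ne.
have [||d d0 H] := @unit_interval_compact
   (fun d s => forall t, in01 t -> far_pt d (f s) (g t)).
- by move=> d d' s dd H t tI; case: (H t tI) => {}H; [left|right]; lra.
- move=> s0 s01.
  have [d d0 H] := point_curve_dist cg (ne s0 ^~ s01).
  have d2 : 0 < d / 2 by lra.
  have [eta eta0 He] := cf _ s01 _ d2.
  exists (d / 2) => //; exists eta => // s sI ss t tI.
  have /far_pt_sym/far_pt_close := H t tI => /(_ (d / 2) (f s)).
  have -> : d - d / 2 = d / 2 by lra.
  move=> h; apply: far_pt_sym; apply: h.
  by apply: close_pt_sym; apply: sqdist_close => //; apply: He.
by exists d => // s t sI tI; apply: H.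
Qed.

(* [upper v] says that the argument of v lies in [0, pi); [ray_cross v w] counts mod 2 the
   crossings of the positive half-line by a short step from v to w. *)
Definition upper (v : pt) : bool := (0 < v.2) || ((v.2 == 0) && (0 < v.1)).
Definition ray_cross (v w : pt) : bool := (upper v (+) upper w) && (0 < v.1).
Definition subpt (p q : pt) : pt := (p.1 - q.1, p.2 - q.2).

(** This is why [upper] includes exactly one of the two horizontal half-lines: of two opposite
    nonzero vectors exactly one is upper. It provides the antisymmetry of [h]. *)
Lemma upper_opp p q : p <> q -> upper (subpt q p) = ~~ upper (subpt p q).
Proof.
move=> ne; rewrite /upper /=.
case: (ltrgtP p.2 q.2) => h2.
- have -> : 0 < q.2 - p.2 by lra.
  have -> : (0 < p.2 - q.2) = false by apply/negbTE; rewrite -leNgt; lra.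
  by have -> : (p.2 - q.2 == 0) = false by apply/negbTE; rewrite subr_eq0; apply/eqP; lra.
- have -> : 0 < p.2 - q.2 by lra.
  have -> : (0 < q.2 - p.2) = false by apply/negbTE; rewrite -leNgt; lra.
  by have -> : (q.2 - p.2 == 0) = false by apply/negbTE; rewrite subr_eq0; apply/eqP; lra.
rewrite h2 !subrr ltxx eqxx /= !subr_gt0.
case: (ltrgtP p.1 q.1) => h1 //.
by case: ne; apply/eqP; rewrite -pair_eqE /= /pair_eq h1 h2 !eqxx.
Qed.

(* Both points are far from the origin but close to each other, hence a change of [upper]
   happens far from the vertical axis. *)
Lemma upper_change d (v w : pt) : (d <= `|v.1| \/ d <= `|v.2|) -> close_pt d v w ->
  upper v != upper w -> d <= `|v.1| /\ (0 < v.1) = (0 < w.1).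
Proof.
case: v w => [a b] [a' b'] /= far; rewrite /close_pt /= !ltr_norml => -[/andP[? ?] /andP[? ?]] h.
have lb : `|b| < d.
  rewrite ltr_norml; move: h; rewrite /upper /=.
  case: (ltrgtP b 0) => hb; case: (ltrgtP b' 0) => hb' //= _; apply/andP; split; lra.
have la : d <= `|a| by case: far; lra.
split=> //; move: la; rewrite ler_normr => /orP[] la.
  have -> : 0 < a by lra.
  by apply/esym; lra.
have /negbTE -> : ~~ (0 < a) by rewrite -leNgt; lra.
by apply/esym/negbTE; rewrite -leNgt; lra.
Qed.

(** A short step that changes [upper] crosses the horizontal axis on one side of the origin, and
    negation exchanges the sides. So exactly one of the two values of [ray_cross] is true for such a
    step, and none for any other. *)
Lemma ray_cross_opp d (p q p' : pt) : far_pt d p q -> close_pt d p p' -> far_pt d p' q ->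
    0 < d ->
  ray_cross (subpt q p) (subpt q p') =
  ray_cross (subpt p q) (subpt p' q) (+) (upper (subpt p q) (+) upper (subpt p' q)).
Proof.
move=> f1 c f2 d0.
have pq r : far_pt d r q -> r <> q.
  by case=> + e; rewrite e subrr normr0; lra.
rewrite /ray_cross (upper_opp (pq _ f1)) (upper_opp (pq _ f2)).
rewrite addNb addbN negbK.
case: (boolP (upper (subpt p q) (+) upper (subpt p' q))) => //= h.
have [|||h1 _] := @upper_change d (subpt p q) (subpt p' q).
- by [].
- by case: c => c1 c2; split => /=; [move: c1|move: c2]; congr (`|_| < _); ring.
- by move: h; case: (upper _); case: (upper _).
move: h1; rewrite /= ler_normr => /orP[] h1.
  have -> : 0 < p.1 - q.1 by lra.
  by apply/negbTE; rewrite -leNgt; lra.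
have -> : (0 < p.1 - q.1) = false by apply/negbTE; rewrite -leNgt; lra.
rewrite /= -/(is_true _); lra.
Qed.

(** The square is too small to surround the origin: corners that differ in [upper] lie on the same
    side of the vertical axis, so the boundary crosses the half-line an even number of times. *)
Lemma ray_cross_square d (a b c e : pt) :
    (forall v, v \in [:: a; b; c; e] -> d <= `|v.1| \/ d <= `|v.2|) ->
    (forall v w, v \in [:: a; b; c; e] -> w \in [:: a; b; c; e] -> close_pt d v w) ->
  ray_cross a b (+) ray_cross b c (+) (ray_cross e c (+) ray_cross a e) = false.
Proof.
move=> far clo.
have key v w : v \in [:: a; b; c; e] -> w \in [:: a; b; c; e] ->
    upper v != upper w -> (0 < v.1) = (0 < w.1).
  move=> iv iw h; exact: (@upper_change d v w (far _ iv) (clo _ _ iv iw) h).2.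
have ia : a \in [:: a; b; c; e] by rewrite !inE eqxx.
have ib : b \in [:: a; b; c; e] by rewrite !inE eqxx ?orbT.
have ic : c \in [:: a; b; c; e] by rewrite !inE eqxx ?orbT.
have ie : e \in [:: a; b; c; e] by rewrite !inE eqxx ?orbT.
move: (key _ _ ia ib) (key _ _ ib ic) (key _ _ ic ie) (key _ _ ia ie) (key _ _ ia ic) (key _ _ ib ie).
rewrite /ray_cross.
move: (upper a) (upper b) (upper c) (upper e) (0 < a.1) (0 < b.1) (0 < c.1) (0 < e.1).
by do 8 case; move=> //= H1 H2 H3 H4 H5 H6; first
  [discriminate (H1 isT)|discriminate (H2 isT)|discriminate (H3 isT)
  |discriminate (H4 isT)|discriminate (H5 isT)|discriminate (H6 isT)].
Qed.

(** * Crossing parities of two sampled curves *)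

Definition crossings (A : nat -> pt) (N : nat) (p : pt) : bool :=
  \big[addb/false]_(i < N) ray_cross (subpt (A i) p) (subpt (A i.+1) p).

Lemma telescope_addb (f : nat -> bool) n :
  \big[addb/false]_(i < n) (f i (+) f i.+1) = f 0%N (+) f n.
Proof.
elim: n => [|n IH]; first by rewrite big_ord0 addbb.
by rewrite big_ord_recr /= IH addbA -(addbA (f 0%N)) addbb addbF.
Qed.

Section Grid.
Variables (A B : nat -> pt) (N : nat) (d : RR).
Hypothesis d_gt0 : 0 < d.
Hypothesis far : forall i j, (i <= N)%N -> (j <= N)%N -> far_pt d (A i) (B j).
Hypothesis closeA : forall i, (i < N)%N -> close_pt (d / 2) (A i) (A i.+1).
Hypothesis closeB : forall i, (i < N)%N -> close_pt (d / 2) (B i) (B i.+1).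

Lemma grid_square i j : (i < N)%N -> (j < N)%N ->
  ray_cross (subpt (A i) (B j)) (subpt (A i.+1) (B j)) (+)
  ray_cross (subpt (A i) (B j.+1)) (subpt (A i.+1) (B j.+1)) =
  ray_cross (subpt (A i) (B j)) (subpt (A i) (B j.+1)) (+)
  ray_cross (subpt (A i.+1) (B j)) (subpt (A i.+1) (B j.+1)).
Proof.
move=> iN jN.
have [a1 a2] := closeA iN; have [b1 b2] := closeB jN.
have := @ray_cross_square d (subpt (A i) (B j)) (subpt (A i.+1) (B j))
   (subpt (A i.+1) (B j.+1)) (subpt (A i) (B j.+1)).
have sub z : z \in [:: subpt (A i) (B j); subpt (A i.+1) (B j); subpt (A i.+1) (B j.+1);
     subpt (A i) (B j.+1)] -> exists i' j', [/\ (i <= i' <= i.+1)%N, (j <= j' <= j.+1)%N &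
     z = subpt (A i') (B j')].
  rewrite !inE => /or4P[] /eqP ->.
  - by exists i, j; rewrite !leqnn !leqnSn.
  - by exists i.+1, j; rewrite !leqnn !leqnSn.
  - by exists i.+1, j.+1; rewrite !leqnn !leqnSn.
  - by exists i, j.+1; rewrite !leqnn !leqnSn.
have dist (C : nat -> RR) k k' m : `|C k - C k.+1| < d / 2 ->
    (k <= k' <= k.+1)%N -> (k <= m <= k.+1)%N -> `|C k' - C m| < d / 2.
  move=> h hk hm; have d2 : 0 < d / 2 by rewrite divr_gt0 // ltr0n.
  have [->|->] : k' = k \/ k' = k.+1 by clear - hk; lia.
    have [->|->] : m = k \/ m = k.+1 by clear - hm; lia.
      by rewrite subrr normr0.
    by [].
  have [->|->] : m = k \/ m = k.+1 by clear - hm; lia.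
    by rewrite distrC.
  by rewrite subrr normr0.
have split_dist (C D : nat -> RR) k k' m m' : `|C k - C k'| < d / 2 -> `|D m - D m'| < d / 2 ->
    `|C k - D m - (C k' - D m')| < d.
  by rewrite !ltr_norml => /andP[? ?] /andP[? ?]; apply/andP; split; lra.
set a := subpt _ _; set b := subpt _ _; set c := subpt _ _; set e := subpt _ _.
move=> h; have {h} : ray_cross a b (+) ray_cross b c (+) (ray_cross e c (+) ray_cross a e) = false.
  apply: h.
    move=> v /sub[i' [j' [hi hj ->]]].
    have i'N : (i' <= N)%N by clear - hi iN; lia.
    have j'N : (j' <= N)%N by clear - hj jN; lia.
    by have [] := far i'N j'N; [left|right].
  move=> v w /sub[i1 [j1 [hi1 hj1 ->]]] /sub[i2 [j2 [hi2 hj2 ->]]].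
  split=> /=.
    apply: (split_dist (fun k => (A k).1) (fun k => (B k).1)).
      exact: (dist (fun k => (A k).1) i).
    exact: (dist (fun k => (B k).1) j).
  apply: (split_dist (fun k => (A k).2) (fun k => (B k).2)).
    exact: (dist (fun k => (A k).2) i).
  exact: (dist (fun k => (B k).2) j).
by case: (ray_cross a b); case: (ray_cross b c); case: (ray_cross e c); case: (ray_cross a e).
Qed.

(** A discrete Stokes formula: summed over the grid, the relations of the small squares telescope in
    both directions and leave the four sides. *)
Lemma grid_boundary :
  crossings A N (B 0%N) (+) crossings A N (B N) =
  \big[addb/false]_(j < N) ray_cross (subpt (A 0%N) (B j)) (subpt (A 0%N) (B j.+1)) (+)
  \big[addb/false]_(j < N) ray_cross (subpt (A N) (B j)) (subpt (A N) (B j.+1)).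
Proof.
rewrite -(telescope_addb (fun j => crossings A N (B j))).
rewrite -big_split /=; apply: eq_bigr => j _.
rewrite -(telescope_addb (fun i => ray_cross (subpt (A i) (B j)) (subpt (A i) (B j.+1)))).
rewrite -big_split /=; apply: eq_bigr => i _.
exact: grid_square.
Qed.

(** On the sides where [A] stands still the curves exchange roles, which negates the difference
    vector; the corrections of [ray_cross_opp] telescope to the values of [upper] that become
    [h]. *)
Lemma crossings_opp k : (k <= N)%N ->
  \big[addb/false]_(j < N) ray_cross (subpt (A k) (B j)) (subpt (A k) (B j.+1)) =
  crossings B N (A k) (+) (upper (subpt (B 0%N) (A k)) (+) upper (subpt (B N) (A k))).
Proof.
move=> kN; rewrite -(telescope_addb (fun j => upper (subpt (B j) (A k)))).
rewrite -big_split /=; apply: eq_bigr => j _.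
apply: (ray_cross_opp (d := d)) => //.
- by apply/far_pt_sym/far => //; exact: ltnW.
- have [h1 h2] := closeB (ltn_ord j); have := d_gt0; split; lra.
- exact/far_pt_sym/far.
Qed.

Lemma grid_relation :
  crossings A N (B 0%N) (+) crossings A N (B N) (+) crossings B N (A 0%N) (+) crossings B N (A N) (+)
  (upper (subpt (B 0%N) (A 0%N)) (+) upper (subpt (B N) (A 0%N)) (+)
   upper (subpt (B 0%N) (A N)) (+) upper (subpt (B N) (A N))) = false.
Proof.
rewrite grid_boundary !crossings_opp //.
move: (crossings B N (A 0%N)) (crossings B N (A N)) (upper (subpt (B 0%N) (A 0%N))).
move: (upper (subpt (B N) (A 0%N))) (upper (subpt (B 0%N) (A N))) (upper (subpt (B N) (A N))).
by do 6 case.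
Qed.

End Grid.

Lemma in01_ratio i N : (0 < N)%N -> (i <= N)%N -> in01 (i%:R / N%:R).
Proof.
move=> N0 iN; rewrite /in01 divr_ge0 ?ler0n //=.
by rewrite ler_pdivrMr ?ltr0n // mul1r ler_nat.
Qed.

(** [N] is taken so large that one sampling step moves either curve by less than half of a distance
    [d] that separates them. *)
Lemma sampled_curves_relation (f g : RR -> pt) : cont01 f -> cont01 g ->
    (forall s t, in01 s -> in01 t -> f s <> g t) ->
  exists N0, forall N, (N0 <= N)%N ->
    let A i := f (i%:R / N%:R) in let B i := g (i%:R / N%:R) in
  crossings A N (g 0) (+) crossings A N (g 1) (+) crossings B N (f 0) (+) crossings B N (f 1) (+)
  (upper (subpt (g 0) (f 0)) (+) upper (subpt (g 1) (f 0)) (+)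
   upper (subpt (g 0) (f 1)) (+) upper (subpt (g 1) (f 1))) = false.
Proof.
move=> cf cg ne.
have [d d0 far] := disjoint_curves_dist cf cg ne.
have d2 : 0 < d / 2 by lra.
have [a a0 Ha] := cont01_uniform cf d2.
have [b b0 Hb] := cont01_uniform cg d2.
pose c := Num.min a b; have c0 : 0 < c by rewrite lt_min a0 b0.
exists (Num.bound c^-1).+1 => N hN A B.
have N0 : (0 < N)%N by apply: leq_trans hN.
have NR : 0 < N%:R :> RR by rewrite ltr0n.
have step : N%:R^-1 < c.
  rewrite invf_plt ?posrE //; apply: lt_le_trans (archi_boundP _) _.
    by rewrite invr_ge0 ltW.
  by rewrite ler_nat ltnW.
have st (i : nat) : `|i%:R / N%:R - i.+1%:R / N%:R| < c.
  rewrite -mulrBl -natr1 opprD addrA subrr add0r mulN1r normrN ger0_norm //.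
  by rewrite invr_ge0 ltW.
have e0 : 0%:R / N%:R = 0 :> RR by rewrite mul0r.
have e1 : N%:R / N%:R = 1 :> RR by rewrite divff // gt_eqF.
have := @grid_relation A B N d d0; rewrite /A /B e0 e1; apply.
- by move=> i j iN jN; apply: far; apply: in01_ratio.
- move=> i iN; apply: Ha; rewrite ?in01_ratio //; try exact: ltnW.
  by apply: lt_le_trans (st i) _; rewrite /c ge_min lexx.
- move=> i iN; apply: Hb; rewrite ?in01_ratio //; try exact: ltnW.
  by apply: lt_le_trans (st i) _; rewrite /c ge_min lexx orbT.
Qed.

Lemma eventually_forall_fin (T : finType) (P : T -> nat -> Prop) :
    (forall x, exists N0, forall N, (N0 <= N)%N -> P x N) ->
  exists N, forall x, P x N.
Proof.
move=> /fin_all_exists[f Hf]; exists (\max_x f x) => x.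
by apply: Hf; apply: leq_bigmax.
Qed.

Theorem planar_van_kampen (T : finType) (e : rel T) : planar e -> van_kampen e.
Proof.
move=> [pos [arc [pos_inj [arcP arc_disj]]]].
have end01 s : in01 s -> [\/ s = 0, s = 1 | in01o s].
  move=> /andP[s0 s1]; rewrite /in01o.
  case: (eqVneq s 0) => [->|n0]; first by constructor 1.
  case: (eqVneq s 1) => [->|n1]; first by constructor 2.
  by constructor 3; rewrite !lt_neqAle s0 s1 n1 eq_sym n0.
(* One [N] must serve all pairs of edges, because [M x y z] has to be the same in the relations of
   all edges disjoint from [xy]. *)
have [N HN] : exists N, forall q : (T * T) * (T * T),
    e q.1.1 q.1.2 -> e q.2.1 q.2.2 -> uniq [:: q.1.1; q.1.2; q.2.1; q.2.2] ->
    let A := arc q.1.1 q.1.2 in let B := arc q.2.1 q.2.2 in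
    let X p := crossings (fun i => A (i%:R / N%:R)) N p in
    let Y p := crossings (fun i => B (i%:R / N%:R)) N p in
    X (B 0) (+) X (B 1) (+) Y (A 0) (+) Y (A 1) (+)
  (upper (subpt (B 0) (A 0)) (+) upper (subpt (B 1) (A 0)) (+)
   upper (subpt (B 0) (A 1)) (+) upper (subpt (B 1) (A 1))) = false.
  apply: eventually_forall_fin => -[[x y] [u v]] /=.
  have [|nxy] := boolP (e x y); last by exists 0%N.
  have [|nuv] := boolP (e u v); last by exists 0%N.
  case: (boolP (uniq [:: x; y; u; v])) => [un|nun]; last by exists 0%N => N _ _ _ un; case/negP: nun.
  move=> euv exy.
  have [cx _ x0 x1 xz] := arcP _ _ exy; have [cu _ u0 u1 uz] := arcP _ _ euv.
  have [xu [xv [yu yv]]] : x <> u /\ x <> v /\ y <> u /\ y <> v.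
    by move: un; rewrite /= !inE !negb_or => /and4P[/and3P[_ /eqP ? /eqP ?] /andP[/eqP ? /eqP ?] _ _].
  have [|N0 HN0] := @sampled_curves_relation (arc x y) (arc u v) cx cu.
    move=> s t /end01 hs /end01 ht.
    case: ht hs => [->|->|ht] [->|->|hs]; rewrite ?x0 ?x1 ?u0 ?u1;
      try (by move=> /pos_inj); try exact: xz; try (by move=> h; apply: (uz _ _ ht (esym h))).
    apply: arc_disj => //.
    by rewrite negb_or !negb_and; apply/andP; split; apply/orP; [left|left]; apply/eqP.
  by exists N0 => N hN _ _ _; exact: HN0.
exists (fun x y z => crossings (fun i => arc x y (i%:R / N%:R)) N (pos z)).
exists (fun x u => upper (subpt (pos u) (pos x))).
split=> [x y /eqP xy|x y u v exy euv un].
  by rewrite upper_opp // => /pos_inj /esym.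
have := HN ((x, y), (u, v)) exy euv un => /=.
have [_ _ -> -> _] := arcP _ _ exy; have [_ _ -> -> _] := arcP _ _ euv.
by [].
Qed.

End PlanarVanKampen.

(** * Maximizing the Rayleigh quotient *)

Section RayleighQuotient.
Import boolp classical_sets functions topology normedtype derive numFieldNormedType.Exports.
Local Open Scope classical_set_scope.
Local Open Scope ring_scope.

Definition qform {R : realType} {n} (A : 'M[R]_n) (x y : 'rV[R]_n) : R :=
  \sum_i \sum_j A i j * x 0 i * y 0 j.

Definition dotv {R : realType} {n} (x y : 'rV[R]_n) : R := \sum_i x 0 i * y 0 i.

Lemma continuous_sum (R : realType) (T : topologicalType) (I : Type) (r : seq I) (F : I -> T -> R) :
  (forall i, continuous (F i)) -> continuous (fun x => \sum_(i <- r) F i x).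
Proof.
move=> cF; elim: r => [|i r IH] x.
  rewrite (_ : (fun x => _) = cst 0); first exact: cvg_cst.
  by apply/funext => y; rewrite big_nil.
rewrite (_ : (fun x => _) = F i + (fun x => \sum_(i <- r) F i x)).
  by apply: cvgD; [exact: cF|exact: IH].
by apply/funext => y; rewrite big_cons.
Qed.

Lemma continuous_mul (R : realType) (T : topologicalType) (f g : T -> R) :
  continuous f -> continuous g -> continuous (fun x => f x * g x).
Proof. by move=> cf cg x; exact: (cvgM (cf x) (cg x)). Qed.

Lemma qform_continuous (R : realType) n (A : 'M[R]_n) : continuous (fun x : 'rV[R]_n => qform A x x).
Proof.
have cc : forall j, continuous (fun x : 'rV[R]_n => x 0 j) by move=> j; apply: coord_continuous.
apply: continuous_sum => i; apply: continuous_sum => j.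
apply: continuous_mul; last exact: cc.
by apply: continuous_mul; [exact: cst_continuous|exact: cc].
Qed.

Lemma dotv_continuous (R : realType) n : continuous (fun x : 'rV[R]_n => dotv x x).
Proof.
have cc : forall j, continuous (fun x : 'rV[R]_n => x 0 j) by move=> j; apply: coord_continuous.
by apply: continuous_sum => i; apply: continuous_mul; exact: cc.
Qed.

Lemma sphere_compact (R : realType) n : compact [set x : 'rV[R]_n | dotv x x = 1].
Proof.
apply: bounded_closed_compact.
  exists 1; split => // M M1 x /= x1.
  rewrite (_ : `|x| = mx_norm x) // mx_normrE; apply: bigmax_le; first by lra.
  move=> [i j] _ /=; rewrite (ord1 i).
  have : `|x 0 j| ^+ 2 <= 1.
    rewrite real_normK ?num_real // -x1 /dotv (bigD1 j) //= -expr2 lerDl.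
    by apply: sumr_ge0 => k _; rewrite -expr2 sqr_ge0.
  by rewrite -[X in _ <= X]( expr1n _ 2) ler_pXn2r ?nnegrE //; lra.
rewrite (_ : [set x | _] = (fun x : 'rV[R]_n => dotv x x) @^-1` [set 1]) //.
apply: preimage_closed; first by move=> x _; apply: dotv_continuous.
exact: closed_eq.
Qed.

Lemma dotv_ge0 (R : realType) n (x : 'rV[R]_n) : 0 <= dotv x x.
Proof. by apply: sumr_ge0 => i _; rewrite -expr2 sqr_ge0. Qed.

Lemma dotv_eq0 (R : realType) n (x : 'rV[R]_n) : (dotv x x == 0) = (x == 0).
Proof.
apply/eqP/eqP => [/eqP|->]; last by rewrite /dotv big1 // => i _; rewrite mxE mul0r.
rewrite psumr_eq0 => [/allP h|i _]; last by rewrite -expr2 sqr_ge0.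
apply/rowP => i; rewrite mxE; apply/eqP.
by have := h i (mem_index_enum _); rewrite /= mulf_eq0 orbb.
Qed.

Lemma qformZ (R : realType) n (A : 'M[R]_n) (a b : R) x y : qform A (a *: x) (b *: y) = a * b * qform A x y.
Proof.
rewrite /qform mulr_sumr; apply: eq_bigr => i _; rewrite mulr_sumr; apply: eq_bigr => j _.
by rewrite !mxE; ring.
Qed.

Lemma qformDl (R : realType) n (A : 'M[R]_n) x x' y : qform A (x + x') y = qform A x y + qform A x' y.
Proof.
rewrite /qform -big_split; apply: eq_bigr => i _ /=; rewrite -big_split; apply: eq_bigr => j _ /=.
by rewrite !mxE; ring.
Qed.

Lemma qformDr (R : realType) n (A : 'M[R]_n) x y y' : qform A x (y + y') = qform A x y + qform A x y'.
Proof.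
rewrite /qform -big_split; apply: eq_bigr => i _ /=; rewrite -big_split; apply: eq_bigr => j _ /=.
by rewrite !mxE; ring.
Qed.

Lemma qform_sym (R : realType) n (A : 'M[R]_n) x y : A^T = A -> qform A x y = qform A y x.
Proof.
move=> AT; rewrite /qform exchange_big; apply: eq_bigr => i _; apply: eq_bigr => j _ /=.
by rewrite -[in LHS]AT mxE; ring.
Qed.

Lemma dotvZ (R : realType) n (a b : R) (x y : 'rV[R]_n) : dotv (a *: x) (b *: y) = a * b * dotv x y.
Proof. by rewrite /dotv mulr_sumr; apply: eq_bigr => i _; rewrite !mxE; ring. Qed.

Lemma dotvDl (R : realType) n (x x' y : 'rV[R]_n) : dotv (x + x') y = dotv x y + dotv x' y.
Proof. by rewrite /dotv -big_split; apply: eq_bigr => i _; rewrite !mxE /=; ring. Qed.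

Lemma dotvC (R : realType) n (x y : 'rV[R]_n) : dotv x y = dotv y x.
Proof. by apply: eq_bigr => i _; rewrite mulrC. Qed.

Lemma qform_delta (R : realType) n (A : 'M[R]_n) x i :
  qform A (delta_mx 0 i) x = \sum_j A i j * x 0 j.
Proof.
rewrite /qform (bigD1 i) //= [X in _ + X]big1 ?addr0.
  by apply: eq_bigr => j _; rewrite mxE !eqxx /= mulr1.
by move=> k /negbTE ki; apply: big1 => j _; rewrite mxE ki andbF mulr0 mul0r.
Qed.

(* A maximizer of the Rayleigh quotient is an eigenvector: the form [rho * dotv - qform] is
   nonnegative and vanishes at [x], so it vanishes to first order there. *)
Lemma rayleigh_stationary (R : realType) n (A : 'M[R]_n) (rho : R) x : A^T = A ->
  (forall y, qform A y y <= rho * dotv y y) -> rho * dotv x x <= qform A x x ->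
  forall i, \sum_j A i j * x 0 j = rho * x 0 i.
Proof.
move=> AT ub lb i; pose y : 'rV[R]_n := delta_mx 0 i.
have dxy : dotv y x = x 0 i.
  rewrite /dotv (bigD1 i) //= mxE !eqxx mul1r big1 ?addr0 // => k /negbTE ki.
  by rewrite mxE ki andbF mul0r.
have dyy : dotv y y = 1 by rewrite /dotv (bigD1 i) //= mxE !eqxx mul1r big1 ?addr0 // => k /negbTE ki;
  rewrite mxE ki andbF mul0r.
rewrite -qform_delta -/y.
have H t : 0 <= (rho - qform A y y) * t ^+ 2 + 2 * (rho * x 0 i - qform A y x) * t.
  have Exy : qform A x (t *: y) = t * qform A y x.
    by rewrite -{1}(scale1r x) qformZ mul1r qform_sym.
  have Eyx : qform A (t *: y) x = t * qform A y x by rewrite -{1}(scale1r x) qformZ mulr1.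
  have Dyx : dotv (t *: y) x = t * x 0 i by rewrite -{1}(scale1r x) dotvZ mulr1 dxy.
  have := ub (x + t *: y).
  rewrite qformDl !qformDr Exy Eyx qformZ dotvDl (dotvC x) (dotvC (t *: y)) !dotvDl.
  rewrite (dotvC x) Dyx dotvZ dyy.
  by move: lb; lra.
set b := rho * x 0 i - qform A y x in H *.
suff : b = 0 by rewrite /b; lra.
set a := rho - qform A y y in H.
have a0 : 0 <= a.
  by have := ub y; rewrite dyy mulr1 /a; lra.
(* At this argument the quadratic is negative unless [b = 0]; the [+ 1] keeps the denominator
   positive even if [a] is 0. *)
have := H (- b / (a + 1)); clear AT.
have a1 : a + 1 != 0 by lra.
have -> : a * (- b / (a + 1)) ^+ 2 + 2 * b * (- b / (a + 1)) = - (b ^+ 2 * (a + 2)) / (a + 1) ^+ 2.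
  by field.
rewrite mulNr oppr_ge0 pmulr_lle0 ?invr_gt0 ?exprn_gt0; try lra.
rewrite pmulr_lle0; last by lra.
by move=> h; apply/eqP; rewrite -sqrf_eq0 eq_le h sqr_ge0.
Qed.

(** A maximizer on the unit sphere may be replaced by its entrywise absolute value, which does not
    decrease the form as the entries of [A] are nonnegative. It is then a nonnegative eigenvector by
    [rayleigh_stationary]. *)
Theorem perron_vector (R : realType) n (A : 'M[R]_n.+1) : A^T = A -> (forall i j, 0 <= A i j) ->
  exists (rho : R) (x : 'rV[R]_n.+1), [/\ x != 0, forall i, 0 <= x 0 i,
    forall i, \sum_j A i j * x 0 j = rho * x 0 i & forall y, qform A y y <= rho * dotv y y].
Proof.
move=> AT A0; pose K := [set x : 'rV[R]_n.+1 | dotv x x = 1].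
have K0 : K !=set0.
  exists (delta_mx 0 0); rewrite /K /= /dotv (bigD1 0) //= mxE !eqxx mul1r big1 ?addr0 // => k /negbTE ki.
  by rewrite mxE ki andbF mul0r.
have [|x xK xmax] := compact_EVT_max K0 (@sphere_compact R n.+1) (f := fun x => qform A x x).
  by apply: continuous_subspaceT; apply: qform_continuous.
have {}xK : dotv x x = 1 by move: xK; rewrite inE.
pose rho := qform A x x; pose z : 'rV[R]_n.+1 := \row_i `|x 0 i|.
have zz : dotv z z = 1.
  by rewrite -xK; apply: eq_bigr => i _; rewrite mxE -expr2 real_normK ?num_real // expr2.
have ub y : qform A y y <= rho * dotv y y.
  have [y0|yn0] := eqVneq y 0.
    by rewrite y0 -(scale0r 0) qformZ dotvZ !mul0r mulr0.
  have dy : 0 < dotv y y by rewrite lt_neqAle dotv_ge0 eq_sym dotv_eq0 yn0.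
  pose c := (Num.sqrt (dotv y y))^-1.
  have c2 : c * c = (dotv y y)^-1.
    by rewrite /c -invfM -expr2 sqr_sqrtr ?dotv_ge0.
  have := xmax (c *: y); rewrite inE /K /= dotvZ qformZ c2 mulVf ?gt_eqF // => /(_ erefl).
  by rewrite mulrC ler_pdivrMr.
exists rho, z; split => //.
- by rewrite -dotv_eq0 zz oner_eq0.
- by move=> i; rewrite mxE.
apply: (rayleigh_stationary AT ub); rewrite zz mulr1 /rho.
apply: ler_sum => i _; apply: ler_sum => j _; rewrite !mxE -!mulrA -normrM.
by apply: ler_wpM2l; [exact: A0|exact: ler_norm].
Qed.

End RayleighQuotient.

(** * Two vertices of large eigenvector weight *)

Definition nbr {T : finType} (e : rel T) (w : T) : {set T} := [set y | e w y].

Section TwoDominating.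
Variables (R : realFieldType) (T : finType) (e : rel T) (x : T -> R) (rho : R) (u : T).
Hypothesis irr : irreflexive e.
Hypothesis sym : symmetric e.
Hypothesis vk : van_kampen e.
Hypothesis x_ge0 : forall w, 0 <= x w.
Hypothesis x_le1 : forall w, x w <= 1.
Hypothesis xu : x u = 1.
Hypothesis rho_gt0 : 0 < rho.
Hypothesis eig : forall w, \sum_(y in nbr e w) x y = rho * x w.
Local Notation N := (#|T|%:R : R).
Hypothesis N_large : 4 * 10 ^+ 16 <= N.
Hypothesis rho_large : 2 * N - 4 <= rho ^+ 2.

Lemma walk2 w : rho ^+ 2 * x w = \sum_(y in nbr e w) \sum_(z in nbr e y) x z.
Proof. by rewrite expr2 -mulrA -eig mulr_sumr; apply: eq_bigr => y _; rewrite eig. Qed.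

Lemma sum_degree : (\sum_w #|nbr e w| <= 6 * #|T|)%N.
Proof.
have := van_kampen_arcs_linear [set: T] irr sym vk; rewrite cardsT; apply: leq_trans.
rewrite /arcs leq_eqVlt; apply/orP; left; apply/eqP.
apply: eq_big => [w|w _]; first by rewrite inE.
by apply: eq_card => y; rewrite !inE.
Qed.

Lemma sum_degree_real (P : pred T) : \sum_(w | P w) #|nbr e w|%:R <= 6 * N.
Proof.
rewrite -natr_sum -natrM ler_nat; apply: leq_trans sum_degree.
by rewrite [X in (_ <= X)%N](bigID P) /= leq_addr.
Qed.

(** As weights are at most 1, a vertex of weight at least [eps] has degree at least [rho * eps], and
    the degrees sum to at most [6 * N]. *)
Lemma threshold_card (eps : R) : 0 < eps ->
  #|[set z | eps <= x z]|%:R * (rho * eps) <= 6 * N.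
Proof.
move=> e0; apply: le_trans (sum_degree_real (mem [set z | eps <= x z])).
rewrite -sumr_const mulr_suml; apply: ler_sum => z; rewrite inE => ez.
rewrite mul1r; apply: (@le_trans _ _ (rho * x z)); first by rewrite ler_pM2l.
rewrite -eig -sumr_const; exact: ler_sum.
Qed.

Lemma threshold_walk2 (eps : R) w : 0 <= eps ->
  rho ^+ 2 * x w <= \sum_(y in nbr e w) \sum_(z in nbr e y :&: [set z | eps <= x z]) x z + 6 * N * eps.
Proof.
move=> e0; rewrite walk2.
apply: (@le_trans _ _ (\sum_(y in nbr e w) (\sum_(z in nbr e y :&: [set z | eps <= x z]) x z
   + #|nbr e y|%:R * eps))).
  apply: ler_sum => y _; rewrite (big_setID [set z | eps <= x z]) /= lerD2l.
  apply: (@le_trans _ _ (\sum_(z in nbr e y :\: [set z | eps <= x z]) eps)).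
    by apply: ler_sum => z; rewrite !inE -ltNge => /andP[/ltW].
  rewrite sumr_const -(mulr_natl eps); apply: ler_wpM2r => //; rewrite ler_nat.
  by apply: subset_leq_card; apply: subsetDl.
rewrite big_split /= lerD2l -mulr_suml; apply: ler_wpM2r => //.
exact: sum_degree_real.
Qed.

(** All the pairs counted are arcs inside the union of the neighbourhood and [L], whose number is
    linear in its size. *)
Lemma walk2_arcs (L : {set T}) w :
  (\sum_(y in nbr e w) #|nbr e y :&: L| <= 6 * (#|nbr e w| + #|L|))%N.
Proof.
apply: (@leq_trans (arcs e (nbr e w :|: L))); last first.
  apply: leq_trans (van_kampen_arcs_linear _ irr sym vk) _.
  by rewrite leq_mul2l /= cardsU leq_subr.
rewrite /arcs [X in (_ <= X)%N](big_setID (nbr e w)) /=.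
rewrite (_ : (_ :|: _) :&: _ = nbr e w); last by apply/setIidPr/subsetUl.
apply: leq_trans (leq_addr _ _); apply: leq_sum => y _; apply: subset_leq_card.
by apply/subsetP => z; rewrite !inE => /andP[-> ->]; rewrite orbT.
Qed.

Lemma rho_lower : 28 * 10 ^+ 7 <= rho.
Proof.
rewrite leNgt; apply/negP => h.
have : rho ^+ 2 < (28 * 10 ^+ 7) ^+ 2 by rewrite ltr_pXn2r // nnegrE; have := rho_gt0; lra.
by have := rho_large; have := N_large; lra.
Qed.

Lemma weight_degree w : rho ^+ 2 * x w <= 6 * #|nbr e w|%:R + 18 / 10 ^+ 4 * N.
Proof.
(* With this threshold the light endpoints contribute at most [6 * N / 7000], and there are at most
   [3 * N / 20000] heavy vertices, counted six times; together this is below [18 / 10^4 * N]. *)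
have e0 : 0 < 1 / (7 * 10 ^+ 3) :> R by lra.
apply: le_trans (threshold_walk2 w (ltW e0)) _.
set L := [set z | _].
have hL : #|L|%:R * 28 * 10 ^+ 7 <= 42 * 10 ^+ 3 * N.
  have := threshold_card e0; rewrite -/L; have : 28 * 10 ^+ 7 * #|L|%:R <= rho * #|L|%:R.
    by apply: ler_wpM2r rho_lower.
  lra.
have : \sum_(y in nbr e w) \sum_(z in nbr e y :&: L) x z <= 6 * (#|nbr e w|%:R + #|L|%:R).
  rewrite -natrD -natrM; apply: le_trans (_ : (\sum_(y in nbr e w) #|nbr e y :&: L|)%:R <= _); last first.
    by rewrite ler_nat walk2_arcs.
  rewrite natr_sum; apply: ler_sum => y _; rewrite -sumr_const; exact: ler_sum.
by have := N_large; lra.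
Qed.

Local Notation L := [set z | 1 / 400 <= x z].

(** A heavy vertex has degree at least [N / 2000] by [weight_degree], so the bound on the sum of
    degrees leaves room for a number of them that does not grow with [N]. *)
Lemma heavy_card : (#|L| <= 12 * 10 ^ 3)%N.
Proof.
have heavy z : z \in L -> N / (2 * 10 ^+ 3) <= #|nbr e z|%:R.
  rewrite inE => hz; have := weight_degree z.
  have : (2 * N - 4) * (1 / 400) <= rho ^+ 2 * x z.
    apply: ler_pM => //; have := N_large; have := rho_large; lra.
  by have := N_large; lra.
have : \sum_(z in L) N / (2 * 10 ^+ 3) <= 6 * N.
  apply: le_trans (sum_degree_real (mem L)); exact: ler_sum.
rewrite sumr_const -(mulr_natl (N / (2 * 10 ^+ 3))) => h.
rewrite -(ler_nat R) natrM natrX; rewrite leNgt; apply/negP => h2.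
have N0 : 0 < N by have := N_large; lra.
have := ltr_pM2r N0 (12 * 10 ^+ 3) #|L|%:R; rewrite h2 => h3.
by move: h h3; lra.
Qed.

(* Beyond the first, every heavy neighbour of y is paid for by a pair of heavy vertices having
   y as a common neighbour with w, of which there are at most two. *)
Lemma heavy_walk2 w : w \in L ->
  (\sum_(y in nbr e w) #|nbr e y :&: (L :\ w)| <= #|nbr e w| + 2 * #|L| ^ 3)%N.
Proof.
move=> wL; set K := L :\ w.
pose prs := [set p in setX K K | p.1 != p.2].
have KL : (#|K| <= #|L|)%N by apply/subset_leq_card/subD1set.
have step y : (#|nbr e y :&: K| <= 1 + #|L| * \sum_(p in prs) (e y p.1 && e y p.2))%N.
  have [small|/card_gt1P[z [z' [zK z'K zz']]]] := leqP #|nbr e y :&: K| 1.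
    by apply: leq_trans small _; rewrite leq_addr.
  apply: leq_trans (leq_addl _ _); apply: (@leq_trans (#|L| * 1)).
    by rewrite muln1; apply: leq_trans KL; apply/subset_leq_card/subsetIr.
  rewrite leq_mul2l; apply/orP; right.
  move: zK z'K; rewrite !in_setI => /andP[+ zK] /andP[+ z'K]; rewrite ![_ \in nbr _ _]inE => yz yz'.
  rewrite (bigD1 (z, z')) /=; first by rewrite yz yz' leq_addr.
  by rewrite /prs inE in_setX zK z'K.
apply: (@leq_trans (\sum_(y in nbr e w) (1 + #|L| * \sum_(p in prs) (e y p.1 && e y p.2)))%N).
  exact: leq_sum.
rewrite big_split /= sum1_card leq_add2l -big_distrr /= exchange_big /=.
rewrite expnS mulnCA leq_mul2l; apply/orP; right.
apply: (@leq_trans (\sum_(p in prs) 2)%N); last first.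
  rewrite sum_nat_const mulnC leq_mul2l /=; apply: (@leq_trans #|setX K K|).
    by apply/subset_leq_card/subsetP => p; rewrite !inE => /andP[].
  by rewrite cardsX -mulnn leq_mul.
apply: leq_sum => -[z z']; rewrite /prs !inE /= => /andP[/andP[/andP[zw _] /andP[z'w _]] zz'].
rewrite -card_set_sum.
have := @van_kampen_common3 T e [set: T] w z z' irr vk.
rewrite /= !inE negb_or zz' !(eq_sym w) zw z'w => /(_ isT); apply: leq_trans.
apply: subset_leq_card; apply/subsetP => y; rewrite !inE => /and3P[-> yz yz'].
by rewrite /= sym yz sym yz'.
Qed.

(** Walks of length two that return to [w] contribute [x w] per neighbour. Those to other heavy
    vertices number about one per neighbour, each worth at most [beta]; light endpoints contribute
    at most [6 * N / 400]. *)
Lemma heavy_weight (beta : R) w : w \in L -> 0 <= beta <= 1 -> (forall z, z != w -> x z <= beta) ->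
  rho ^+ 2 * x w <= #|nbr e w|%:R * (x w + beta) + 151 / 10 ^+ 4 * N.
Proof.
move=> wL /andP[b0 b1] hb.
have e0 : 0 <= 1 / 400 :> R by lra.
apply: le_trans (threshold_walk2 w e0) _.
have : \sum_(y in nbr e w) \sum_(z in nbr e y :&: L) x z <=
   #|nbr e w|%:R * x w + beta * (\sum_(y in nbr e w) #|nbr e y :&: (L :\ w)|)%:R.
  rewrite mulr_natl -sumr_const natr_sum mulr_sumr -big_split /=; apply: ler_sum => y yw.
  rewrite (big_setD1 w) /=; last by move: yw; rewrite !inE sym => ->; move: wL; rewrite inE.
  rewrite lerD2l mulr_natr -sumr_const.
  rewrite (_ : (nbr e y :&: L) :\ w = nbr e y :&: (L :\ w)); last by rewrite setIDA.
  by apply: ler_sum => z; rewrite !inE => /and3P[_ zw _]; apply: hb.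
(* This estimate uses the size of [N]: the left side is at most [3.456 * 10^12], the right side at
   least [4 * 10^12]. *)
have k3 : (2 * #|L| ^ 3)%:R <= 1 / 10 ^+ 4 * N :> R.
  have hk : #|L|%:R <= 12 * 10 ^+ 3 :> R by have := heavy_card; rewrite -(ler_nat R) natrM natrX.
  have : (#|L| ^ 3)%:R <= (12 * 10 ^+ 3 : R) ^+ 3.
    by rewrite natrX; apply: lerXn2r; rewrite ?nnegrE ?ler0n // (le_trans _ hk) ?ler0n.
  by rewrite natrM; have := N_large; lra.
have : beta * (\sum_(y in nbr e w) #|nbr e y :&: (L :\ w)|)%:R <= beta * #|nbr e w|%:R + 1 / 10 ^+ 4 * N.
  have h1 := heavy_walk2 wL; rewrite -(ler_nat R) natrD in h1.
  have h2 := ler_wpM2l b0 h1; apply: le_trans h2 _; rewrite mulrDr lerD2l.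
  by apply: le_trans k3; rewrite ler_piMl ?ler0n.
by have := N_large; lra.
Qed.

(** Let [v] be the heaviest vertex besides [u]. Since [rho ^+ 2] is nearly [2 * N], the inequality
    of [heavy_weight] at [u] forces [x v] close to 1, and then both degrees are close to [N]. A
    third vertex sees at most two of the common neighbours, so its degree, and by [weight_degree]
    its weight, is small. *)
Theorem two_dominating : exists v, [/\ u != v, 98 / 100 <= x v,
  (forall w, w != u -> w != v -> x w <= 1 / 10) & 9 / 10 * N <= #|nbr e u :&: nbr e v|%:R].
Proof.
have N0 := N_large.
have uL : u \in L by rewrite inE xu; lra.
have dN w : #|nbr e w|%:R <= N by rewrite ler_nat max_card.
have [v0 v0u] : exists v, v != u.
  apply/existsP; rewrite -negb_forall; apply/negP => /forallP h.
  have : (#|T| <= 1)%N by apply/card_le1P => a _ b; rewrite !inE; rewrite (eqP (h a)) (eqP (h b)) !eqxx.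
  by rewrite -(ler_nat R); lra.
pose v := [arg max_(i > v0 | i != u) x i]%O.
have [vu vmax] : v != u /\ forall z, z != u -> x z <= x v.
  by rewrite /v; case: arg_maxP => // i iu imax; split.
have hu := @heavy_weight (x v) u uL ltac:(by rewrite x_ge0 x_le1) vmax.
rewrite xu mulr1 in hu.
have du := dN u; have dv := dN v; have xv0 := x_ge0 v; have xv1 := x_le1 v.
have du0 : 0 <= #|nbr e u|%:R :> R by rewrite ler0n.
have rl := rho_large.
have N4 : 0 <= 2 * N - 4 by move: N0; lra.
have p1 : #|nbr e u|%:R * (1 + x v) <= #|nbr e u|%:R * 2 by apply: ler_wpM2l => //; lra.
have p2 : #|nbr e u|%:R * (1 + x v) <= N * (1 + x v) by apply: ler_wpM2r => //; lra.
have xv : 984 / 1000 <= x v.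
  rewrite leNgt; apply/negP => h.
  have : N * (1 + x v) <= N * (1984 / 1000) by apply: ler_wpM2l; lra.
  lra.
have vL : v \in L by rewrite inE; lra.
have hv := @heavy_weight 1 v vL ltac:(by rewrite ler01 lexx) ltac:(by move=> *; exact: x_le1).
have p3 : (2 * N - 4) * (984 / 1000) <= rho ^+ 2 * x v by apply: ler_pM; rewrite ?divr_ge0.
have p4 : #|nbr e v|%:R * (x v + 1) <= #|nbr e v|%:R * 2 by apply: ler_wpM2l; rewrite ?ler0n //; lra.
have common : 968 / 1000 * N <= #|nbr e u :&: nbr e v|%:R.
  have := cardsUI (nbr e u) (nbr e v) => /(congr1 (fun k => k%:R : R)); rewrite !natrD.
  have : #|nbr e u :|: nbr e v|%:R <= N by rewrite ler_nat max_card.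
  by move: p1 p3 p4 hu hv xv1 xv N0; lra.
exists v; rewrite eq_sym; split=> //; [by move: xv; lra| |by move: common N0; lra].
move=> w wu wv.
have dw : #|nbr e w|%:R <= 32 / 1000 * N + 2.
  have h1 : (#|nbr e w :&: (nbr e u :&: nbr e v)| <= 2)%N.
    have := @van_kampen_common3 T e [set: T] w u v irr vk.
    rewrite /= !inE negb_or wu wv eq_sym vu => /(_ isT); apply: leq_trans.
    by apply: subset_leq_card; apply/subsetP => y; rewrite !inE => /and3P[-> -> ->].
  have h2 : (#|nbr e w| <= 2 + #|~: (nbr e u :&: nbr e v)|)%N.
    rewrite -(cardsID (nbr e u :&: nbr e v) (nbr e w)); apply: leq_add => //.
    by apply: subset_leq_card; apply/subsetP => y; rewrite !inE => /andP[].
  have h3 := cardsC (nbr e u :&: nbr e v).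
  move: h2; rewrite -(ler_nat R) natrD.
  by move: h3 common => /(congr1 (fun k => k%:R : R)); rewrite natrD; lra.
have := weight_degree w => hw.
rewrite leNgt; apply/negP => h.
have : (2 * N - 4) * (1 / 10) <= rho ^+ 2 * x w by apply: ler_pM N4 _ rl (ltW h); rewrite divr_ge0.
by move: hw dw N0; lra.
Qed.

End TwoDominating.

(** * Linear forests and their joins with an edge *)

Local Open Scope nat_scope.

(** A path is the list of its vertices, so that a forest can live in any vertex type; [fadj_index]
    translates to the numbered blocks of [path_adj]. *)
Definition padj {T : eqType} (p : seq T) (x y : T) : bool :=
  [&& x \in p, y \in p & (index y p == (index x p).+1) || (index x p == (index y p).+1)].

Definition fadj {T : eqType} (ps : seq (seq T)) (x y : T) : bool := has (fun p => padj p x y) ps.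

Lemma padj_sym (T : eqType) (p : seq T) : symmetric (padj p).
Proof. by move=> x y; rewrite /padj andbCA orbC. Qed.

Lemma fadj_sym (T : eqType) (ps : seq (seq T)) : symmetric (fadj ps).
Proof. by move=> x y; apply: eq_has => p; rewrite padj_sym. Qed.

Lemma padj_irr (T : eqType) (p : seq T) : irreflexive (padj p).
Proof. by move=> x; rewrite /padj orbb -[X in X == _]addn0 -addn1 eqn_add2l !andbF. Qed.

Lemma fadj_irr (T : eqType) (ps : seq (seq T)) : irreflexive (fadj ps).
Proof. by move=> x; apply/hasP => -[p _]; rewrite padj_irr. Qed.

Lemma fadj_mem (T : eqType) (ps : seq (seq T)) x y : fadj ps x y -> x \in flatten ps.
Proof. by move=> /hasP[p pps /and3P[xp _ _]]; apply/flattenP; exists p. Qed.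

Lemma block_starts_cons a s : block_starts (a :: s) = a :: map (addn a) (block_starts s).
Proof.
rewrite /block_starts /= take0 addn0; congr (_ :: _).
rewrite -map_comp (iotaDl 1 1) -map_comp; apply: eq_map => k /=.
by [].
Qed.

Lemma path_adj_cons a s i j : path_adj (a :: s) (a + i) (a + j) = path_adj s i j.
Proof.
rewrite /path_adj block_starts_cons !inE -!addnS !eqn_add2l.
have mem k : (a + k \in map (addn a) (block_starts s)) = (k \in block_starts s).
  by rewrite mem_map // => x y; apply: addnI.
have e0 k : (a + k == a) = (k == 0) by rewrite -[X in _ == X]addn0 eqn_add2l.
rewrite !mem !e0.
by case: j i => [|j] [|i].
Qed.

Lemma path_adj_head a s i j : i < a -> j < a -> path_adj (a :: s) i j = (j == i.+1) || (i == j.+1).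
Proof.
move=> ia ja; rewrite /path_adj block_starts_cons.
have nin k : k < a -> k \notin a :: map (addn a) (block_starts s).
  move=> ka; rewrite inE negb_or neq_ltn ka /=; apply/mapP => -[m _ km]; lia.
by rewrite !nin ?andbT.
Qed.

Lemma path_adj_cross a s i j : i < a -> path_adj (a :: s) i (a + j) = false.
Proof.
move=> ia; rewrite /path_adj block_starts_cons !inE.
apply/negbTE; rewrite negb_or !negb_and !negbK; apply/andP; split; last first.
  by apply/orP; left; apply/eqP; lia.
case: (eqVneq (a + j) i.+1) => //= h; apply/orP; left; apply/eqP; lia.
Qed.

Lemma path_adj_sym s i j : path_adj s i j = path_adj s j i.
Proof. by rewrite /path_adj orbC. Qed.

Lemma fadj_index (T : eqType) (ps : seq (seq T)) x y :
  uniq (flatten ps) -> x \in flatten ps -> y \in flatten ps ->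
  fadj ps x y = path_adj (map size ps) (index x (flatten ps)) (index y (flatten ps)).
Proof.
elim: ps => //= p ps IH; rewrite cat_uniq => /and3P[up /hasPn dis ufl].
rewrite !mem_cat !index_cat /fadj /= -/(fadj ps x y).
have nin z : z \in p -> z \in flatten ps = false.
  by move=> zp; apply/negbTE; apply: contraL zp => /dis.
case: (boolP (x \in p)) => xp; case: (boolP (y \in p)) => yp /= xm ym.
- rewrite path_adj_head ?index_mem // /padj xp yp /=.
  have -> : fadj ps x y = false by apply: contraFF (nin x xp) => /fadj_mem.
  by rewrite orbF.
- rewrite path_adj_cross ?index_mem // /padj (negbTE yp) andbF /=.
  by apply: contraFF (nin x xp) => /fadj_mem.
- rewrite path_adj_sym path_adj_cross ?index_mem // /padj (negbTE xp) /=.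
  by rewrite fadj_sym; apply: contraFF (nin y yp) => /fadj_mem.
by rewrite path_adj_cons /padj (negbTE xp) /= IH.
Qed.

Lemma sorted_padj (T : eqType) (g : rel T) (p : seq T) x y :
  symmetric g -> sorted g p -> padj p x y -> g x y.
Proof.
move=> sym sp /and3P[xp yp /orP[] /eqP E].
  have := sortedP x sp; move/(_ (index x p)); rewrite -E index_mem yp => /(_ isT).
  by rewrite !nth_index.
have := sortedP x sp; move/(_ (index y p)); rewrite -E index_mem xp => /(_ isT).
by rewrite sym !nth_index.
Qed.

Lemma padj_nth (T : eqType) (p : seq T) x0 i : uniq p -> i.+1 < size p ->
  padj p (nth x0 p i) (nth x0 p i.+1).
Proof. by move=> up ip; rewrite /padj !mem_nth ?(ltnW ip) // !index_uniq ?(ltnW ip) // eqxx. Qed.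

Lemma padj_sorted (T : eqType) (g : rel T) (p : seq T) :
  uniq p -> (forall x y, padj p x y -> g x y) -> sorted g p.
Proof.
case: p => // x0 p up H; apply/(sortedP x0) => i ip; apply: H.
exact: padj_nth.
Qed.

Lemma shape_nseq (T : Type) (ps : seq (seq T)) t l :
  size ps = t -> all (fun p => size p == l) ps -> map size ps = nseq t l.
Proof. by move=> <-; elim: ps => //= p ps IH /andP[/eqP -> /IH ->]. Qed.

(** Copies of [tP_l] become lists of vertices, which can be cut, concatenated and mapped. *)
Lemma contains_tP (T : finType) (g : rel T) (t l : nat) : symmetric g ->
  contains_sub (tP t l) g <->
  exists ps : seq (seq T), [/\ size ps = t, all (fun p => size p == l) ps, uniq (flatten ps)
                             & all (sorted g) ps].
Proof.
move=> sym; split; last first.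
  case=> ps [ts ls uf sg].
  have shE : map size ps = nseq t l by apply: shape_nseq.
  have szE : size (flatten ps) = sumn (nseq t l) by rewrite size_flatten /shape shE.
  case E : (flatten ps) => [|x0 fl].
    have n0 (x : 'I_(sumn (nseq t l))) : False by case: x => m; rewrite -szE E.
    by exists (fun i => False_rect T (n0 i)); split=> [i|i j]; case: (n0 i).
  exists (fun i : 'I_(sumn (nseq t l)) => nth x0 (flatten ps) i); split.
    move=> i j /eqP; rewrite nth_uniq ?szE ?ltn_ord // => /eqP; exact: val_inj.
  move=> i j; rewrite /tP /paths_graph => ij.
  have : fadj ps (nth x0 (flatten ps) i) (nth x0 (flatten ps) j).
    by rewrite fadj_index ?mem_nth ?szE ?ltn_ord // !index_uniq ?szE ?ltn_ord // shE.
  by case/hasP => p pps; apply: sorted_padj => //; apply: (allP sg).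
case=> f [finj fE].
pose en := [seq f i | i <- enum 'I_(sumn (nseq t l))].
pose ps := reshape (nseq t l) en.
have ssz : size en = sumn (nseq t l) by rewrite size_map size_enum_ord.
have shE : map size ps = nseq t l by apply: reshapeKl; rewrite ssz.
have flE : flatten ps = en by apply: reshapeKr; rewrite ssz.
have uen : uniq en by rewrite map_inj_uniq // enum_uniq.
exists ps; split.
- by rewrite -(size_map size) shE size_nseq.
- by rewrite -(all_map size (fun k => k == l)) shE all_nseq eqxx orbT.
- by rewrite flE.
have path_uniq p : p \in ps -> uniq p.
  move: uen; rewrite -flE; elim: (ps) => //= q qs IH; rewrite cat_uniq => /and3P[uq _ uqs].
  by rewrite inE => /orP[/eqP ->|/IH]; last exact.
apply/allP => p pps; apply: padj_sorted; first exact: path_uniq.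
move=> x y pxy.
have fxy : fadj ps x y by apply/hasP; exists p.
have xfl := fadj_mem fxy; have yfl : y \in flatten ps by apply: (@fadj_mem _ _ y x); rewrite fadj_sym.
have ufl : uniq (flatten ps) by rewrite flE.
move: fxy; rewrite fadj_index // shE.
move: xfl yfl; rewrite flE => /mapP[i _ ->] /mapP[j _ ->].
rewrite !index_map // -!enumT !index_enum_ord; exact: fE.
Qed.

Definition join_decomp {T : finType} (g : rel T) (u v : T) (ps : seq (seq T)) : Prop :=
  [/\ uniq (u :: v :: flatten ps), forall x, x \in u :: v :: flatten ps &
      forall x y, g x y = (x != y) && [|| x \in [:: u; v], y \in [:: u; v] | fadj ps x y]].

Lemma join_decomp_card (T : finType) (g : rel T) u v ps :
  join_decomp g u v ps -> #|T| = (sumn (map size ps)).+2.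
Proof.
case=> un cov _; rewrite -[sumn _](size_flatten ps) -[_.+2]/(size (u :: v :: flatten ps)).
rewrite -(card_uniqP un); apply/esym/eq_card => x; rewrite cov; exact/esym.
Qed.

Lemma join_decomp_iso (T : finType) (g : rel T) u v ps s :
  join_decomp g u v ps -> map size ps = s -> isomorphic g (K2_join s).
Proof.
move=> dec <- {s}; have cT := join_decomp_card dec; case: dec => un cov gE.
pose w := u :: v :: flatten ps.
have szw : size w = (sumn (map size ps)).+2 by rewrite /= size_flatten.
have lt x : index x w < (sumn (map size ps)).+2 by rewrite -szw index_mem cov.
pose f x : 'I_(sumn (map size ps)).+2 := Ordinal (lt x).
have finj : injective f.
  move=> x y /(congr1 val) E; have {}E : index x w = index y w := E.
  by have := nth_index u (cov x); rewrite -/w E nth_index //; exact: cov.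
exists f; split; first by apply: inj_card_bij => //; rewrite card_ord cT.
have small x : (f x < 2) = (x \in [:: u; v]).
  by rewrite /= !inE (eq_sym x) (eq_sym x); case: (u == x); case: (v == x).
have large x : x \notin [:: u; v] -> (x \in flatten ps) /\ f x - 2 = index x (flatten ps).
  move=> xn; split; first by have := cov x; rewrite !inE orbA -mem_seq2 (negbTE xn).
  move: xn; rewrite !inE negb_or !(eq_sym x) /= => /andP[/negbTE -> /negbTE ->].
  by rewrite subn2.
move=> x y; rewrite gE /K2_join !small (inj_eq finj); congr (_ && _).
case: (boolP (x \in [:: u; v])) => // xn; case: (boolP (y \in [:: u; v])) => // yn.
rewrite !orFb; have [xf xE] := large x xn; have [yf yE] := large y yn.
rewrite fadj_index //; last by move: un => /= /and3P[].
by rewrite -xE -yE.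
Qed.

Lemma K2_join_decomp s : exists u v ps, join_decomp (K2_join s) u v ps /\ map size ps = s.
Proof.
pose c i : 'I_(sumn s).+2 := lift ord0 (lift ord0 i).
pose en := [seq c i | i <- enum 'I_(sumn s)].
pose v : 'I_(sumn s).+2 := lift ord0 ord0.
have cE i : c i = i.+2 :> nat by rewrite /c !lift0.
have cinj : injective c by move=> i j /lift_inj/lift_inj.
have vE : v = 1 :> nat by rewrite /v lift0.
clearbody c v.
have ssz : size en = sumn s by rewrite size_map size_enum_ord.
have shE : map size (reshape s en) = s by apply: reshapeKl; rewrite ssz.
have flE : flatten (reshape s en) = en by apply: reshapeKr; rewrite ssz.
have uen : uniq en by rewrite map_inj_uniq // enum_uniq.
have men (x : 'I_(sumn s).+2) : 2 <= x -> exists2 i, x = c i & i = x - 2 :> nat.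
  move=> x2; have xs : x - 2 < sumn s by have := ltn_ord x; lia.
  by exists (Ordinal xs) => //; apply: ord_inj; rewrite cE /=; lia.
have small (x : 'I_(sumn s).+2) : (x < 2) = (x \in [:: ord0; v]).
  by rewrite !inE -!val_eqE /= vE; lia.
exists ord0, v, (reshape s en); split=> //; split.
- rewrite flE /= !inE negb_or uen andbT -andbA; apply/and3P; split.
    by rewrite -val_eqE /= vE.
    by apply/mapP => -[i _ /(congr1 (@nat_of_ord _))]; rewrite cE.
  by apply/mapP => -[i _ /(congr1 (@nat_of_ord _))]; rewrite cE vE.
- move=> x; rewrite flE; case: (ltnP x 2) => x2.
    by move: x2; rewrite small !inE => /orP[] ->; rewrite ?orbT.
  have [i -> _] := men x x2; rewrite !inE [c i \in en]map_f ?orbT //; exact: mem_enum.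
move=> x y; rewrite /K2_join !small; congr (_ && _).
case: (boolP (x \in _)) => //= xn; case: (boolP (y \in _)) => //= yn.
move: xn yn; rewrite -!small -!leqNgt => /men[i -> iE] /men[j -> jE].
rewrite -iE -jE fadj_index ?flE // ?map_f ?mem_enum // shE !index_map //.
by rewrite -!enumT !index_enum_ord.
Qed.

Lemma join_decomp_perm (T : finType) (g : rel T) u v ps ps' :
  perm_eq ps ps' -> join_decomp g u v ps -> join_decomp g u v ps'.
Proof.
move=> pp [un cov gE]; have pf : perm_eq (u :: v :: flatten ps) (u :: v :: flatten ps').
  by rewrite !perm_cons; exact: perm_flatten.
split; first by rewrite -(perm_uniq pf).
  by move=> x; rewrite -(perm_mem pf).
by move=> x y; rewrite gE /fadj (perm_has _ pp).
Qed.

Ltac plain_lia :=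
  repeat match goal with
  | H : forall _, _ |- _ => clear H
  | H : is_true (uniq _) |- _ => clear H
  | H : is_true (all _ _) |- _ => clear H
  | H : is_true (sorted _ _) |- _ => clear H
  | H : is_true (_ \in _) |- _ => clear H
  | H : is_true (_ \notin _) |- _ => clear H
  end; lia.

(* By splitting off a longest path. *)
Lemma linear_forest_paths (T : finType) (h : rel T) (R : {set T}) :
  irreflexive h -> symmetric h -> (forall x, x \in R -> #|[set y in R | h x y]| <= 2) ->
  (forall C : {set T}, C \subset R -> C != set0 -> exists2 x, x \in C & #|[set y in C | h x y]| <= 1) ->
  exists ps : seq (seq T), [/\ uniq (flatten ps), flatten ps =i R, (forall p, p \in ps -> p != [::]) &
    {in R &, forall x y, h x y = fadj ps x y}].
Proof.
move=> irr sym; have [m] := ubnP #|R|; elim: m R => // m IH R; rewrite ltnS => Rm deg2 forest.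
have [->|/set0Pn[x1 x1R]] := eqVneq R set0.
  by exists [::]; split=> // [x|x y]; rewrite ?inE.
pose P k := [exists t : k.-tuple T, [&& uniq t, all (mem R) t & sorted h t]].
have P1 : exists k, P k by exists 1; apply/existsP; exists [tuple x1]; rewrite /= x1R.
have Pbound k : P k -> k <= #|R|.
  move=> /existsP[t /and3P[ut tR _]]; rewrite -(size_tuple t) -(card_uniqP ut).
  by apply: subset_leq_card; apply/subsetP => x /(allP tR).
case: (ex_maxnP P1 Pbound) => a /existsP[t /and3P[ut0 tR0 st0]] amax.
have [p [szp ut tR st]] : exists p : seq T, [/\ size p = a, uniq p, all (mem R) p & sorted h p].
  by exists t; rewrite size_tuple.
have longest q : uniq q -> all (mem R) q -> sorted h q -> size q <= a.
  by move=> uq qR sq; apply: amax; apply/existsP; exists (in_tuple q); rewrite /= uq qR sq.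
have a0 : 0 < a by apply: (amax 1); apply/existsP; exists [tuple x1]; rewrite /= x1R.
have pR x : x \in p -> x \in R by move=> /(allP tR).
have hnth i : i.+1 < a -> h (nth x1 p i) (nth x1 p i.+1).
  by move=> ia; have /(sortedP x1) := st; apply; rewrite szp.
have two (C : {set T}) x y z : y \in C -> z \in C -> y != z -> h x y -> h x z -> 1 < #|[set w in C | h x w]|.
  move=> yC zC yz xy xz; have := subset_leq_card (_ : [set y; z] \subset [set w in C | h x w]).
  rewrite cards2 yz; apply; apply/subsetP => w; rewrite !inE => /orP[] /eqP ->; by rewrite ?yC ?zC.
have nthE i j : i < a -> j < a -> (nth x1 p i == nth x1 p j) = (i == j).
  by move=> ia ja; rewrite nth_uniq ?szp.
(* A chord would close a cycle along the path, a set in which every vertex has two neighbours. *)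
have nochord i j : i.+1 < j -> j < a -> h (nth x1 p i) (nth x1 p j) = false.
  move=> ij ja; apply/negbTE/negP => hij.
  pose C := [set x | (x \in p) && (i <= index x p <= j)].
  have inC k : i <= k <= j -> nth x1 p k \in C.
    by move=> kij; rewrite inE mem_nth ?index_uniq ?szp //; plain_lia.
  have [x] : exists2 x, x \in C & #|[set y in C | h x y]| <= 1.
    apply: forest; first by apply/subsetP => x; rewrite inE => /andP[/pR].
    by apply/set0Pn; exists (nth x1 p i); apply: inC; plain_lia.
  rewrite inE => /andP[xp /andP[ix xj]]; apply/negP; rewrite -ltnNge.
  rewrite -(nth_index x1 xp); set k := index x p in ix xj *.
  have [ki|ki] := eqVneq k i.
    apply: (two _ _ (nth x1 p k.+1) (nth x1 p j)).
    - by apply: inC; plain_lia.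
    - by apply: inC; plain_lia.
    - by rewrite nthE; plain_lia.
    - by apply: hnth; plain_lia.
    - by rewrite ki.
  have [kj|kj] := eqVneq k j.
    apply: (two _ _ (nth x1 p k.-1) (nth x1 p i)).
    - by apply: inC; plain_lia.
    - by apply: inC; plain_lia.
    - by rewrite nthE; plain_lia.
    - by rewrite sym -[in X in h _ X](prednK (_ : 0 < k)); [apply: hnth; plain_lia|plain_lia].
    - by rewrite kj sym.
  apply: (two _ _ (nth x1 p k.-1) (nth x1 p k.+1)).
  - by apply: inC; plain_lia.
  - by apply: inC; plain_lia.
  - by rewrite nthE; plain_lia.
  - by rewrite sym -[in X in h _ X](prednK (_ : 0 < k)); [apply: hnth; plain_lia|plain_lia].
  - by apply: hnth; plain_lia.
have inside x y : x \in p -> y \in p -> h x y = padj p x y.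
  move=> xp yp; apply/idP/idP; last exact: sorted_padj.
  rewrite /padj xp yp /=.
  have [ix iy] : index x p < a /\ index y p < a by rewrite -szp !index_mem.
  rewrite -{1}(nth_index x1 xp) -{1}(nth_index x1 yp).
  case: (ltngtP (index x p) (index y p)) => hxy.
  - case: (ltngtP (index x p).+1 (index y p)) => // h2; first [by rewrite nochord | by plain_lia].
  - rewrite sym; case: (ltngtP (index y p).+1 (index x p)) => // h2; first [by rewrite nochord | by plain_lia].
  - by rewrite hxy irr.
(* At an end of the path an edge leaving it would give a longer path; at an inner vertex it would be
   a third neighbour. *)
have outside x y : x \in p -> y \in R -> y \notin p -> h x y = false.
  move=> xp yR yp; apply/negbTE/negP => hxy.
  have ix : index x p < a by rewrite -szp index_mem.
  have xE := nth_index x1 xp.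
  have [i0|i0] := posnP (index x p).
    have : size (y :: p) <= a.
      apply: longest => /=; first by rewrite yp ut.
        by rewrite yR tR.
      case: (p) st xE i0 => [|z q] /= sz; first by rewrite /= in xp *.
      by move=> xE i0; move: xE; rewrite i0 /= => zx; rewrite sz andbT sym zx.
    by rewrite /= szp ltnn.
  have [il|il] := eqVneq (index x p).+1 a.
    have : size (rcons p y) <= a.
      apply: longest; first by rewrite rcons_uniq yp ut.
        by rewrite all_rcons /= yR tR.
      case: (p) st szp xE il xp => [//|z q] sz sq xE il _; rewrite rcons_cons [sorted _ _]rcons_path; apply/andP; split=> //.
      have ixq : index x (z :: q) = size q by move: sq il => /=; plain_lia.
      have -> : last z q = x by rewrite (last_nth x1) -ixq.
      exact: hxy.
    by rewrite size_rcons szp ltnn.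
  have := deg2 x (pR _ xp); rewrite leqNgt => /negP; apply.
  pose k := index x p.
  have kx : h x (nth x1 p k.-1).
    by rewrite sym -xE -[in X in h _ X](prednK i0); apply: hnth; rewrite /k; plain_lia.
  have kx' : h x (nth x1 p k.+1) by rewrite -[X in h X _]xE; apply: hnth; rewrite /k; plain_lia.
  have pk1 : nth x1 p k.-1 \in p by rewrite mem_nth // szp /k; plain_lia.
  have pk2 : nth x1 p k.+1 \in p by rewrite mem_nth // szp /k; plain_lia.
  have : #|[set y; nth x1 p k.-1; nth x1 p k.+1]| <= #|[set y0 in R | h x y0]|.
    apply: subset_leq_card; apply/subsetP => w; rewrite !inE => /orP[/orP[]|] /eqP -> ;
    by rewrite ?yR ?hxy ?kx ?kx' ?pR.
  rewrite -setUA cardsU1 cards2 !inE negb_or nthE; try by rewrite /k; plain_lia.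
  have -> : (k.-1 != k.+1) by plain_lia.
  have -> : y != nth x1 p k.-1 by apply: contraNneq yp => ->.
  have -> : y != nth x1 p k.+1 by apply: contraNneq yp => ->.
  by [].
pose R' := [set x in R | x \notin p].
have R'm : #|R'| < m.
  apply: leq_trans Rm; apply: proper_card; apply/properP; split.
    by apply/subsetP => x; rewrite inE => /andP[].
  exists (nth x1 p 0); first by apply: pR; rewrite mem_nth ?szp.
  by rewrite inE mem_nth ?szp // andbF.
have R'R x : x \in R' -> x \in R by rewrite inE => /andP[].
have [||ps [ufl flR pne hE]] := IH R' R'm.
- move=> x /R'R /deg2; apply: leq_trans; apply: subset_leq_card.
  by apply/subsetP => y; rewrite !inE => /andP[/andP[-> _] ->].
- by move=> C CR'; apply: forest; apply: subset_trans CR' _; apply/subsetP.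
exists (p :: ps); split.
- rewrite /= cat_uniq ut ufl andbT /=; apply/hasPn => x; rewrite flR inE => /andP[_ xp].
  exact: xp.
- move=> x; rewrite /= mem_cat flR inE; case: (boolP (x \in p)) => [/pR ->//|_].
  by rewrite andbT.
- by move=> q; rewrite inE => /orP[/eqP ->|/pne //]; rewrite -size_eq0 szp -lt0n.
move=> x y xR yR; rewrite /fadj /= -/(fadj ps x y).
have fno z w : z \in p -> fadj ps z w = false.
  by move=> zp; apply/negbTE/negP => /fadj_mem; rewrite flR inE zp andbF.
case: (boolP (x \in p)) => xp; case: (boolP (y \in p)) => yp.
- by rewrite inside // fno // orbF.
- by rewrite outside // fno // orbF /padj (negbTE yp) andbF.
- by rewrite sym outside // fadj_sym fno // orbF /padj (negbTE xp).
by rewrite hE ?inE ?xR ?yR // /padj (negbTE xp).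
Qed.

(** * Rearranging an extremal graph into a join *)

Lemma maximal_path (T : finType) (h : rel T) (R : {set T}) : symmetric h -> R != set0 ->
  exists x q, [/\ uniq (x :: q), all (mem R) (x :: q), path h x q &
    forall y, y \in R -> h x y || h (last x q) y -> y \in x :: q].
Proof.
move=> sym /set0Pn[x1 x1R].
pose P k := [exists t : k.-tuple T, [&& uniq t, all (mem R) t & sorted h t]].
have P1 : exists k, P k by exists 1; apply/existsP; exists [tuple x1]; rewrite /= x1R.
have Pbound k : P k -> k <= #|R|.
  move=> /existsP[t /and3P[ut tR _]]; rewrite -(size_tuple t) -(card_uniqP ut).
  by apply: subset_leq_card; apply/subsetP => x /(allP tR).
case: (ex_maxnP P1 Pbound) => a /existsP[t /and3P[ut0 tR0 st0]] amax.
have [p [sz ut tR st]] : exists p : seq T, [/\ size p = a, uniq p, all (mem R) p & sorted h p].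
  by exists t; rewrite size_tuple.
have longest q : uniq q -> all (mem R) q -> sorted h q -> size q <= a.
  by move=> uq qR sq; apply: amax; apply/existsP; exists (in_tuple q); rewrite /= uq qR sq.
have a0 : 0 < a by apply: (amax 1); apply/existsP; exists [tuple x1]; rewrite /= x1R.
case: p sz ut tR st => [|x q] sz ut tR st; first by rewrite -sz in a0.
exists x, q; split=> // y yR hy; apply/negPn/negP => yn.
case/orP: hy => hy.
  have : size (y :: x :: q) <= a.
    apply: longest; first by rewrite cons_uniq yn.
      by rewrite /= yR.
    by rewrite /= sym hy.
  by rewrite /= -sz ltnn.
have : size (rcons (x :: q) y) <= a.
  apply: longest; first by rewrite rcons_uniq yn.
    by rewrite all_rcons tR andbT.
  by rewrite /= rcons_path hy andbT; exact: st.
by rewrite size_rcons -sz ltnn.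
Qed.

(** On the vertices of a maximal path all degrees are at least two: the ends have all their
    neighbours there, the inner vertices their two neighbours along the path. So this set is not a
    proper subset. *)
Lemma hamiltonian_path (T : finType) (h : rel T) (R : {set T}) : symmetric h -> R != set0 ->
  (forall x, x \in R -> 2 <= #|nbrs h R x|) ->
  (forall C : {set T}, C \proper R -> C != set0 -> exists2 x, x \in C & #|nbrs h C x| <= 1) ->
  exists p, [/\ uniq p, p =i R & sorted h p].
Proof.
move=> sym R0 deg2 forest; have [x [q [ut tR st ext]]] := maximal_path sym R0.
exists (x :: q); split=> //.
pose P := [set y in x :: q].
have PR : P \subset R by apply/subsetP => y; rewrite inE => /(allP tR).
suff RP : R = P by move=> y; rewrite RP in_set.
apply/eqP; rewrite eq_sym; apply/negPn/negP => PnR.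
have [||y yP] := forest P; first by rewrite properEneq PnR.
  by apply/set0Pn; exists x; rewrite !inE eqxx.
apply/negP; rewrite -ltnNge.
have yp : y \in x :: q by move: yP; rewrite inE.
have {}ext : h x =1 h y \/ h (last x q) =1 h y -> 1 < #|nbrs h P y|.
  move=> ey; apply: leq_trans (deg2 y (subsetP PR _ yP)) _.
  apply: subset_leq_card; apply/subsetP => z; rewrite inE => /andP[zR yz].
  rewrite !inE yz andbT -in_cons; apply: ext => //.
  by case: ey => ->; rewrite yz ?orbT.
have ysz : index y (x :: q) < size (x :: q) by rewrite index_mem.
have yE := nth_index x yp.
set k := index y (x :: q) in ysz yE.
have [k0|k0] := posnP k; first by apply: ext; left => z; rewrite -yE k0.
have [kl|kl] := eqVneq k.+1 (size (x :: q)).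
  by apply: ext; right => z; rewrite -yE (last_nth x) -/(size _); case: kl => ->.
have /(sortedP x) hs : sorted h (x :: q) := st.
have h1 : h y (nth x (x :: q) k.-1).
  by rewrite sym -yE -[in X in h _ X](prednK k0); apply: hs; rewrite prednK.
have h2 : h y (nth x (x :: q) k.+1) by rewrite -[X in h X _]yE; apply: hs; plain_lia.
have : #|[set nth x (x :: q) k.-1; nth x (x :: q) k.+1]| <= #|nbrs h P y|.
  apply: subset_leq_card; apply/subsetP => z /set2P[] ->.
    by rewrite /nbrs !in_set h1 mem_nth //; plain_lia.
  by rewrite /nbrs !in_set h2 mem_nth //; plain_lia.
rewrite cards2 nth_uniq //; try plain_lia.
Qed.

Lemma long_path_tP (T : finType) (e : rel T) (t l : nat) (p : seq T) :
  symmetric e -> uniq p -> sorted e p -> t * l <= size p -> contains_sub (tP t l) e.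
Proof.
move=> sym up sp tl; apply/(contains_tP _ _ sym).
have szt : size (take (t * l) p) = sumn (nseq t l) by rewrite sumn_nseq size_takel // mulnC.
have shE : map size (reshape (nseq t l) (take (t * l) p)) = nseq t l by apply: reshapeKl; rewrite szt.
have flE : flatten (reshape (nseq t l) (take (t * l) p)) = take (t * l) p by apply: reshapeKr; rewrite szt.
exists (reshape (nseq t l) (take (t * l) p)); split.
- by rewrite -(size_map size) shE size_nseq.
- by rewrite -(all_map size (fun k => k == l)) shE all_nseq eqxx orbT.
- by rewrite flE take_uniq.
have : sorted e (flatten (reshape (nseq t l) (take (t * l) p))) by rewrite flE take_sorted.
by elim: (reshape _ _) => //= q qs IH /cat_sorted2[-> /IH].
Qed.

Section Star.
Variables (T : finType) (e : rel T) (u v : T).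
Hypothesis irr : irreflexive e.
Hypothesis sym : symmetric e.
Hypothesis vk : van_kampen e.
Hypothesis uv : u != v.

Definition good : {set T} := nbr e u :&: nbr e v.
Definition star : rel T := fun x y =>
  (x != y) && [|| x \in [:: u; v], y \in [:: u; v] | [&& e x y, x \in good & y \in good]].

Lemma star_sym : symmetric star.
Proof.
move=> x y; rewrite /star eq_sym sym; congr (_ && _).
by rewrite orbCA; congr [|| _, _ | _]; rewrite (andbC (x \in good)).
Qed.

Lemma goodE x : (x \in good) = e u x && e v x.
Proof. by rewrite !inE. Qed.

Lemma good_center x : x \in good -> x \notin [:: u; v].
Proof.
rewrite goodE !inE negb_or => /andP[ux vx].
by apply/andP; split; apply/eqP => xE; [move: ux|move: vx]; rewrite xE irr.
Qed.

(** [van_kampen_no_cycle] needs a common neighbour outside of [C], so only the whole of [good] could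
    carry a cycle. In that case it has a spanning path, long enough to contain [tP_l]. Degrees are
    at most two because [u], [v] and [x] have no three common neighbours. *)
Lemma star_join_decomp (t l : nat) : ~ contains_sub (tP t l) e -> 1 < t * l <= #|good| ->
  exists2 ps, join_decomp star u v ps & forall p, p \in ps -> p != [::].
Proof.
move=> free /andP[tl1 tl].
pose h : rel T := fun x y => [&& e x y, x \in good & y \in good].
pose R : {set T} := [set x | x \notin [:: u; v]].
have hirr : irreflexive h by move=> x; rewrite /h irr.
have hsym : symmetric h by move=> x y; rewrite /h sym (andbC (x \in good)).
have good0 : good != set0 by rewrite -card_gt0; apply: leq_trans tl; apply: ltnW.
have forest (C : {set T}) : C \subset good -> C != good -> C != set0 -> exists2 x, x \in C & #|nbrs e C x| <= 1.
  move=> Cg CnG C0; have /properP[_ [w wg wC]] : C \proper good by rewrite properEneq CnG.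
  move: wg; rewrite goodE => /andP[uw vw].
  by apply: (van_kampen_no_cycle irr sym vk uv uw vw wC) => // x /(subsetP Cg); rewrite goodE.
have [x0 x0g x0d] : exists2 x, x \in good & #|nbrs e good x| <= 1.
  case: (boolP [exists x in good, #|nbrs e good x| <= 1]) => [/existsP[x /andP[]]|/existsPn no].
    by exists x.
  case: free; have [x xg|C|p [up pg sp]] := hamiltonian_path (h := e) (R := good) sym good0.
  - by have := no x; rewrite xg /= -ltnNge.
  - by rewrite properEneq => /andP[CnG Cg]; apply: forest.
  apply: (long_path_tP sym up sp); rewrite -(card_uniqP up) (eq_card pg) //.
have [x xR|C CR C0|ps [ufl flR pne hE]] := linear_forest_paths (R := R) hirr hsym.
- case: (boolP (x \in good)) => xg; last first.
    by rewrite eq_card0 // => y; rewrite !inE /h (negbTE xg) andbF andbF.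
  have un : uniq [:: u; v; x].
    move: (good_center xg); rewrite /= !inE !negb_or uv !(eq_sym x) => /andP[-> ->].
    by [].
  apply: leq_trans (van_kampen_common3 good irr vk un).
  apply: subset_leq_card; apply/subsetP => y; rewrite in_set => /andP[_ /and3P[xy _ yg]].
  by move: (yg); rewrite goodE => /andP[uy vy]; rewrite in_set yg uy vy xy.
- case: (boolP (C \subset good)) => [Cg|/subsetPn[x xC xg]]; last first.
    by exists x => //; rewrite eq_card0 // => y; rewrite !inE /h (negbTE xg) andbF andbF.
  have [x xC dx] : exists2 x, x \in C & #|nbrs e C x| <= 1.
    have [->|CnG] := eqVneq C good; first by exists x0.
    exact: forest.
  exists x => //; apply: leq_trans dx; apply: subset_leq_card; apply/subsetP => y.
  by rewrite !in_set => /andP[-> /and3P[->]].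
exists ps => //; split.
- rewrite !cons_uniq ufl andbT inE flR !inE negb_or uv !eqxx /=. by rewrite flR !inE eqxx orbT.
- by move=> x; rewrite !inE flR !inE; case: (x == u); case: (x == v).
move=> x y; rewrite /star; congr (_ && _).
case: (boolP (x \in [:: u; v])) => // xn; case: (boolP (y \in [:: u; v])) => // yn.
rewrite !orFb.
by rewrite -[RHS]hE // in_set.
Qed.

Lemma star_tP (t l : nat) (ps : seq (seq T)) :
  size ps = t -> all (fun p => size p == l) ps -> uniq (flatten ps) ->
  all (sorted (fun x y => star x y && ((x \notin [:: u; v]) || (y \notin [:: u; v])))) ps ->
  t * l <= #|good| -> contains_sub (tP t l) e.
Proof.
move=> ts ls uf sg tl; apply/(contains_tP _ _ sym).
pose Q := flatten ps.
have szQ : size Q = t * l.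
  by rewrite size_flatten /shape (shape_nseq ts ls) sumn_nseq mulnC.
pose bad := [seq w <- Q | w \notin u |: (v |: good)].
pose free := [seq w <- enum good | w \notin Q].
have bad_free : size bad <= size free.
  have : size bad + size [seq w <- Q | w \in good] <= size Q.
    rewrite !size_filter -(count_predC (mem good) Q) addnC leq_add2l.
    by apply: sub_count => w /=; rewrite !inE !negb_or => /and3P[_ _ ->].
  have : size [seq w <- Q | w \in good] + size free = #|good|.
    rewrite cardE -(count_predC (mem Q) (enum good)) !size_filter; congr (_ + _).
    rewrite -!size_filter; apply: perm_size.
    apply: uniq_perm; [exact/filter_uniq|exact/filter_uniq/enum_uniq|].
    move=> w; rewrite [LHS]mem_filter [RHS]mem_filter.
    by rewrite mem_enum andbC.
  rewrite szQ; move: tl; clear; lia.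
pose phi w := if w \in bad then nth w free (index w bad) else w.
have phiF w : w \in bad -> phi w \in free.
  by move=> wb; rewrite /phi wb mem_nth // (leq_trans _ bad_free) // index_mem.
have phi_inj : {in Q &, injective phi}.
  move=> a b aQ bQ.
  have key c d : c \in bad -> d \in Q -> d \notin bad -> phi c = phi d -> False.
    move=> cb dQ db E; have := phiF c cb; rewrite E /phi (negbTE db) mem_filter dQ.
    by [].
  case: (boolP (a \in bad)) => ab; case: (boolP (b \in bad)) => bb E.
  - move: E; rewrite /phi ab bb => E.
    have ia : index a bad < size free by rewrite (leq_trans _ bad_free) // index_mem.
    have ib : index b bad < size free by rewrite (leq_trans _ bad_free) // index_mem.
    have uF : uniq free by exact/filter_uniq/enum_uniq.
    move/eqP: E; rewrite (set_nth_default a b ib) nth_uniq // => /eqP E.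
    by rewrite -(nth_index a ab) E nth_index.
  - by case: (key a b).
  - by case: (key b a).
  - by move: E; rewrite /phi (negbTE ab) (negbTE bb).
have phiE w : w \in Q -> w \in u |: (v |: good) -> phi w = w.
  by move=> wQ wg; rewrite /phi mem_filter wg.
have phiG w : w \in Q -> w \notin [:: u; v] -> phi w \in good.
  move=> wQ wn; case: (boolP (w \in bad)) => wb.
    by have := phiF w wb; rewrite mem_filter mem_enum => /andP[].
  move: (wb); rewrite mem_filter wQ andbT negbK => wg; rewrite phiE //.
  by move: wg wn; rewrite 2!in_setU1 !inE; case: (w == u); case: (w == v).
exists (map (map phi) ps); split.
- by rewrite size_map.
- by rewrite all_map; apply: sub_all ls => p /=; rewrite size_map.
- by rewrite -map_flatten map_inj_in_uniq.
rewrite all_map; apply/allP => p pps /=; have pQ x : x \in p -> x \in Q by move=> xp; apply/flattenP; exists p.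
have := allP sg p pps; rewrite sorted_map; apply: sub_in_sorted (allss p) => x y xp yp /=.
have [xQ yQ] := (pQ x xp, pQ y yp).
have e_center c y1 : c \in [:: u; v] -> c \in Q -> y1 \in Q -> y1 \notin [:: u; v] -> e (phi c) (phi y1).
  move=> cuv cQ y1Q y1n; have := phiG y1 y1Q y1n; rewrite goodE => /andP[uy vy].
  rewrite (phiE c cQ); first by move: cuv; rewrite !inE => /orP[] /eqP ->.
  by move: cuv; rewrite !inE => /orP[] ->; rewrite ?orbT.
rewrite /star => /andP[/andP[xy]].
case: (boolP (x \in [:: u; v])) => xc; case: (boolP (y \in [:: u; v])) => yc //=.
- by move=> _ _; apply: e_center.
- by move=> _ _; rewrite sym; apply: e_center.
by move=> /and3P[exy xg yg] _; rewrite !phiE // !in_setU1 ?xg ?yg !orbT.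
Qed.

End Star.

(** * The weight gained by the rearrangement *)

Local Open Scope ring_scope.

(** Peeling off vertices with at most five remaining neighbours charges each edge to the end peeled
    first, at most [5 * m * x v] per vertex [v]; ordered pairs double this. *)
Lemma degenerate_weight (R : realFieldType) (T : finType) (e : rel T) (x : T -> R) (m : R) (V : {set T}) :
  irreflexive e -> symmetric e -> van_kampen e -> (forall w, w \in V -> 0 <= x w <= m) ->
  \sum_(a in V) \sum_(b in V) (e a b)%:R * x a * x b <= 10 * m * \sum_(a in V) x a.
Proof.
move=> irr sym vk; have [k] := ubnP #|V|; elim: k V => // k IH V; rewrite ltnS => Vk xm.
have [->|V0] := eqVneq V set0; first by rewrite !big_set0 mulr0.
have [v vV dv] := van_kampen_degenerate irr sym vk V0.
have /andP[xv0 xvm] := xm v vV.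
have {}IH := IH (V :\ v) ltac:(by rewrite (leq_trans _ Vk) // [X in (_ < X)%N](cardsD1 v) vV)
  ltac:(by move=> w; rewrite inE => /andP[_ /xm]).
have row : \sum_(b in V :\ v) (e v b)%:R * x v * x b <= 5 * m * x v.
  have : \sum_(b in V :\ v) (e v b)%:R * x b <= 5 * m.
    apply: (@le_trans _ _ (\sum_(b in nbrs e V v) m)).
      rewrite (big_setID (nbrs e V v)) /= [X in _ + X]big1 ?addr0; last first.
        by move=> b; rewrite !inE => /andP[+ /andP[_ bV]]; rewrite bV /= => /negbTE ->; rewrite mul0r.
      rewrite (_ : (V :\ v) :&: _ = nbrs e V v); last first.
        apply/setP => b; rewrite !inE; case: (eqVneq b v) => [->|] /=; first by rewrite irr andbF.
        by move=> _; case: (b \in V).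
      by apply: ler_sum => b; rewrite inE => /andP[/xm/andP[b0 bm] ->]; rewrite mul1r.
    rewrite sumr_const -(mulr_natl m); apply: ler_wpM2r; first by lra.
    by rewrite (ler_nat R _ 5).
  move=> h; apply: (@le_trans _ _ (x v * (\sum_(b in V :\ v) (e v b)%:R * x b))).
    by rewrite mulr_sumr; apply: ler_sum => b _; rewrite mulrA (mulrC (x v)).
  by rewrite mulrC; apply: ler_wpM2r.
rewrite [X in _ <= X](_ : _ = 10 * m * x v + 10 * m * \sum_(a in V :\ v) x a); last first.
  by rewrite (big_setD1 v) //= mulrDr.
rewrite (big_setD1 v) //= (big_setD1 v (A := V)) //= irr !mul0r add0r.
under [X in _ + X <= _]eq_bigr do rewrite (big_setD1 v) //=.
rewrite big_split /=.
have -> : \sum_(i in V :\ v) (e i v)%:R * x i * x v = \sum_(b in V :\ v) (e v b)%:R * x v * x b.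
  by apply: eq_bigr => b _; rewrite sym; ring.
by lra.
Qed.

Section StarWeight.
Variables (R : realFieldType) (T : finType) (e : rel T) (u v : T) (x : T -> R).
Hypothesis irr : irreflexive e.
Hypothesis sym : symmetric e.
Hypothesis vk : van_kampen e.
Hypothesis uv : u != v.
Hypothesis x_ge0 : forall w, 0 <= x w.
Hypothesis xu : x u = 1.
Hypothesis xv : 98 / 100 <= x v.
Hypothesis x_small : forall w, w != u -> w != v -> x w <= 1 / 10.

Local Notation good := (good e u v).
Definition bad : {set T} := [set w | (w \notin [:: u; v]) && (w \notin good)].

Lemma badP w : w \in bad -> [/\ w != u, w != v & w \notin good].
Proof. by rewrite in_set !inE negb_or => /andP[/andP[-> ->]]. Qed.

Lemma bad_good_weight w : w \in bad -> \sum_(a in good) (e w a)%:R * x a <= 2 / 10.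
Proof.
move=> /badP[wu wv _].
have un : uniq [:: u; v; w] by rewrite /= !inE negb_or uv !(eq_sym _ w) wu wv.
apply: (@le_trans _ _ (\sum_(a in [set y in good | [&& e u y, e v y & e w y]]) (1 / 10))).
  rewrite (big_setID [set y in good | [&& e u y, e v y & e w y]]) /= [X in _ + X]big1 ?addr0; last first.
    move=> b; rewrite inE in_set => /andP[+ bg]; rewrite bg /=.
    move: (bg); rewrite goodE => /andP[-> ->] /= /negbTE ->; by rewrite mul0r.
  rewrite (_ : good :&: _ = [set y in good | [&& e u y, e v y & e w y]]); last first.
    by apply/setP => b; rewrite in_setI in_set andbA andbb.
  apply: ler_sum => b; rewrite in_set => /and4P[bg _ _ ->]; rewrite (mul1r (x b)).
  have := good_center irr bg; rewrite !inE negb_or => /andP[bu bv]; exact: x_small.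
rewrite sumr_const -(mulr_natl (1 / 10)).
have : #|[set y in good | [&& e u y, e v y & e w y]]|%:R <= 2 :> R.
  by rewrite (ler_nat R _ 2); apply: van_kampen_common3.
by lra.
Qed.

Lemma missing_center w : w \in bad -> 98 / 100 <= (~~ e u w)%:R * x u + (~~ e v w)%:R * x v.
Proof.
by move=> /badP[_ _]; rewrite goodE xu; have := xv; case: (e u w); case: (e v w) => //=; lra.
Qed.

(** Per unit of its weight a bad vertex gains at least [2 * 98 / 100] from the missing center, and
    loses at most 1 inside [bad] and [4 / 10] towards [good]. The balance of [56 / 100] exceeds
    [1 / 2]. *)
Lemma star_weight :
  \sum_a \sum_b (e a b)%:R * x a * x b + \sum_(w in bad) x w / 2 <=
  \sum_a \sum_b (star e u v a b)%:R * x a * x b.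
Proof.
(* A lower bound for the change at each ordered pair; a possible gain from the edge [uv] is left
   out. *)
pose c (a b : T) : R :=
  ((a \in [:: u; v]) && (b \in bad))%:R * (~~ e a b)%:R * (x a * x b) +
  ((b \in [:: u; v]) && (a \in bad))%:R * (~~ e a b)%:R * (x a * x b) -
  ((a \in bad) && (b \in bad))%:R * (e a b)%:R * (x a * x b) -
  ((a \in bad) && (b \in good))%:R * (e a b)%:R * (x a * x b) -
  ((a \in good) && (b \in bad))%:R * (e a b)%:R * (x a * x b).
have pointwise a b : (e a b)%:R * x a * x b + c a b <= (star e u v a b)%:R * x a * x b.
  have xx : 0 <= x a * x b by apply: mulr_ge0.
  suff : (e a b)%:R + (((a \in [:: u; v]) && (b \in bad))%:R * (~~ e a b)%:R +
     ((b \in [:: u; v]) && (a \in bad))%:R * (~~ e a b)%:R -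
     ((a \in bad) && (b \in bad))%:R * (e a b)%:R -
     ((a \in bad) && (b \in good))%:R * (e a b)%:R -
     ((a \in good) && (b \in bad))%:R * (e a b)%:R) <= (star e u v a b)%:R :> R.
    by move=> h; have := ler_wpM2r xx h; rewrite /c; lra.
  rewrite /star.
  have cl z : [\/ z \in [:: u; v] /\ z \notin bad /\ z \notin good,
                z \notin [:: u; v] /\ z \in bad /\ z \notin good |
                z \notin [:: u; v] /\ z \notin bad /\ z \in good].
    case: (boolP (z \in good)) => zg.
      constructor 3; have := good_center irr zg => zn; split=> //; split=> //.
      by rewrite in_set zg andbF.
    case: (boolP (z \in [:: u; v])) => zn; [constructor 1|constructor 2]; split=> //; split=> //;
      by rewrite in_set zg zn.
  case: (eqVneq a b) => [<-|ab]; first rewrite irr.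
    by case: (cl a) => [] [] + [] => [-> /negbTE -> /negbTE ->|/negbTE -> -> /negbTE ->|/negbTE -> /negbTE -> ->];
      rewrite /=; lra.
  by case: (cl a) => [] [] + [] => [-> /negbTE -> /negbTE ->|/negbTE -> -> /negbTE ->|/negbTE -> /negbTE -> ->];
   case: (cl b) => [] [] + [] => [-> /negbTE -> /negbTE ->|/negbTE -> -> /negbTE ->|/negbTE -> /negbTE -> ->];
   case: (e a b) => /=; lra.
have total : \sum_a \sum_b (e a b)%:R * x a * x b + \sum_a \sum_b c a b <=
    \sum_a \sum_b (star e u v a b)%:R * x a * x b.
  rewrite -big_split; apply: ler_sum => a _; rewrite -big_split; apply: ler_sum => b _.
  exact: pointwise.
apply: le_trans total; rewrite lerD2l.
have restrict (A B : {set T}) (f : T -> T -> R) :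
    \sum_a \sum_b ((a \in A) && (b \in B))%:R * f a b = \sum_(a in A) \sum_(b in B) f a b.
  rewrite [RHS]big_mkcond; apply: eq_bigr => a _; case: (a \in A) => /=; last first.
    by apply: big1 => b _; rewrite mul0r.
  by rewrite [RHS]big_mkcond; apply: eq_bigr => b _; case: (b \in B); rewrite ?mul1r ?mul0r.
pose f a b : R := (e a b)%:R * (x a * x b).
pose g a b : R := (~~ e a b)%:R * (x a * x b).
have uvE a : (a \in [:: u; v]) = (a \in [set u; v]) by rewrite !inE.
have -> : \sum_a \sum_b c a b = \sum_(a in [set u; v]) \sum_(b in bad) g a b +
   \sum_(a in bad) \sum_(b in [set u; v]) g a b - \sum_(a in bad) \sum_(b in bad) f a b -
   \sum_(a in bad) \sum_(b in good) f a b - \sum_(a in good) \sum_(b in bad) f a b.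
  rewrite -!restrict -!sumrN -!big_split; apply: eq_bigr => a _ /=.
  rewrite -!sumrN -!big_split; apply: eq_bigr => b _ /=.
  by rewrite /c /f /g -!uvE (andbC (b \in [:: u; v])); ring.
have -> : \sum_(a in bad) \sum_(b in [set u; v]) g a b = \sum_(a in [set u; v]) \sum_(b in bad) g a b.
  by rewrite exchange_big; apply: eq_bigr => a _; apply: eq_bigr => b _; rewrite /g sym; ring.
have -> : \sum_(a in good) \sum_(b in bad) f a b = \sum_(a in bad) \sum_(b in good) f a b.
  by rewrite exchange_big; apply: eq_bigr => a _; apply: eq_bigr => b _; rewrite /f sym; ring.
pose S := \sum_(w in bad) x w.
have S0 : 0 <= S by apply: sumr_ge0.
have h1 : 98 / 100 * S <= \sum_(a in [set u; v]) \sum_(b in bad) g a b.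
  rewrite exchange_big mulr_sumr; apply: ler_sum => w wb /=.
  rewrite big_setU1 ?inE //= big_set1 /g !mulrA -mulrDl; apply: ler_wpM2r => //.
  exact: missing_center.
have h2 : \sum_(a in bad) \sum_(b in bad) f a b <= S.
  have := @degenerate_weight R T e x (1 / 10) bad irr sym vk.
  have -> : \sum_(a in bad) \sum_(b in bad) f a b = \sum_(a in bad) \sum_(b in bad) (e a b)%:R * x a * x b.
    by apply: eq_bigr => a _; apply: eq_bigr => b _; rewrite /f mulrA.
  move=> h; have := h ltac:(by move=> w /badP[wu wv _]; rewrite x_ge0 x_small).
  by rewrite -/S; lra.
have h3 : \sum_(a in bad) \sum_(b in good) f a b <= 2 / 10 * S.
  rewrite mulr_sumr; apply: ler_sum => w wb.
  have -> : \sum_(b in good) f w b = (\sum_(b in good) (e w b)%:R * x b) * x w.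
    by rewrite mulr_suml; apply: eq_bigr => b _; rewrite /f; ring.
  by apply: ler_wpM2r => //; apply: bad_good_weight.
have -> : \sum_(w in bad) x w / 2 = S / 2 by rewrite mulr_suml.
by lra.
Qed.

Lemma star_center (w : T) : w != u -> w != v -> w \notin good -> \sum_b (star e u v w b)%:R * x b = x u + x v.
Proof.
move=> wu wv wg; rewrite (bigD1 u) //= (bigD1 v) /=; last by rewrite eq_sym.
rewrite {1 2}/star wu wv !mem_seq2 !eqxx !orbT !mul1r big1 ?addr0 // => b /andP[bu bv].
by rewrite /star !mem_seq2 (negbTE wu) (negbTE wv) (negbTE bu) (negbTE bv) (negbTE wg) andbF andbF mul0r.
Qed.

(** The gain of [star_weight] could vanish on bad vertices of weight 0, so rows are compared
    instead. At a bad vertex with at most five bad neighbours a center worth [98 / 100] is missing,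
    and its other edges make up for at most [7 / 10]. Without bad vertices only the edge [uv] can
    differ, and the row of [u] decides it. *)
Lemma star_eigen_eq (rho : R) :
  (forall a, \sum_b (e a b)%:R * x b = rho * x a) ->
  (forall a, \sum_b (star e u v a b)%:R * x b = rho * x a) -> e =2 star e u v.
Proof.
move=> he hs.
have split_row w : \sum_b (e w b)%:R * x b = (e w u)%:R * x u + (e w v)%:R * x v +
    \sum_(b in bad) (e w b)%:R * x b + \sum_(b in good) (e w b)%:R * x b.
  rewrite (bigD1 u) //= (bigD1 v) /=; last by rewrite eq_sym.
  rewrite (bigID (mem good)) /= !addrA addrAC; congr (_ + _ + _).
    apply: eq_bigl => b; rewrite /bad in_set !inE negb_or; by case: (b \in good); rewrite ?andbT ?andbF.
  apply: eq_bigl => b; apply/andP/idP => [[]//|bg]; split=> //.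
  by have := good_center irr bg; rewrite !inE negb_or.
have bad0 : bad = set0.
  apply/eqP; apply/negPn/negP => bn.
  have [w wb dw] := van_kampen_degenerate irr sym vk bn.
  have [wu wv wg] := badP wb.
  have := he w; rewrite -hs star_center // split_row.
  have := missing_center wb; rewrite (sym w u) (sym w v).
  have := bad_good_weight wb.
  have : \sum_(b in bad) (e w b)%:R * x b <= 5 / 10.
    apply: (@le_trans _ _ (\sum_(b in nbrs e bad w) (1 / 10))).
      rewrite (big_setID (nbrs e bad w)) /= [X in _ + X]big1 ?addr0; last first.
        by move=> b; rewrite in_setD in_set => /andP[+ bB]; rewrite bB /= => /negbTE ->; rewrite mul0r.
      rewrite (_ : bad :&: _ = nbrs e bad w); last first.
        by apply/setP => b; rewrite in_setI [_ \in nbrs _ _ _]in_set andbA andbb.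
      by apply: ler_sum => b; rewrite in_set => /andP[/badP[bu bv _] ->]; rewrite (mul1r (x b)) x_small.
    have : #|nbrs e bad w|%:R <= 5 :> R by rewrite (ler_nat R _ 5).
    by rewrite sumr_const -(mulr_natl (1 / 10)); lra.
  rewrite xu; case: (e u w); case: (e v w) => /=; move: xv; lra.
have cl z : z \notin [:: u; v] -> z \in good.
  by move=> zn; apply/negPn/negP => zg; have : z \in bad; [rewrite in_set zn|rewrite bad0 inE].
have euv : e u v.
  apply/negPn/negP => /negbTE nuv.
  have := he u; rewrite -hs (bigD1 v) //= [in RHS](bigD1 v) //= nuv mul0r add0r.
  have -> : star e u v u v by rewrite /star uv !inE eqxx.
  rewrite mul1r; set s1 := \sum_(i | i != v) _; set s2 := \sum_(i | i != v) _.
  have : s1 <= s2.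
    apply: ler_sum => b bv; apply: ler_wpM2r => //; rewrite ler_nat.
    case: (eqVneq u b) => [<-|ub]; first by rewrite irr.
    by rewrite /star ub !inE eqxx /= leq_b1.
  by move: xv; lra.
have eu z : z != u -> e u z.
  move=> zu; case: (eqVneq z v) => [->//|zv].
  by have := cl z; rewrite !inE negb_or zu zv => /(_ isT) /andP[].
have ev z : z != v -> e v z.
  move=> zv; case: (eqVneq z u) => [->|zu]; first by rewrite sym.
  by have := cl z; rewrite !inE negb_or zu zv => /(_ isT) /andP[].
move=> a b; rewrite /star; case: (eqVneq a b) => [->|ab]; first by rewrite irr.
case: (boolP (a \in [:: u; v])) => [|an].
  by rewrite !inE => /orP[] /eqP aE; subst a; [apply: eu|apply: ev]; rewrite eq_sym.
case: (boolP (b \in [:: u; v])) => [|bn].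
  by rewrite !inE sym => /orP[] /eqP bE; subst b; [apply: eu|apply: ev].
by rewrite (cl a an) (cl b bn) !andbT.
Qed.

End StarWeight.

(** * The cost of a path component *)

Lemma big_ord_delta (R : realFieldType) a k (G : nat -> R) :
  \sum_(j < a) (j == k :> nat)%:R * G j = if (k < a)%N then G k else 0.
Proof.
elim: a => [|a IH]; first by rewrite big_ord0.
rewrite big_ord_recr /= IH ltnS; case: (ltngtP k a) => h /=.
- by rewrite mul0r addr0.
- by rewrite mul0r addr0.
- by rewrite add0r mul1r h.
Qed.

Lemma big_index (R : realFieldType) (T : eqType) (p : seq T) (G : nat -> R) : uniq p ->
  \sum_(w <- p) G (index w p) = \sum_(j < size p) G j.
Proof.
case: p => [|x0 p] up; first by rewrite big_nil big_ord0.
rewrite (big_nth x0) big_mkord; apply: eq_bigr => j _.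
by rewrite index_uniq.
Qed.

Lemma join_decomp_sum (R : realFieldType) (T : finType) (g : rel T) u v ps (F : T -> R) :
  join_decomp g u v ps -> \sum_w F w = F u + F v + \sum_(w <- flatten ps) F w.
Proof.
case=> un cov _; rewrite -addrA.
have <- : \sum_(w <- u :: v :: flatten ps) F w = F u + (F v + \sum_(w <- flatten ps) F w).
  by rewrite !big_cons.
apply: perm_big; by apply: uniq_perm; rewrite ?index_enum_uniq // => w; rewrite mem_index_enum cov.
Qed.

Section PathSolution.
Variables (R : realFieldType) (q : R).
Hypothesis q0 : 0 < q.
Hypothesis q1 : q < 1.
Let rho : R := q + q^-1.

(* The solution of [rho z_i = z_(i-1) + z_(i+1) + 1], [z_0 = z_(a+1) = 0], where j = a + 1 - i. *)
Definition psol (i j : nat) : R := (1 - (q ^+ i + q ^+ j) / (1 + q ^+ (i + j))) / (rho - 2).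

Lemma rho_gt2 : 0 < rho - 2.
Proof.
have qn : q != 0 by rewrite gt_eqF.
have -> : rho - 2 = (1 - q) ^+ 2 / q by rewrite /rho; field.
by rewrite divr_gt0 // exprn_gt0 // subr_gt0.
Qed.

Lemma expq_gt0 n : 0 < q ^+ n. Proof. exact: exprn_gt0. Qed.

Lemma psol_rec i j : rho * psol i.+1 j.+1 = psol i j.+2 + psol i.+2 j + 1.
Proof.
have qn : q != 0 by rewrite gt_eqF.
have h : 1 + q ^+ (i + j).+2 != 0 by rewrite gt_eqF // ltr_wpDl ?expq_gt0.
have r : rho - 2 != 0 by rewrite gt_eqF // rho_gt2.
have r' : rho - 2 = (1 - q) ^+ 2 / q by rewrite /rho; field.
have nq : 1 - q != 0 by rewrite subr_eq0 eq_sym lt_eqF.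
rewrite /psol !addnS !addSn r' /rho !exprS; move: h; rewrite !exprS exprD => h.
by field; rewrite qn nq h.
Qed.

Lemma psol0 j : psol 0 j = 0.
Proof.
rewrite /psol expr0 add0n divff ?subrr ?mul0r // gt_eqF //.
by rewrite ltr_wpDl ?expq_gt0.
Qed.

Lemma psolC i j : psol i j = psol j i.
Proof. by rewrite /psol addnC (addrC (q ^+ i)). Qed.

(** Up to a constant factor, the value of [psol] at an end vertex of a path with [a] vertices. *)
Definition zeta (a : nat) : R := (1 - q ^+ a) / (1 + q ^+ a.+1).

Lemma psol_zeta a : psol 1 a = (1 - q) / (rho - 2) * zeta a.
Proof.
have h : 1 + q ^+ a.+1 != 0 by rewrite gt_eqF // ltr_wpDl ?expq_gt0.
have r : rho - 2 != 0 by rewrite gt_eqF // rho_gt2.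
rewrite /psol /zeta add1n expr1; move: h; rewrite exprS => h; by field; rewrite r h.
Qed.

(** Summing the recurrence telescopes; only the values at the two ends of the path are lost, and
    they agree by symmetry. *)
Lemma psol_sum a :
  (rho - 2) * \sum_(i < a) psol i.+1 (a - i) = a%:R - 2 * ((1 - q) / (rho - 2) * zeta a).
Proof.
rewrite -psol_zeta; pose y i := psol i (a.+1 - i).
have yE : \sum_(i < a) psol i.+1 (a - i) = \sum_(i < a) y i.+1.
  by apply: eq_bigr => i _; rewrite /y subSS.
have rec : \sum_(i < a) rho * y i.+1 = \sum_(i < a) (y i + y i.+2 + 1).
  apply: eq_bigr => i _; have ia := ltn_ord i; rewrite /y.
  have -> : (a.+1 - i.+1 = (a - i.+1).+1)%N by lia.
  have -> : (a.+1 - i = (a - i.+1).+2)%N by lia.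
  by rewrite psol_rec subSS.
have t1 : \sum_(i < a) y i + y a = y 0%N + \sum_(i < a) y i.+1.
  by rewrite -[LHS](big_ord_recr a (fun i : 'I_a.+1 => y i)) big_ord_recl.
have t2 : \sum_(i < a) y i.+1 + y a.+1 = y 1%N + \sum_(i < a) y i.+2.
  by rewrite -[LHS](big_ord_recr a (fun i : 'I_a.+1 => y i.+1)) big_ord_recl.
have y0 : y 0%N = 0 by rewrite /y psol0.
have ya1 : y a.+1 = 0 by rewrite /y subnn psolC psol0.
have ya : y a = psol 1 a by rewrite /y subSnn psolC.
have y1 : y 1%N = psol 1 a by rewrite /y subn1.
move: rec; rewrite -mulr_sumr !big_split /= sumr_const card_ord yE.
move: t1 t2; rewrite y0 ya1 ya y1.
set S := \sum_(i < a) y i.+1; set S0 := \sum_(i < a) y i; set S2 := \sum_(i < a) y i.+2.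
by move=> t1 t2 h; have -> : (rho - 2) * S = rho * S - 2 * S by [ring]; rewrite h; lra.
Qed.

Lemma zeta0 : zeta 0 = 0.
Proof. by rewrite /zeta expr0 subrr mul0r. Qed.

Lemma zetaS a : zeta a.+1 - zeta a = (1 + q) * (1 - q) * q ^+ a / ((1 + q ^+ a.+1) * (1 + q ^+ a.+2)).
Proof.
have h1 : 1 + q ^+ a.+1 != 0 by rewrite gt_eqF // ltr_wpDl ?expq_gt0.
have h2 : 1 + q ^+ a.+2 != 0 by rewrite gt_eqF // ltr_wpDl ?expq_gt0.
rewrite /zeta; move: h1 h2; rewrite !exprS => h1 h2; field; by rewrite h1 h2.
Qed.

Lemma zetaS_gt0 a : 0 < zeta a.+1 - zeta a.
Proof.
have q_gt := q0; have q_lt := q1.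
rewrite zetaS !(mulr_gt0, divr_gt0) ?invr_gt0 ?mulr_gt0 ?expq_gt0 ?subr_gt0 // ?addr_gt0 ?expq_gt0 //.
Qed.

Lemma zeta_concave a : zeta a.+2 - zeta a.+1 < zeta a.+1 - zeta a.
Proof.
have q_gt := q0; have q_lt := q1.
have P n : 0 < 1 + q ^+ n by rewrite ltr_wpDl ?expq_gt0.
have N n : 1 + q ^+ n != 0 by rewrite gt_eqF.
rewrite !zetaS -subr_gt0.
have h1 := N a.+1; have h2 := N a.+2; have h3 := N a.+3.
rewrite [X in 0 < X](_ : _ = (1 + q) * (1 - q) ^+ 2 * q ^+ a * (1 - q ^+ a.+2) /
    ((1 + q ^+ a.+1) * (1 + q ^+ a.+2) * (1 + q ^+ a.+3))); last first.
  by move: h1 h2 h3; rewrite !exprS => h1 h2 h3; field; rewrite h1 h2 h3.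
have lt1 : 0 < 1 - q ^+ a.+2 by rewrite subr_gt0 exprn_ilt1 // ltW.
rewrite divr_gt0 // ?mulr_gt0 // ?exprn_gt0 ?subr_gt0 //.
by rewrite addr_gt0.
Qed.

Lemma zeta_ge0 a : 0 <= zeta a.
Proof. elim: a => [|a IH]; first by rewrite zeta0. by have := zetaS_gt0 a; lra. Qed.

Lemma zeta_lt1 a : zeta a < 1.
Proof.
rewrite /zeta ltr_pdivrMr ?ltr_wpDl ?expq_gt0 // mul1r.
by have := expq_gt0 a; have := expq_gt0 a.+1; lra.
Qed.

End PathSolution.

Definition path_of {T : eqType} (ps : seq (seq T)) (w : T) : seq T :=
  nth [::] ps (find (fun p => w \in p) ps).

Lemma path_of_mem (T : eqType) (ps : seq (seq T)) p w :
  uniq (flatten ps) -> p \in ps -> w \in p -> path_of ps w = p.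
Proof.
elim: ps => //= p' ps IH; rewrite cat_uniq => /and3P[_ /hasPn dis ufl].
rewrite /path_of inE /=; case: (boolP (w \in p')) => [wp' /orP[/eqP -> //|pps wp]|wp'].
  by have := dis w; rewrite wp' => /(_ ltac:(by apply/flattenP; exists p)).
by move=> /orP[/eqP ->|pps wp]; [rewrite (negbTE wp')|exact: IH].
Qed.

Lemma fadj_path (T : eqType) (ps : seq (seq T)) p w y :
  uniq (flatten ps) -> p \in ps -> w \in p -> fadj ps w y = padj p w y.
Proof.
move=> ufl pps wp; apply/hasP/idP => [[p' p'ps pwy]|pwy]; last by exists p.
have wp' : w \in p' by case/and3P: pwy.
by rewrite -(path_of_mem ufl pps wp) (path_of_mem ufl p'ps wp').
Qed.

Lemma uniq_path (T : eqType) (ps : seq (seq T)) p : uniq (flatten ps) -> p \in ps -> uniq p.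
Proof.
elim: ps => //= q ps IH; rewrite cat_uniq => /and3P[uq _ uqs].
by rewrite inE => /orP[/eqP ->|/IH]; last exact.
Qed.

Section JoinCost.
Variables (R : realFieldType) (q : R) (T : finType) (g : rel T) (u v : T) (ps : seq (seq T)).
Hypothesis q0 : 0 < q.
Hypothesis q1 : q < 1.
Hypothesis dec : join_decomp g u v ps.
Let rho : R := q + q^-1.
Let fl := flatten ps.

(** The response of the forest to a unit load at every vertex: with its adjacency matrix [A], the
    solution of [(rho - A) z = 1]. *)
Definition forest_sol (w : T) : R :=
  let p := path_of ps w in psol q (index w p).+1 (size p - index w p).

Lemma decomp_uniq : uniq fl.
Proof. by case: dec => /= /and3P[]. Qed.

Lemma forest_sol_rec w : w \in fl ->
  \sum_(y <- fl) (fadj ps w y)%:R * forest_sol y = rho * forest_sol w - 1.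
Proof.
have ufl := decomp_uniq.
move=> /flattenP[p pps wp]; have up := uniq_path ufl pps.
have -> : \sum_(y <- fl) (fadj ps w y)%:R * forest_sol y =
    \sum_(y <- p) (padj p w y)%:R * psol q (index y p).+1 (size p - index y p).
  rewrite /fl (perm_big _ (perm_flatten (perm_to_rem pps))) /=.
  rewrite big_cat /= [X in _ + X]big1_seq ?addr0.
    apply: eq_big_seq => y yp; rewrite (fadj_path _ ufl pps wp).
    by rewrite /forest_sol (path_of_mem ufl pps yp).
  move=> y /andP[_ yf]; rewrite (fadj_path _ ufl pps wp).
  suff /negbTE yp : y \notin p by rewrite /padj yp andbF mul0r.
  have : uniq (flatten (p :: rem p ps)).
    by rewrite -(perm_uniq (perm_flatten (perm_to_rem pps))).
  by rewrite /= cat_uniq => /and3P[_ /hasPn dis _]; exact: dis.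
rewrite /forest_sol (path_of_mem ufl pps wp).
set k := index w p; set a := size p.
have ka : (k < a)%N by rewrite index_mem.
have -> : \sum_(y <- p) (padj p w y)%:R * psol q (index y p).+1 (a - index y p) =
   \sum_(y <- p) ((index y p == k.+1)%:R * psol q (index y p).+1 (a - index y p) +
                  (k == (index y p).+1)%:R * psol q (index y p).+1 (a - index y p)).
  apply: eq_big_seq => y yp; rewrite -mulrDl; congr (_ * _).
  rewrite /padj wp yp /= -/k.
  case: (eqVneq (index y p) k.+1) => [->|_] /=; last by rewrite add0r.
  have -> : (k == k.+2) = false by lia.
  by rewrite addr0.
rewrite (big_index (fun i => (i == k.+1)%:R * psol q i.+1 (a - i) + (k == i.+1)%:R * psol q i.+1 (a - i))) //.
rewrite big_split /= (big_ord_delta a k.+1 (fun j => psol q j.+1 (a - j))).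
have -> : \sum_(i < a) (k == i.+1)%:R * psol q i.+1 (a - i) = psol q k (a - k).+1.
  case: (posnP k) => k0.
    by rewrite k0 psol0 // big1 // => i _; rewrite mul0r.
  have := big_ord_delta a k.-1 (fun j => psol q j.+1 (a - j)).
  have ka1 : (k.-1 < a)%N by lia.
  rewrite ka1 (prednK k0).
  have -> : (a - k.-1 = (a - k).+1)%N by lia.
  by move=> <-; apply: eq_bigr => i _; congr (_%:R * _); congr nat_of_bool; lia.
have rec := psol_rec q0 q1 k (a - k.+1); rewrite -/rho in rec.
have E1 : ((a - k.+1).+1 = a - k)%N by lia.
rewrite E1 in rec; rewrite rec.
case: ifP => h.
  by ring.
have -> : (a - k.+1 = 0)%N by lia.
rewrite (psolC q k.+2) psol0 //; by ring.
Qed.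

Lemma forest_sol_sum :
  (rho - 2) * \sum_(w <- fl) forest_sol w =
  (sumn (map size ps))%:R - 2 * ((1 - q) / (rho - 2)) * \sum_(a <- map size ps) zeta q a.
Proof.
have ufl := decomp_uniq.
have -> : \sum_(w <- fl) forest_sol w = \sum_(p <- ps) \sum_(i < size p) psol q i.+1 (size p - i).
  rewrite /fl big_flatten /=; apply: eq_big_seq => p pps.
  rewrite -(big_index (fun i => psol q i.+1 (size p - i))) ?(uniq_path ufl pps) //.
  by apply: eq_big_seq => w wp; rewrite /forest_sol (path_of_mem ufl pps wp).
rewrite mulr_sumr sumnE natr_sum !big_map mulr_sumr -sumrB; apply: eq_bigr => p _.
by rewrite psol_sum // -/rho; ring.
Qed.

Lemma join_row (X : T -> R) w : w \in fl ->
  \sum_y (g w y)%:R * X y = X u + X v + \sum_(y <- fl) (fadj ps w y)%:R * X y.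
Proof.
case: (dec) => un cov gE wfl; rewrite (join_decomp_sum _ dec) !gE !inE !eqxx /= !orbT.
have [wu wv] : w != u /\ w != v.
  move: un; rewrite /= !inE negb_or => /and3P[/andP[_ uf] vf _].
  by split; apply/eqP => wE; [move: uf|move: vf]; rewrite -wE wfl.
rewrite wu wv !mul1r; congr (_ + _); apply: eq_big_seq => y yfl.
have [yu yv] : y != u /\ y != v.
  move: un; rewrite /= !inE negb_or => /and3P[/andP[_ uf] vf _].
  by split; apply/eqP => yE; [move: uf|move: vf]; rewrite -yE yfl.
rewrite gE !inE (negbTE wu) (negbTE wv) (negbTE yu) (negbTE yv) /=.
by case: (eqVneq w y) => [->|] //=; rewrite fadj_irr.
Qed.

Lemma join_row_center (X : T -> R) c c' : (c, c') \in [:: (u, v); (v, u)] ->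
  \sum_y (g c y)%:R * X y = X c' + \sum_(y <- fl) X y.
Proof.
case: (dec) => un cov gE cc; rewrite (join_decomp_sum _ dec) !gE.
have uv : u != v by move: un; rewrite /= inE negb_or => /andP[/andP[]].
have -> : \sum_(y <- flatten ps) (g c y)%:R * X y = \sum_(y <- fl) X y.
  apply: eq_big_seq => y yfl; rewrite gE.
  have [yu yv] : y != u /\ y != v.
    move: un; rewrite /= !inE negb_or => /and3P[/andP[_ uf] vf _].
    by split; apply/eqP => yE; [move: uf|move: vf]; rewrite -yE yfl.
  by move: cc; rewrite !inE => /orP[] /eqP[-> _]; rewrite eqxx ?orbT !(eq_sym _ y) ?yu ?yv mul1r.
move: cc; rewrite !inE => /orP[] /eqP[-> ->]; rewrite !eqxx ?orbT ?(eq_sym v u) ?uv /= mul1r mul0r.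
  by rewrite add0r.
by rewrite addr0.
Qed.

Lemma fadj_pairing (X Z : T -> R) :
  \sum_(w <- fl) (\sum_(y <- fl) (fadj ps w y)%:R * X y) * Z w =
  \sum_(w <- fl) (\sum_(y <- fl) (fadj ps w y)%:R * Z y) * X w.
Proof.
under eq_bigr do rewrite mulr_suml; rewrite exchange_big /=; apply: eq_bigr => w _.
by rewrite mulr_suml; apply: eq_bigr => y _; rewrite fadj_sym; ring.
Qed.

(** On the paths [X] and [forest_sol] solve the same system with loads [X u + X v] and 1. Since the
    adjacency is symmetric, pairing them gives [S = (X u + X v) * Z]. The equations at the centers
    add up to [rho * (X u + X v) = X u + X v + 2 * S], and [X u + X v] is nonzero. *)
Lemma join_eigen_value (X : T -> R) : (forall w, 0 <= X w) -> (exists w, X w != 0) ->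
  (forall w, \sum_y (g w y)%:R * X y = rho * X w) ->
  rho = 1 + 2 * \sum_(w <- fl) forest_sol w.
Proof.
move=> X0 [w0 w0n] eig.
pose S := \sum_(w <- fl) X w; pose Z := \sum_(w <- fl) forest_sol w.
have hu : rho * X u = X v + S by rewrite -eig (@join_row_center X u v) // inE eqxx.
have hv : rho * X v = X u + S by rewrite -eig (@join_row_center X v u) // !inE eqxx orbT.
have hS : S = (X u + X v) * Z.
  have E := fadj_pairing X forest_sol.
  have L : \sum_(w <- fl) (\sum_(y <- fl) (fadj ps w y)%:R * X y) * forest_sol w =
      \sum_(w <- fl) (rho * (X w * forest_sol w) - (X u + X v) * forest_sol w).
    apply: eq_big_seq => w wfl; have := join_row X wfl; rewrite eig => h.
    have -> : \sum_(y <- fl) (fadj ps w y)%:R * X y = rho * X w - (X u + X v) by lra.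
    by ring.
  have Rr : \sum_(w <- fl) (\sum_(y <- fl) (fadj ps w y)%:R * forest_sol y) * X w =
      \sum_(w <- fl) (rho * (X w * forest_sol w) - X w).
    by apply: eq_big_seq => w wfl; rewrite forest_sol_rec //; ring.
  move: E; rewrite L Rr !sumrB -!mulr_sumr -/Z -/S; lra.
have c0 : X u + X v != 0.
  apply/negP => /eqP c; have S0 : S = 0 by rewrite hS c mul0r.
  have [Xu Xv] : X u = 0 /\ X v = 0 by have xu := X0 u; have xv := X0 v; split; lra.
  have : \sum_w X w = 0 by rewrite (join_decomp_sum _ dec) Xu Xv !add0r.
  move=> /eqP; rewrite psumr_eq0 // => /allP/(_ w0 (mem_index_enum _)) /=.
  by rewrite (negbTE w0n).
apply: (mulfI c0); rewrite -/Z; move: hu hv; rewrite hS; lra.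
Qed.

(** The test function is 1 at the centers and twice [forest_sol] on the paths, so the eigenvalue
    equation at [rho] holds exactly along the paths. Their part [rho * Q] is at least [r * Q], and
    what remains is the inequality at the centers. *)
Lemma join_rayleigh_value (r : R) : r <= rho ->
  (forall X : T -> R, \sum_a \sum_b (g a b)%:R * X a * X b <= r * \sum_a X a ^+ 2) ->
  1 + 2 * \sum_(w <- fl) forest_sol w <= rho.
Proof.
move=> rr ub.
pose Z := \sum_(w <- fl) forest_sol w.
pose X w : R := if (w == u) || (w == v) then 1 else 2 * forest_sol w.
have [un _ _] := dec.
have Xu : X u = 1 by rewrite /X eqxx.
have Xv : X v = 1 by rewrite /X eqxx orbT.
have Xw w : w \in fl -> X w = 2 * forest_sol w.
  move=> wfl; rewrite /X; case: ifP => // /orP[] /eqP wE; move: un; rewrite /= !inE negb_or -wE.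
    by rewrite wfl andbF.
  by rewrite wfl andbF.
have SX : \sum_(w <- fl) X w = 2 * Z by rewrite mulr_sumr; apply: eq_big_seq.
have row w : w \in fl -> \sum_y (g w y)%:R * X y = rho * X w.
  move=> wfl; rewrite join_row // Xu Xv Xw //.
  have -> : \sum_(y <- fl) (fadj ps w y)%:R * X y = 2 * \sum_(y <- fl) (fadj ps w y)%:R * forest_sol y.
    by rewrite mulr_sumr; apply: eq_big_seq => y yfl; rewrite Xw //; ring.
  by rewrite forest_sol_rec //; ring.
have := ub X.
have -> : \sum_a \sum_b (g a b)%:R * X a * X b = \sum_a X a * (\sum_b (g a b)%:R * X b).
  by apply: eq_bigr => a _; rewrite mulr_sumr; apply: eq_bigr => b _; ring.
rewrite (join_decomp_sum (fun a => X a * (\sum_b (g a b)%:R * X b)) dec).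
rewrite (join_decomp_sum (fun a => X a ^+ 2) dec) (@join_row_center X u v) ?inE ?eqxx //.
rewrite (@join_row_center X v u) ?inE ?eqxx ?orbT // Xu Xv SX.
have -> : \sum_(w <- fl) X w * (\sum_b (g w b)%:R * X b) = rho * \sum_(w <- fl) X w ^+ 2.
  by rewrite mulr_sumr; apply: eq_big_seq => w wfl; rewrite row //; ring.
set Q := \sum_(w <- fl) _; have Q0 : 0 <= Q by apply: sumr_ge0 => w _; rewrite sqr_ge0.
have : r * Q <= rho * Q by apply: ler_wpM2r.
rewrite -/Z; lra.
Qed.

End JoinCost.

(** For [Z] the total of [forest_sol], the first join has [rho = 1 + 2 * Z], the second only
    [1 + 2 * Z' <= rho]. For equal numbers of vertices both totals are the same decreasing affine
    function of the total of [zeta q]. *)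
Theorem join_cost_le (R : realFieldType) (q : R) (T T' : finType) (g : rel T) (g' : rel T')
    u v ps u' v' ps' (X : T -> R) (r : R) : 0 < q -> q < 1 ->
  join_decomp g u v ps -> join_decomp g' u' v' ps' ->
  sumn (map size ps) = sumn (map size ps') ->
  (forall w, 0 <= X w) -> (exists w, X w != 0) ->
  (forall w, \sum_y (g w y)%:R * X y = (q + q^-1) * X w) -> r <= q + q^-1 ->
  (forall Y : T' -> R, \sum_a \sum_b (g' a b)%:R * Y a * Y b <= r * \sum_a Y a ^+ 2) ->
  \sum_(a <- map size ps) zeta q a <= \sum_(a <- map size ps') zeta q a.
Proof.
move=> q0 q1 dec dec' szE X0 Xn eig rr ub.
have e1 := join_eigen_value q0 q1 dec X0 Xn eig.
have e2 := join_rayleigh_value q0 q1 dec' rr ub.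
have s1 := forest_sol_sum q0 q1 dec; have s2 := forest_sol_sum q0 q1 dec'.
have r2 := rho_gt2 q0 q1.
have : (q + q^-1 - 2) * \sum_(w <- flatten ps') forest_sol q ps' w <=
       (q + q^-1 - 2) * \sum_(w <- flatten ps) forest_sol q ps w.
  by apply: ler_wpM2l; [exact: ltW|lra].
rewrite s1 s2 szE lerD2l lerN2.
have k0 : 0 < 2 * ((1 - q) / (q + q^-1 - 2)).
  by rewrite mulr_gt0 // divr_gt0 // subr_gt0.
by rewrite ler_pM2l.
Qed.

(** * Majorization *)

Section Majorization.
Variables (R : realFieldType) (F : nat -> R).
Let D a := F a.+1 - F a.
Hypothesis D_decr : forall a, D a.+1 < D a.

Lemma slope_anti a b : (a <= b)%N -> D b <= D a.
Proof.
by move=> /subnK <-; elim: (b - a)%N => // k IH; rewrite addSn (le_trans _ IH) // ltW.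
Qed.

Lemma concave_above a k : F (a + k) - F a <= D a * k%:R ?= iff (k <= 1)%N.
Proof.
elim: k => [|k IH]; first by split; rewrite ?addn0 ?subrr ?mulr0 ?eqxx.
have E : F (a + k.+1) - F a = D (a + k) + (F (a + k) - F a) by rewrite /D addnS; ring.
have Dk := slope_anti (leq_addr k a); have [le1 eq1] := IH.
case: k IH E Dk le1 eq1 => [|k] IH E Dk le1 eq1.
  by split; rewrite addn1 mulr1 // eqxx.
have lt : D (a + k.+1) < D a.
  by apply: le_lt_trans (D_decr a); rewrite addnS; apply: slope_anti; rewrite ltnS leq_addr.
have : F (a + k.+2) - F a < D a * k.+2%:R by rewrite E -(natr1 k.+1) mulrDr mulr1; lra.
by move=> h; split; [exact: ltW|rewrite lt_eqF].
Qed.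

Lemma concave_below a k : F a - F (a + k.+1) < D (a + k.+1) * - (k.+1)%:R.
Proof.
elim: k => [|k IH].
  by rewrite addn1; have := D_decr a; rewrite /D mulrN mulr1; lra.
have E : F a - F (a + k.+2) = - D (a + k.+1) + (F a - F (a + k.+1)) by rewrite /D !addnS; ring.
have lt := D_decr (a + k.+1); rewrite -addnS in lt.
rewrite E -(natr1 k.+1).
have : D (a + k.+1) * - k.+1%:R <= D (a + k.+2) * - k.+1%:R.
  by rewrite !mulrN lerN2 ler_wpM2r // ltW.
by move: IH lt; rewrite -[D (a + k.+2) * _]/(D (a + k.+2) * _); lra.
Qed.

Lemma tangent a b : F b - F a <= D a * (b%:R - a%:R).
Proof.
case: (leqP a b) => [/subnK <-|/ltnW/subnK].
  by rewrite natrD addrK addnC; have [] := concave_above a (b - a).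
case: (a - b)%N => [<-|k <-]; first by rewrite add0n !subrr mulr0.
have := concave_below b k; rewrite addnC => /ltW; rewrite natrD.
by have -> : b%:R - (k.+1%:R + b%:R) = - k.+1%:R :> R by ring.
Qed.

(** The line of slope [D a] also touches at [a.+1], so equality yields an inequality only; summed
    against equal totals this is enough. *)
Lemma tangent_eq a b : F b - F a = D a * (b%:R - a%:R) -> (a <= b)%N.
Proof.
move=> E; rewrite leqNgt; apply/negP => ba.
have [k ak] : exists k, a = (b + k.+1)%N by exists (a - b.+1)%N; lia.
have := concave_below b k; rewrite -ak E ak natrD.
have -> : b%:R - (b%:R + k.+1%:R) = - k.+1%:R :> R by ring.
by rewrite ltxx.
Qed.

Variables (f g : nat -> nat) (N : nat).
Hypothesis f_decr : forall i j, (i <= j)%N -> (f j <= f i)%N.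
Hypothesis prefix : forall k, (k <= N)%N -> (\sum_(i < k) f i <= \sum_(i < k) g i)%N.
Hypothesis total : (\sum_(i < N) f i = \sum_(i < N) g i)%N.

(** Abel summation: the prefix excesses are nonnegative and the slopes [D (f i)] grow with [i], so
    replacing every slope by the last one can only increase the sum. *)
Lemma abel_bound k : (k < N)%N ->
  \sum_(i < k.+1) D (f i) * ((g i)%:R - (f i)%:R) <=
  D (f k) * ((\sum_(i < k.+1) g i)%:R - (\sum_(i < k.+1) f i)%:R).
Proof.
elim: k => [|k IH] kN; first by rewrite !big_ord1.
rewrite big_ord_recr /= (big_ord_recr k.+1 (fun i : 'I_k.+2 => g i)) /=.
rewrite (big_ord_recr k.+1 (fun i : 'I_k.+2 => f i)) /= !natrD.
have {}IH := IH (ltnW kN).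
have P0 : 0 <= (\sum_(i < k.+1) g i)%:R - (\sum_(i < k.+1) f i)%:R :> R.
  by rewrite subr_ge0 ler_nat prefix // ltnW.
have Dm : D (f k) <= D (f k.+1) by apply/slope_anti/f_decr.
have := ler_wpM2r P0 Dm; move: IH.
move: (\sum_(i < k.+1) D _ * _) (D (f k)) (D (f k.+1)) ((\sum_(i < k.+1) g i)%:R : R) ((\sum_(i < k.+1) f i)%:R : R).
by move=> S d d' A B; lra.
Qed.

(** Karamata's inequality with its case of equality: the tangents at the points [f i] bound the
    differences, their total is at most 0, and so the assumed inequality makes every tangent
    estimate tight. *)
Theorem majorization : \sum_(i < N) F (f i) <= \sum_(i < N) F (g i) -> forall i, (i < N)%N -> f i = g i.
Proof.
move=> le.
have tot : \sum_(i < N) D (f i) * ((g i)%:R - (f i)%:R) <= 0.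
  case: (N) total abel_bound => [|k] tt ab; first by rewrite big_ord0.
  by have := ab k (ltnSn k); rewrite tt subrr mulr0.
have tight (i : 'I_N) : F (g i) - F (f i) = D (f i) * ((g i)%:R - (f i)%:R).
  pose h i := D (f i) * ((g i)%:R - (f i)%:R) - (F (g i) - F (f i)).
  have h0 j : 0 <= h j by rewrite subr_ge0 tangent.
  have : \sum_(j < N) h j <= 0 by rewrite /h !sumrB; lra.
  move=> hs; have /eqP : \sum_(j < N) h j = 0.
    by apply/eqP; rewrite eq_le hs sumr_ge0.
  rewrite psumr_eq0 // => /allP/(_ i (mem_index_enum _)); rewrite /= /h subr_eq0 => /eqP ->.
  by [].
have fg (i : 'I_N) : (f i <= g i)%N by apply: tangent_eq.
move=> i iN; have : (\sum_(j < N) (g j - f j) = 0)%N.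
  by rewrite sumnB // total subnn.
move/eqP; rewrite sum_nat_eq0 => /forallP/(_ (Ordinal iN)) /= /eqP h.
by have := fg (Ordinal iN); rewrite /=; lia.
Qed.

End Majorization.

Definition prefix_sum (s : seq nat) (k : nat) : nat := sumn (take k s).

Lemma prefix_sumE s k : prefix_sum s k = \sum_(i < k) nth 0%N s i.
Proof.
elim: s k => [|a s IH] [|k]; rewrite /prefix_sum ?big_ord0 //=.
  by rewrite big1 // => i _; rewrite nth_nil.
by rewrite big_ord_recl /= -[sumn (take k s)]/(prefix_sum s k) IH.
Qed.

Lemma sum_padded (R : realFieldType) (F : nat -> R) (s : seq nat) N : F 0%N = 0 -> (size s <= N)%N ->
  \sum_(a <- s) F a = \sum_(i < N) F (nth 0%N s i).
Proof.
move=> F0; elim: s N => [|a s IH] N.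
  by rewrite big_nil big1 // => i _; rewrite nth_nil.
by case: N => // N; rewrite ltnS => sN; rewrite big_cons big_ord_recl /= (IH N).
Qed.

Lemma eq_from_nth_pos (s s' : seq nat) : all (fun a => 0 < a)%N s -> all (fun a => 0 < a)%N s' ->
  (forall i, nth 0%N s i = nth 0%N s' i) -> s = s'.
Proof.
elim: s s' => [|a s IH] [|b s'] //=.
- by move=> _ /andP[b0 _] /(_ 0%N) /= h; rewrite -h in b0.
- by move=> /andP[a0 _] _ /(_ 0%N) /= h; rewrite h in a0.
move=> /andP[_ ps] /andP[_ ps'] h; have /= -> := h 0%N.
by rewrite (IH s') // => i; apply: (h i.+1).
Qed.

Theorem zeta_majorization (R : realFieldType) (q : R) (s s' : seq nat) : 0 < q -> q < 1 ->
  sorted geq s -> all (fun a => 0 < a)%N s -> all (fun a => 0 < a)%N s' ->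
  (forall k, (prefix_sum s k <= prefix_sum s' k)%N) -> sumn s = sumn s' ->
  \sum_(a <- s) zeta q a <= \sum_(a <- s') zeta q a -> s = s'.
Proof.
move=> q0 q1 srt pos pos' pre tot le.
pose N := (size s + size s')%N.
have sN : (size s <= N)%N by rewrite leq_addr.
have s'N : (size s' <= N)%N by rewrite leq_addl.
have full (r : seq nat) : (size r <= N)%N -> \sum_(i < N) nth 0%N r i = sumn r.
  by move=> rN; rewrite -prefix_sumE /prefix_sum take_oversize.
apply: eq_from_nth_pos => // i.
have [iN|iN] := ltnP i N; last by rewrite !nth_default // (leq_trans _ iN).
apply: (@majorization R (zeta q) _ (nth 0%N s) (nth 0%N s') N) => //.
- by move=> a; apply: zeta_concave.
- move=> j k jk; have [ks|ks] := ltnP k (size s); last by rewrite nth_default.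
  have tr : transitive geq by move=> a b c ba cb; apply: leq_trans cb ba.
  by apply: (sorted_leq_nth tr (fun a => leqnn a) 0%N srt); rewrite ?inE //; apply: leq_ltn_trans ks.
- by move=> k _; rewrite -!prefix_sumE.
- by rewrite !full.
by rewrite -!sum_padded // /zeta expr0 subrr mul0r.
Qed.

(** * Prefix sums of the path orders *)

Local Open Scope nat_scope.

Lemma prefix_sumS s k : prefix_sum s k.+1 = prefix_sum s k + nth 0 s k.
Proof. by rewrite !prefix_sumE big_ord_recr. Qed.

Lemma prefix_sum_le s k : prefix_sum s k <= sumn s.
Proof. by rewrite -{2}(cat_take_drop k s) sumn_cat leq_addr. Qed.

Lemma prefix_sum_tail s c j k : (forall i, j <= i -> nth 0 s i <= c) ->
  prefix_sum s (j + k) <= prefix_sum s j + k * c.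
Proof.
move=> h; elim: k => [|k IH]; first by rewrite addn0 mul0n addn0.
rewrite addnS prefix_sumS mulSn addnCA addnC leq_add //; first exact/h/leq_addr.
Qed.

Definition equal_parts (M c : nat) : seq nat :=
  nseq (M %/ c) c ++ (if M %% c == 0 then [::] else [:: M %% c]).

Lemma HP2E n n1 n2 : HP2 n n1 n2 = n1 :: equal_parts (n - 2 - n1) n2.
Proof. by []. Qed.

Lemma HP3E n n1 n2 n3 : HP3 n n1 n2 n3 = n1 :: n2 :: equal_parts (n - 2 - n1 - n2) n3.
Proof. by []. Qed.

Lemma equal_parts_sum M c : sumn (equal_parts M c) = M.
Proof.
rewrite /equal_parts sumn_cat sumn_nseq [RHS](divn_eq M c) mulnC; congr (_ + _).
by case: eqP => [->|_] //=; rewrite addn0.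
Qed.

Lemma equal_parts_pos M c : 0 < c -> all (fun a => 0 < a) (equal_parts M c).
Proof.
move=> c0; rewrite all_cat all_nseq c0 orbT /=.
by case: eqP => //= /eqP; rewrite -lt0n => ->.
Qed.

Lemma equal_parts_size M c : size (equal_parts M c) <= (M %/ c).+1.
Proof. by rewrite size_cat size_nseq -addn1 leq_add2l; case: ifP. Qed.

Lemma equal_parts_prefix M c k : 0 < c -> minn M (k * c) <= prefix_sum (equal_parts M c) k.
Proof.
move=> c0; case: (leqP k (M %/ c)) => [kM|Mk].
  by rewrite /prefix_sum takel_cat ?size_nseq // take_nseq // sumn_nseq mulnC geq_minr.
rewrite /prefix_sum take_oversize; first by rewrite equal_parts_sum geq_minl.
exact: leq_trans (equal_parts_size M c) Mk.
Qed.

(** For a part smaller than [c], [c - 1] times its cost is at least [1 - 2 * q] per vertex, while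
    the budget is about [1 / c] per vertex; [4 * c * q <= 1] keeps these apart. If fewer than [K0]
    parts reached [c], they would cover at most [K0 * B] vertices, and the small parts alone would
    exceed the budget. *)
Lemma many_large_parts (R : realFieldType) (q : R) (s : seq nat) (c K0 B m : nat) :
  (0 < q)%R -> (q < 1)%R -> 0 < c -> (4 * c%:R * q <= 1)%R ->
  all (fun a => a < B) s -> m <= sumn s %/ c + 3 -> 2 * c * (K0 * B + 3 * c) < sumn s ->
  (\sum_(a <- s) zeta q a <= m%:R)%R ->
  K0 <= count (fun a => c <= a) s.
Proof.
move=> q0 q1 c0 qc sB ms large cost; rewrite leqNgt; apply/negP => few.
have z1 a : 0 < a -> (1 - 2 * q <= zeta q a)%R.
  move=> a0; have mono k : (zeta q 1 <= zeta q k.+1)%R.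
    elim: k => // k IH; have := zetaS_gt0 q0 q1 k.+1; lra.
  apply: Order.POrderTheory.le_trans (_ : zeta q 1 <= _)%R; last by rewrite -(prednK a0).
  have qq := mulr_gt0 q0 q0; have qqq := mulr_gt0 qq q0.
  have qq1 : (q * q <= q)%R by rewrite ger_pMl // ltW.
  by rewrite /zeta expr1 expr2 ler_pdivlMr; lra.
have c1 : (1 <= c%:R :> R)%R by rewrite (ler_nat R 1).
have q4 : (4 * q <= 1)%R by have := ler_wpM2l (ltW q0) c1; lra.
have termwise a : (a < c) -> ((1 - 2 * q) * a%:R <= (c%:R - 1) * zeta q a)%R.
  case: a => [|a] ac; first by rewrite zeta0 !mulr0.
  have ac' : (a.+1%:R <= c%:R - 1 :> R)%R by rewrite lerBrDr natr1 ler_nat.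
  apply: Order.POrderTheory.le_trans (_ : (1 - 2 * q) * (c%:R - 1) <= _)%R.
    by apply: ler_wpM2l ac'; lra.
  by rewrite mulrC; apply: ler_wpM2l; [lra|exact: z1].
have small_sum : ((1 - 2 * q) * (\sum_(a <- s | a < c) a)%N%:R <= (c%:R - 1) * m%:R)%R.
  apply: Order.POrderTheory.le_trans (_ : (c%:R - 1) * \sum_(a <- s) zeta q a <= _)%R; last first.
    by apply: ler_wpM2l cost; lra.
  rewrite natr_sum !mulr_sumr [X in (_ <= X)%R](bigID (fun a => (a < c)%N)) /=.
  rewrite -[X in (X <= _)%R]addr0; apply: lerD; first by apply: ler_sum => a; exact: termwise.
  by apply: sumr_ge0 => a _; apply: mulr_ge0; [lra|exact: zeta_ge0].
have split_sum : sumn s <= \sum_(a <- s | a < c) a + K0 * B.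
  rewrite sumnE (bigID (fun a => a < c)) /= leq_add2l.
  apply: (@leq_trans (count (fun a => c <= a) s * B)); last by rewrite leq_mul2r ltnW ?orbT.
  rewrite -sum1_count big_distrl /=; under [X in X <= _]eq_bigl do rewrite -leqNgt.
  rewrite [X in X <= _]big_seq_cond [X in _ <= X]big_seq_cond; apply: leq_sum => a /andP[as_ _].
  by rewrite mul1n ltnW // (allP sB).
move: ms large split_sum small_sum; set M := sumn s; set S := \sum_(a <- s | _) a => ms large split_sum small_sum.
have mR : (c%:R * m%:R <= M%:R + 3 * c%:R :> R)%R.
  rewrite -!natrM -natrD ler_nat; apply: leq_trans (_ : c * (M %/ c + 3) <= _); first by rewrite leq_mul2l ms orbT.
  by rewrite mulnDr leq_add // mulnC ?leq_divM.
have lR : (2 * c%:R * (K0%:R * B%:R + 3 * c%:R) < M%:R :> R)%R.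
  by rewrite -!(natrM, natrD) ltr_nat.
have sR : (M%:R <= S%:R + K0%:R * B%:R :> R)%R by rewrite -natrM -natrD ler_nat.
have h1 := ler_wpM2l (Order.POrderTheory.le_trans ler01 c1) small_sum.
have c10 : (0 <= c%:R - 1 :> R)%R by lra.
have h2 := ler_wpM2l c10 mR.
have cq0 : (0 <= c%:R * (1 - 2 * q))%R by apply: mulr_ge0; lra.
have h3 := ler_wpM2l cq0 sR.
have h4 := ler_wpM2r (ler0n R M) qc.
have h5 : (0 <= c%:R * q * (K0%:R * B%:R))%R by rewrite !mulr_ge0 ?ler0n // ltW.
move: (c%:R)%R (m%:R)%R (M%:R)%R (S%:R)%R (K0%:R)%R (B%:R)%R h1 h2 h3 h4 h5 lR c1 => C m' M' S' K B' h1 h2 h3 h4 h5 lR c1.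
have C2 : (0 <= C * 1)%R by lra.
lra.
Qed.

Lemma sorted_geq_nth s i j : sorted geq s -> i <= j -> nth 0 s j <= nth 0 s i.
Proof.
move=> srt ij; have [js|js] := ltnP j (size s); last by rewrite nth_default.
have tr : transitive geq by move=> a b c ba cb; apply: leq_trans cb ba.
by apply: (sorted_leq_nth tr (fun a => leqnn a) 0 srt); rewrite ?inE //; apply: leq_ltn_trans js.
Qed.

Lemma sorted_geq_count s c k i : sorted geq s -> k <= count (fun a => c <= a) s -> i < k -> c <= nth 0 s i.
Proof.
move=> srt kc ik; rewrite leqNgt; apply/negP => small.
have : count (fun a => c <= a) s <= i.
  rewrite -(cat_take_drop i s) count_cat.
  have -> : count (fun a => c <= a) (drop i s) = 0.
    apply/eqP; rewrite -leqn0 leqNgt -has_count; apply/negP => /hasP[a /(nthP 0)[j js <-]].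
    rewrite nth_drop leqNgt => /negP; apply; apply: leq_ltn_trans small.
    by apply: sorted_geq_nth => //; rewrite leq_addr.
  by rewrite addn0 (leq_trans (count_size _ _)) // size_take_min geq_minl.
by lia.
Qed.

Lemma HP2_prefix s n n1 c : 0 < c -> sumn s = n - 2 ->
  (forall k, prefix_sum s k.+1 <= n1 + k * c) ->
  forall k, prefix_sum s k <= prefix_sum (HP2 n n1 c) k.
Proof.
move=> c0 tot h [|k]; first by rewrite /prefix_sum take0.
rewrite HP2E /prefix_sum /= -/(prefix_sum _ _).
have := equal_parts_prefix (n - 2 - n1) k c0; have := h k; have := prefix_sum_le s k.+1.
rewrite tot /prefix_sum; lia.
Qed.

Lemma HP3_prefix s n n1 n2 c : 0 < c -> sumn s = n - 2 -> nth 0 s 0 <= n1 ->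
  (forall k, prefix_sum s k.+2 <= n1 + n2 + k * c) ->
  forall k, prefix_sum s k <= prefix_sum (HP3 n n1 n2 c) k.
Proof.
move=> c0 tot h0 h [|[|k]]; first by rewrite /prefix_sum take0.
  rewrite prefix_sumS HP3E prefix_sumS /prefix_sum !take0 /=; lia.
rewrite HP3E /prefix_sum /= -/(prefix_sum _ _).
have := equal_parts_prefix (n - 2 - n1 - n2) k c0; have := h k; have := prefix_sum_le s k.+2.
rewrite tot /prefix_sum; lia.
Qed.

(** The third order is the least of three with sum at most [l - 3], so it and all later ones are at
    most [c]. As the first three are at least [c], the first is at most [l - 3 - 2 * c] and the
    first two together at most [l - 3 - c]. *)
Lemma prefix_case1 s n l : 6 <= l -> sorted geq s -> sumn s = n - 2 ->
  (forall i, i < 3 -> (l - 3) %/ 3 <= nth 0 s i) ->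
  nth 0 s 0 + nth 0 s 1 + nth 0 s 2 <= l - 3 ->
  forall k, prefix_sum s k <= prefix_sum (HP2 n (l - 3 - 2 * ((l - 3) %/ 3)) ((l - 3) %/ 3)) k.
Proof.
set c := (l - 3) %/ 3 => l6 srt tot big small.
have c0 : 0 < c by rewrite divn_gt0 //; lia.
apply: HP2_prefix => // k.
have [b1 b2] := (big 1 isT, big 2 isT).
have s2c : nth 0 s 2 <= c.
  rewrite leq_divRL //; have := sorted_geq_nth srt (isT : 0 <= 1); have := sorted_geq_nth srt (isT : 1 <= 2).
  by lia.
have P0 : prefix_sum s 0 = 0 by rewrite /prefix_sum take0.
case: k => [|[|k]]; rewrite ?prefix_sumS ?P0; try lia.
have tail i : 2 <= i -> nth 0 s i <= c by move=> i2; apply: leq_trans s2c; exact: sorted_geq_nth.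
have := prefix_sum_tail (j := 2) k.+1 tail; rewrite add2n !prefix_sumS P0.
by lia.
Qed.

(** If the fourth order exceeded [a], both sums would reach [2 * a + 2 >= l - 1]. If the second
    exceeded [b], then [b + 1 + a = l - 1] would again bound both sums from below. *)
Lemma prefix_case2 s n l : 4 <= l -> sorted geq s -> sumn s = n - 2 ->
  (forall i, i < 4 -> (l - 2) %/ 2 <= nth 0 s i) ->
  nth 0 s 0 <= l - 1 ->
  ~~ ((l - 1 <= nth 0 s 0 + nth 0 s 3) && (l - 1 <= nth 0 s 1 + nth 0 s 2)) ->
  forall k, prefix_sum s k <= prefix_sum (HP3 n (l - 1) ((l - 2).+1 %/ 2) ((l - 2) %/ 2)) k.
Proof.
set a := (l - 2) %/ 2; set b := (l - 2).+1 %/ 2 => l4 srt tot big s0 free.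
have ab : a + b = l - 2 by rewrite /a /b; lia.
have ba : a <= b <= a.+1 by rewrite /a /b; lia.
have a0 : 0 < a by rewrite divn_gt0 //; lia.
have [b0 [b1 [b2 b3]]] : a <= nth 0 s 0 /\ a <= nth 0 s 1 /\ a <= nth 0 s 2 /\ a <= nth 0 s 3 by rewrite !big.
have s01 := sorted_geq_nth srt (isT : 0 <= 1); have s12 := sorted_geq_nth srt (isT : 1 <= 2).
have s23 := sorted_geq_nth srt (isT : 2 <= 3).
have s3a : nth 0 s 3 <= a by clear - free s01 s12 s23 ab ba; lia.
have tail i : 3 <= i -> nth 0 s i <= a by move=> i3; apply: leq_trans s3a; exact: sorted_geq_nth.
have P0 : prefix_sum s 0 = 0 by rewrite /prefix_sum take0.
clearbody a b.
apply: HP3_prefix => // k.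
case: k => [|k].
  rewrite !prefix_sumS P0; clear tail big; lia.
have := prefix_sum_tail (j := 3) k tail; rewrite add3n !prefix_sumS P0.
clear tail big; lia.
Qed.

(** Division by [l] writes an order as a multiple of [l] plus at most [l - 1]. By the pigeonhole
    principle the order at index [t - 3], hence every later one, is below [l]. So the quotients of
    any prefix sum to at most [t - 3], and [(t - 3) * l + (l - 1)] is the first claimed order. *)
Lemma prefix_case3 s n t l : 3 <= t -> 3 <= l -> sorted geq s -> sumn s = n - 2 ->
  \sum_(i < t - 2) nth 0 s i %/ l <= t - 3 ->
  forall k, prefix_sum s k <= prefix_sum (HP2 n (t * l - 2 * l - 1) (l - 1)) k.
Proof.
move=> t3 l3 srt tot few; have l0 : 0 < l by lia.
have last0 : nth 0 s (t - 3) %/ l = 0.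
  apply/eqP; rewrite -leqn0 leqNgt; apply/negP => f1.
  have : \sum_(i < t - 2) 1 <= \sum_(i < t - 2) nth 0 s i %/ l.
    apply: leq_sum => i _; apply: leq_trans f1 _; apply: leq_div2r.
    by apply: sorted_geq_nth => //; have := ltn_ord i; lia.
  by rewrite sum_nat_const card_ord muln1; lia.
have zero i : t - 3 <= i -> nth 0 s i %/ l = 0.
  by move=> ti; have := leq_div2r l (sorted_geq_nth srt ti); rewrite last0 leqn0 => /eqP.
have few_all k : \sum_(i < k) nth 0 s i %/ l <= t - 3.
  apply: leq_trans few; have [kt|kt] := leqP k (t - 2).
    by rewrite -(subnKC kt) big_split_ord /= leq_addr.
  rewrite -(subnKC (ltnW kt)) big_split_ord /= -[X in _ <= X]addn0 leq_add2l leqn0.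
  apply/eqP/big1 => i _; apply: zero; lia.
apply: HP2_prefix => //; first by lia.
move=> k; rewrite prefix_sumE.
apply: (@leq_trans (\sum_(i < k.+1) (nth 0 s i %/ l * l + (l - 1)))).
  apply: leq_sum => i _; rewrite {1}(divn_eq (nth 0 s i) l) leq_add2l.
  by have := ltn_pmod (nth 0 s i) l0; lia.
rewrite big_split /= -big_distrl /= sum_nat_const card_ord.
have -> : t * l - 2 * l - 1 = (t - 3) * l + (l - 1) by rewrite -[in LHS](subnK t3) mulnDl; move: ((t - 3) * l) => A; clear - l3; lia.
by rewrite mulSn addnA !leq_add2r leq_mul2r few_all orbT.
Qed.

(** * Paths in a join through its two centers *)

(** Disjointness of lists that are cut and glued from others is reduced to comparing multiplicities,
    which is a matter of [count_cat] and [lia]. *)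
Lemma uniq_count_le (T : eqType) (s1 s2 : seq T) :
  (forall a : pred T, count a s1 <= count a s2) -> uniq s2 -> uniq s1.
Proof.
move=> le u2; have {le} : forall x, count_mem x s1 <= 1.
  by move=> x; apply: leq_trans (le _) _; rewrite count_uniq_mem // leq_b1.
elim: s1 => //= x s1 IH h; rewrite IH; last by move=> y; have := h y; lia.
by rewrite -has_pred1 has_count -leqNgt; have := h x; rewrite eqxx; lia.
Qed.

Lemma count_take_le (T : Type) (a : pred T) k (s : seq T) : count a (take k s) <= count a s.
Proof. by rewrite -{2}(cat_take_drop k s) count_cat leq_addr. Qed.

Section Constructions.
Variables (T : finType) (g : rel T) (u v : T) (ps : seq (seq T)).
Hypothesis dec : join_decomp g u v ps.
Let fl := flatten ps.

(** All edges except [uv]; copies of [tP_l] in this graph are those that [star_tP] can carry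
    back. *)
Definition off_axis : rel T := fun x y => g x y && ((x \notin [:: u; v]) || (y \notin [:: u; v])).

Lemma off_axis_sym : symmetric off_axis.
Proof.
case: dec => _ _ gE x y; rewrite /off_axis !gE (eq_sym y) (fadj_sym ps y).
by congr ((_ && _) && _); [exact: orbCA|exact: orbC].
Qed.

Lemma flatten_off x : x \in fl -> x \notin [:: u; v].
Proof.
case: dec => /=; rewrite !inE negb_or => /and3P[/andP[_ uf] vf _] _ _ xf.
by apply/norP; split; apply/eqP => xE; [move: uf|move: vf]; rewrite -xE xf.
Qed.

Lemma part_sorted p : p \in ps -> sorted off_axis p.
Proof.
move=> pps; case: (dec) => un _ gE; have ufl : uniq fl by case/and3P: un.
have up : uniq p.
  apply: uniq_count_le ufl => a; rewrite /fl; elim: (ps) pps => //= q qs IH.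
  by rewrite inE count_cat => /orP[/eqP ->|/IH]; lia.
apply: padj_sorted => // x y pxy; have fxy : fadj ps x y by apply/hasP; exists p.
have xf : x \in fl := fadj_mem fxy.
have xy : x != y by apply: contraTneq pxy => ->; rewrite padj_irr.
by rewrite /off_axis gE xy fxy !orbT (flatten_off xf).
Qed.

Lemma glue c p1 p2 : c \in [:: u; v] -> sorted off_axis p1 -> sorted off_axis p2 ->
  (if p1 is x :: q then last x q \in fl else true) -> (if p2 is x :: q then x \in fl else true) ->
  sorted off_axis (p1 ++ c :: p2).
Proof.
move=> cc s1 s2 h1 h2.
have adj x : x \in fl -> off_axis c x /\ off_axis x c.
  move=> xf; rewrite off_axis_sym; have xn := flatten_off xf; case: (dec) => _ _ gE.
  have xc : x != c by apply: contraNneq xn => ->.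
  by rewrite /off_axis gE cc xn xc !orbT.
have s2' : path off_axis c p2.
  by case: p2 s2 h2 => //= x q s2 /adj[-> _].
case: p1 s1 h1 => //= x q s1 /adj[_ lc].
by rewrite cat_path s1 /= lc.
Qed.

Lemma part_last p : p \in ps -> if p is x :: q then last x q \in fl else true.
Proof. by case: p => // x q pps; apply/flattenP; exists (x :: q) => //; rewrite mem_last. Qed.

Lemma part_head p : p \in ps -> if p is x :: q then x \in fl else true.
Proof. by case: p => // x q pps; apply/flattenP; exists (x :: q) => //; rewrite inE eqxx. Qed.

Lemma one_center_sorted c p1 p2 : c \in [:: u; v] -> p1 \in ps -> p2 \in ps -> sorted off_axis (p1 ++ c :: p2).
Proof.
move=> cc h1 h2; apply: glue => //; [exact: part_sorted|exact: part_sorted|exact: part_last|exact: part_head].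
Qed.

Lemma two_center_sorted p1 p2 p3 : p1 \in ps -> p2 \in ps -> p3 \in ps -> p2 != [::] ->
  sorted off_axis (p1 ++ u :: p2 ++ v :: p3).
Proof.
move=> h1 h2 h3 n2; apply: glue; rewrite ?inE ?eqxx //; [exact: part_sorted| |exact: part_last|].
  by apply: one_center_sorted; rewrite ?inE ?eqxx ?orbT.
by have := part_head h2; case: (p2) n2.
Qed.

Lemma off_axis_tP t l (qs : seq (seq T)) : size qs = t -> all (fun p => l <= size p) qs ->
  all (sorted off_axis) qs -> uniq (flatten qs) -> contains_sub (tP t l) off_axis.
Proof.
move=> ts ls ss us; apply/(contains_tP _ _ off_axis_sym); exists (map (take l) qs); split.
- by rewrite size_map.
- by rewrite all_map; apply: sub_all ls => p /= lp; rewrite size_takel.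
- apply: uniq_count_le us => a; elim: (qs) => //= q rs IH; rewrite !count_cat leq_add //.
  exact: count_take_le.
- by rewrite all_map; apply: sub_all ss => p /= sp; apply: take_sorted.
Qed.

Lemma three_parts_tP l p1 p2 p3 rest : ps = [:: p1, p2, p3 & rest] -> p2 != [::] ->
  l <= size p1 + size p2 + size p3 + 2 -> contains_sub (tP 1 l) off_axis.
Proof.
move=> psE n2 hl.
have [m1 [m2 m3]] : p1 \in ps /\ p2 \in ps /\ p3 \in ps by rewrite psE !inE !eqxx !orbT.
apply: (@off_axis_tP _ _ [:: p1 ++ u :: p2 ++ v :: p3]) => //=.
- by rewrite size_cat /= size_cat /= andbT; lia.
- by rewrite two_center_sorted.
case: dec => un _ _; apply: uniq_count_le un => a; rewrite psE /= !cats0 !count_cat /= ?count_cat /=.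
lia.
Qed.

Lemma two_pairs_tP l p1 p2 p3 p4 rest : ps = [:: p1, p2, p3, p4 & rest] ->
  l <= size p1 + size p4 + 1 -> l <= size p2 + size p3 + 1 -> contains_sub (tP 2 l) off_axis.
Proof.
move=> psE h1 h2.
have [m1 [m2 [m3 m4]]] : p1 \in ps /\ p2 \in ps /\ p3 \in ps /\ p4 \in ps.
  by rewrite psE !inE !eqxx !orbT.
apply: (@off_axis_tP _ _ [:: p1 ++ u :: p4; p2 ++ v :: p3]) => //=.
- by rewrite !size_cat /=; lia.
- by rewrite !one_center_sorted ?inE ?eqxx ?orbT.
case: dec => un _ _; apply: uniq_count_le un => a; rewrite psE /= !cats0 !count_cat /= ?count_cat /=.
lia.
Qed.

Lemma long_and_three_tP l p1 p2 p3 p4 rest : ps = [:: p1, p2, p3, p4 & rest] -> p3 != [::] ->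
  l <= size p1 -> l <= size p2 + size p3 + size p4 + 2 -> contains_sub (tP 2 l) off_axis.
Proof.
move=> psE n3 h1 h2.
have [m1 [m2 [m3 m4]]] : p1 \in ps /\ p2 \in ps /\ p3 \in ps /\ p4 \in ps.
  by rewrite psE !inE !eqxx !orbT.
apply: (@off_axis_tP _ _ [:: p1; p2 ++ u :: p3 ++ v :: p4]) => //=.
- by rewrite !size_cat /= size_cat /=; lia.
- by rewrite two_center_sorted ?part_sorted.
case: dec => un _ _; apply: uniq_count_le un => a; rewrite psE /= !cats0 !count_cat /= ?count_cat /= ?count_cat /=.
lia.
Qed.

Fixpoint chunks (k l : nat) (p : seq T) : seq (seq T) :=
  if k is k'.+1 then take l p :: chunks k' l (drop l p) else [::].

Lemma size_chunks k l p : size (chunks k l p) = k.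
Proof. by elim: k p => //= k IH p; rewrite IH. Qed.

Lemma chunks_long k l p : k * l <= size p -> all (fun q => l <= size q) (chunks k l p).
Proof.
elim: k p => //= k IH p; rewrite mulSn => h; rewrite size_takel ?leqnn /=; last by lia.
by apply: IH; rewrite size_drop; lia.
Qed.

Lemma chunks_sorted (r : rel T) k l p : sorted r p -> all (sorted r) (chunks k l p).
Proof. by elim: k p => //= k IH p sp; rewrite take_sorted //= IH // drop_sorted. Qed.

Lemma chunks_count a k l p : count a (flatten (chunks k l p)) <= count a p.
Proof.
elim: k p => //= k IH p; rewrite -[in X in _ <= X](cat_take_drop l p) !count_cat leq_add2l.
exact: IH.
Qed.

Lemma long_part_tP t l p : p \in ps -> t * l <= size p -> contains_sub (tP t l) off_axis.
Proof.
move=> pps tl; apply: (@off_axis_tP _ _ (chunks t l p)).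
- exact: size_chunks.
- exact: chunks_long.
- by apply: chunks_sorted; apply: part_sorted.
case: dec => un _ _; apply: uniq_count_le un => a; apply: leq_trans (chunks_count a t l p) _ => /=.
have h : count a p <= count a (flatten ps).
  by elim: (ps) pps => //= q qs IH; rewrite inE count_cat => /orP[/eqP ->|/IH]; lia.
exact: leq_trans h (leq_trans (leq_addl _ _) (leq_addl _ _)).
Qed.

(** The first [t - 2] parts are cut into [t - 2] pieces of [l] vertices, and each center is put in
    front of one of the next two parts, which then need only [l - 1] vertices. *)
Lemma many_chunks_tP t l : 2 <= t -> 0 < l ->
  t - 2 <= \sum_(i < t - 2) size (nth [::] ps i) %/ l ->
  l - 1 <= size (nth [::] ps (t - 2)) -> l - 1 <= size (nth [::] ps (t - 1)) ->
  t <= size ps -> contains_sub (tP t l) off_axis.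
Proof.
move=> t2 l0 enough h1 h2 tps.
have [i1 [i2 [i3 [i4 i5]]]] : t - 2 < size ps /\ t - 1 < size ps /\ t - 2 <= size ps /\
  (t - 2).+2 = t /\ (t - 2).+1 = t - 1 by clear - t2 tps; lia.
pose k := t - 2; pose L := flatten [seq chunks (size p %/ l) l p | p <- take k ps].
have mem p : p \in take k ps -> p \in ps by move=> /mem_take.
have sL : k <= size L.
  rewrite size_flatten /shape -map_comp sumnE big_map /=.
  under eq_bigr do rewrite size_chunks.
  rewrite (big_nth [::]) big_mkord size_takel //.
  by under eq_bigr => i _ do rewrite nth_take //.
have m1 : nth [::] ps (t - 2) \in ps by apply: mem_nth.
have m2 : nth [::] ps (t - 1) \in ps by apply: mem_nth.
have single c p : c \in [:: u; v] -> p \in ps -> sorted off_axis (c :: p).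
  move=> cc pps; apply: (@glue c [::] p) => //; [exact: part_sorted|exact: part_head].
apply: (@off_axis_tP _ _ ((u :: nth [::] ps (t - 2)) :: (v :: nth [::] ps (t - 1)) :: take k L)).
- by rewrite /= size_takel // -i4.
- have aL : all (fun p => l <= size p) L.
    apply/allP => q /flattenP[qs /mapP[p _ ->]].
    exact: (allP (chunks_long (leq_divM (size p) l))).
  rewrite /=; apply/and3P; split; last by apply/allP => q /mem_take; apply: (allP aL).
    by rewrite -(subnK l0) addn1 /= ltnS.
  by rewrite -(subnK l0) addn1 /= ltnS.
- have aL : all (sorted off_axis) L.
    apply/allP => q /flattenP[qs /mapP[p /mem pps ->]].
    exact: (allP (chunks_sorted _ _ (part_sorted pps))).
  apply/and3P; split; last by apply/allP => q /mem_take; apply: (allP aL).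
    by apply: single; rewrite ?inE ?eqxx.
  by apply: single; rewrite ?inE ?eqxx ?orbT.
case: dec => un _ _; apply: uniq_count_le un => a /=.
rewrite !count_cat /= .
have cL : count a (flatten (take k L)) <= count a (flatten (take k ps)).
  apply: (@leq_trans (count a (flatten L))).
    by rewrite -{2}(cat_take_drop k L) flatten_cat count_cat leq_addr.
  rewrite /L; elim: (take k ps) => //= p qs IH.
  by rewrite flatten_cat !count_cat leq_add // chunks_count.
have split_ps : ps = take k ps ++ nth [::] ps (t - 2) :: nth [::] ps (t - 1) :: drop t ps.
  rewrite -{1}(cat_take_drop k ps) (drop_nth [::]) //.
  rewrite (drop_nth [::] (n := k.+1)) ?/k ?i5 //.
  by have -> : (t - 1).+1 = t by rewrite -i5.
have := congr1 (fun qs => count a (flatten qs)) split_ps.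
rewrite /= flatten_cat /= !count_cat /= => ->; move: cL.
by move: (count a (flatten (take k L))) (count a (flatten (take k ps))) => A B; clear; lia.
Qed.

End Constructions.

(** * Long paths in a join are bounded *)

Lemma sum_decr_le (f : nat -> nat) (I : seq nat) k : uniq I -> all (fun i => k <= i) I ->
  (forall i j, i <= j -> f j <= f i) ->
  \sum_(i <- I) f i <= \sum_(j < size I) f (k + j).
Proof.
move=> uI kI decr; rewrite -(size_sort leq) -(perm_big _ (permEl (perm_sort leq I))) /=.
have : path ltn k.-1 (sort leq I) || (k == 0) && sorted ltn (sort leq I).
  have srt : sorted ltn (sort leq I).
    by rewrite ltn_sorted_uniq_leq sort_uniq uI sort_sorted //; exact: leq_total.
  case: k kI => [|k] kI; first by rewrite srt orbT.
  rewrite /= orbF path_min_sorted // all_sort; apply: sub_all kI => i; exact.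
have {uI} : all (fun i => k <= i) (sort leq I) by rewrite all_sort.
elim: (sort leq I) k {kI} => [|i J IH] k; first by rewrite big_nil big_ord0.
move=> /= /andP[ki kJ] pth; rewrite big_cons big_ord_recl /= addn0 leq_add ?decr //.
apply: leq_trans (IH k.+1 _ _) _.
- have pJ : path ltn i J by case/orP: pth => /andP[].
  have := order_path_min ltn_trans pJ; apply: sub_all => j; exact: leq_ltn_trans.
- have pJ : path ltn i J by case/orP: pth => /andP[].
  case: (J) pJ => //= j J' /andP[ij ->]; rewrite andbT orbF; exact: leq_ltn_trans ki ij.
by apply: leq_sum => j _; rewrite addSnnS.
Qed.

Lemma equal_parts_decr M c i j : 0 < c -> i <= j ->
  nth 0 (equal_parts M c) j <= nth 0 (equal_parts M c) i <= c.
Proof.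
move=> c0 ij; have val k : nth 0 (equal_parts M c) k =
    if k < M %/ c then c else if k == M %/ c then M %% c else 0.
  rewrite /equal_parts nth_cat size_nseq nth_nseq; case: ltngtP => // h.
    by case: ifP => _; rewrite ?nth_nil // nth_default //= subn_gt0.
  by rewrite h subnn; case: eqP => [->|].
have := ltn_pmod M c0; rewrite !val.
by case: (ltngtP i (M %/ c)); case: (ltngtP j (M %/ c)); lia.
Qed.

Section Touched.
Variables (T : finType) (g : rel T) (u v : T) (ps : seq (seq T)).
Hypothesis dec : join_decomp g u v ps.
Local Notation center := (fun w => w \in [:: u; v]).
Local Notation part w := (find (fun p : seq T => w \in p) ps).

Definition touched (q : seq T) : seq nat :=
  undup [seq part w | w <- q & w \notin [:: u; v]].

Lemma part_mem w : w \notin [:: u; v] -> part w < size ps /\ w \in nth [::] ps (part w).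
Proof.
case: dec => _ cov _ wn; have : w \in flatten ps.
  by have := cov w; move: wn; rewrite !inE; case: (w == u); case: (w == v).
move=> /flattenP[p pps wp]; have hw : has (fun p => w \in p) ps by apply/hasP; exists p.
by rewrite -has_find; split=> //; apply: (nth_find [::] hw).
Qed.

Lemma part_adj x y : g x y -> x \notin [:: u; v] -> y \notin [:: u; v] -> part x = part y.
Proof.
case: (dec) => un _ gE; rewrite gE => /andP[_ h] /negbTE xn /negbTE yn.
move: h; rewrite xn yn /= => /hasP[p pps /and3P[xp yp _]].
have ufl : uniq (flatten ps) by case/and3P: un.
have key w : w \in p -> part w = index p ps.
  move=> wp; elim: (ps) ufl pps => //= r rs IH; rewrite cat_uniq inE => /and3P[_ /hasPn dis ufl].
  case: (eqVneq p r) => [<- _|pr /= prs]; first by rewrite wp.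
  have /dis/negbTE /= -> : w \in flatten rs by apply/flattenP; exists p.
  by rewrite IH.
by rewrite !key.
Qed.

Lemma touched_size q : sorted g q -> size (touched q) <= (count center q).+1.
Proof.
(* For the induction the extra unit is granted only to a path that starts outside the centers, since
   passing to another part costs a center. *)
suff h : sorted g q -> size (touched q) <= count center q + (if q is x :: _ then x \notin [:: u; v] else false).
  by move=> sq; apply: leq_trans (h sq) _; rewrite -addn1 leq_add2l; case: (q) => // x q'; case: (x \notin _).
elim: q => //= x q IH pq; have sq := path_sorted pq.
have {}IH := IH sq; rewrite /touched /=.
case: (boolP (x \in [:: u; v])) => xc /=.
  apply: leq_trans IH _; rewrite addn0 addnC leq_add2r.
  by case: (q) => // y q'; case: (y \notin _).
rewrite add0n; case: ifP => [_|nin].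
  apply: leq_trans IH _; rewrite leq_add2l; case: (q) => // y q'; by case: (y \notin _).
rewrite /= addn1 ltnS; apply: leq_trans IH _; case: (q) pq nin => [|y q'] /=; first by rewrite addn0.
move=> /andP[xy _]; case: (boolP (y \in [:: u; v])) => yc /=; first by rewrite addn0.
by rewrite (part_adj xy) // inE eqxx.
Qed.

Lemma parts_bound (W : seq T) (I : seq nat) : uniq W -> uniq I ->
  (forall w, w \in W -> w \notin [:: u; v] /\ part w \in I) ->
  size W <= \sum_(i <- I) nth 0 (map size ps) i.
Proof.
move=> uW uI WI; have -> : \sum_(i <- I) nth 0 (map size ps) i = size (flatten [seq nth [::] ps i | i <- I]).
  rewrite size_flatten /shape -map_comp sumnE big_map; apply: eq_big_seq => i iI /=.
  have [ip|ip] := ltnP i (size ps); first by rewrite (nth_map [::]).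
  by rewrite !nth_default ?size_map.
apply: uniq_leq_size => // w /WI[wn wI]; apply/flattenP; exists (nth [::] ps (part w)).
  exact: map_f.
by have [] := part_mem wn.
Qed.

Lemma off_center_count q : size [seq w <- q | w \notin [:: u; v]] + count center q = size q.
Proof. by rewrite size_filter addnC count_predC. Qed.

Lemma center_count q : uniq q -> count center q <= 2.
Proof.
move=> uq; rewrite -size_filter; apply: (@uniq_leq_size _ _ [:: u; v]); first exact: filter_uniq.
by move=> w; rewrite mem_filter => /andP[].
Qed.

Lemma path_size_bound q I : uniq q -> sorted g q -> touched q =i I -> uniq I ->
  size q <= \sum_(i <- I) nth 0 (map size ps) i + count center q.
Proof.
move=> uq sq tI uI; rewrite -(off_center_count q) leq_add2r; apply: parts_bound => //.
  exact: filter_uniq.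
move=> w; rewrite mem_filter => /andP[wn wq]; split=> //; rewrite -tI mem_undup.
by apply: map_f; rewrite mem_filter wn.
Qed.

Hypothesis decr : forall i j, i <= j -> nth 0 (map size ps) j <= nth 0 (map size ps) i.
Local Notation s := (map size ps).

Lemma touched_bound q k : uniq q -> sorted g q -> all (fun i => k <= i) (touched q) ->
  size q <= \sum_(j < (count center q).+1) nth 0 s (k + j) + count center q.
Proof.
move=> uq sq kq; apply: leq_trans (path_size_bound (I := touched q) uq sq _ (undup_uniq _)) _ => //.
rewrite leq_add2r; apply: leq_trans (sum_decr_le (undup_uniq _) kq decr) _.
have := touched_size sq; move: (size _) => m mc.
by rewrite -(subnKC mc) big_split_ord /= leq_addr.
Qed.

Lemma join_free1 l : nth 0 s 0 + nth 0 s 1 + nth 0 s 2 + 2 < l -> ~ contains_sub (tP 1 l) g.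
Proof.
have gsym : symmetric g.
  by case: dec => _ _ gE x y; rewrite !gE (eq_sym y) (fadj_sym ps y) orbCA.
move=> small /(contains_tP _ _ gsym)[[|q [|? ?]] [] // _ /= /andP[/eqP ql _] + /andP[sq _]].
rewrite cats0 => uq; have h := touched_bound (k := 0) uq sq ltac:(by apply/allP).
have c2 := center_count uq.
have mono : \sum_(j < (count center q).+1) nth 0 s (0 + j) <= \sum_(j < 3) nth 0 s (0 + j).
  have c3 : (count center q).+1 <= 3 by [].
  by rewrite -(subnKC c3) big_split_ord /= leq_addr.
have e3 : \sum_(j < 3) nth 0 s (0 + j) = nth 0 s 0 + nth 0 s 1 + nth 0 s 2.
  by rewrite !big_ord_recr big_ord0.
have := leq_trans h (leq_add mono c2); rewrite ql e3; move: small; clear; lia.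
Qed.

(** No part has [l] vertices, so each path uses exactly one center and meets at most two parts.
    Avoiding the first part would leave it too short. Hence both meet it, three parts are met in
    all, and [s_0 + s_1 + s_2 + 2 < 2 * l]. *)
Lemma join_free2 l : nth 0 s 0 < l -> nth 0 s 1 + nth 0 s 2 + 1 < l -> ~ contains_sub (tP 2 l) g.
Proof.
have gsym : symmetric g.
  by case: dec => _ _ gE x y; rewrite !gE (eq_sym y) (fadj_sym ps y) orbCA.
move=> s0 s12 /(contains_tP _ _ gsym)[[|q1 [|q2 [|? ?]]] [] // _ /=].
move=> /and3P[/eqP l1 /eqP l2 _]; rewrite cats0 => uq /and3P[sq1 sq2 _].
have [uq1 uq2] : uniq q1 /\ uniq q2 by move: uq; rewrite cat_uniq => /and3P[].
have cc : count center q1 + count center q2 <= 2 by rewrite -count_cat; apply: center_count.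
have pos q : uniq q -> sorted g q -> size q = l -> 0 < count center q.
  move=> u' s' l'; rewrite lt0n; apply/eqP => c0.
  have := touched_bound (k := 0) u' s' ltac:(by apply/allP).
  by rewrite c0 l' big_ord1 !addn0; move: s0; clear; lia.
have [c1 c2] : count center q1 = 1 /\ count center q2 = 1.
  by have := pos q1 uq1 sq1 l1; have := pos q2 uq2 sq2 l2; lia.
have zero q : uniq q -> sorted g q -> size q = l -> count center q = 1 -> 0 \in touched q.
  move=> u' s' l' c'; apply/negPn/negP => nz.
  have al : all (fun i => 1 <= i) (touched q) by apply/allP => -[|i] //; rewrite (negbTE nz).
  have e2 : \sum_(j < 2) nth 0 s (1 + j) = nth 0 s 1 + nth 0 s 2 by rewrite !big_ord_recr big_ord0.
  by have := touched_bound u' s' al; rewrite c' l' e2; move: s12; clear; lia.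
have z1 := zero q1 uq1 sq1 l1 c1; have z2 := zero q2 uq2 sq2 l2 c2.
pose I := undup (touched q1 ++ touched q2).
have W : size [seq w <- q1 ++ q2 | w \notin [:: u; v]] <= \sum_(i <- I) nth 0 s i.
  apply: parts_bound; [exact: filter_uniq|exact: undup_uniq|].
  move=> w; rewrite mem_filter mem_cat => /andP[wn wq]; split=> //.
  rewrite mem_undup mem_cat /touched !mem_undup.
  by case/orP: wq => wq; apply/orP; [left|right]; apply: map_f; rewrite mem_filter wn.
have sI : size I <= 3.
  have : size I <= size (0 :: rem 0 (touched q1) ++ rem 0 (touched q2)).
    apply: uniq_leq_size; first exact: undup_uniq.
    move=> i; rewrite mem_undup !mem_cat inE mem_cat !(mem_rem_uniq _ (undup_uniq _)) !inE.
    by case: (i == 0).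
  have := touched_size sq1; have := touched_size sq2; rewrite /= size_cat !size_rem // c1 c2.
  move: (size (touched q1)) (size (touched q2)) => m1 m2 t2 t1 h; apply: leq_trans h _; move: t1 t2; clear; lia.
have : \sum_(i <- I) nth 0 s i <= \sum_(j < 3) nth 0 s (0 + j).
  apply: leq_trans (sum_decr_le (k := 0) (undup_uniq _) _ decr) _; first exact/allP.
  by rewrite -[in X in _ <= X](subnKC sI) big_split_ord /= leq_addr.
have := off_center_count (q1 ++ q2); rewrite count_cat size_cat l1 l2 c1 c2.
have e3 : \sum_(j < 3) nth 0 s (0 + j) = nth 0 s 0 + nth 0 s 1 + nth 0 s 2.
  by rewrite !big_ord_recr big_ord0.
by move: W; rewrite e3; move: s0 s12; clear; lia.
Qed.

(** At most two of the paths use a center. Each of the others stays inside one part, which can only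
    be the first, and that has no room for [t - 2] of them. *)
Lemma join_free3 t l : 2 <= t -> nth 0 s 1 < l -> nth 0 s 0 < (t - 2) * l -> ~ contains_sub (tP t l) g.
Proof.
have gsym : symmetric g.
  by case: dec => _ _ gE x y; rewrite !gE (eq_sym y) (fadj_sym ps y) orbCA.
move=> t2 s1 s0 /(contains_tP _ _ gsym)[qs [qt ql uq sq]].
pose free := [seq q <- qs | count center q == 0].
have tfree : t - 2 <= size free.
  have : count (fun q => 0 < count center q) qs <= count center (flatten qs).
    elim: (qs) => //= q rs IH; rewrite count_cat leq_add //; by case: (count center q).
  have := center_count uq; have := count_predC (fun q => count center q == 0) qs.
  rewrite size_filter qt.
  have -> : count (predC (fun q => count center q == 0)) qs = count (fun q => 0 < count center q) qs.
    by apply: eq_count => q /=; rewrite lt0n.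
  lia.
have ufree : uniq (flatten free).
  apply: uniq_count_le uq => a; rewrite /free; elim: (qs) => //= q rs IH.
  by case: ifP => _; rewrite /= !count_cat; lia.
have sz : size (flatten free) = size free * l.
  have : all (fun q => size q == l) free by apply/allP => q; rewrite mem_filter => /andP[_ /(allP ql)].
  by elim: (free) => //= q rs IH /andP[/eqP q_l /IH]; rewrite size_cat q_l mulSn => ->.
have : size (flatten free) <= \sum_(i <- [:: 0]) nth 0 s i.
  apply: parts_bound => // w /flattenP[q]; rewrite mem_filter => /andP[/eqP c0 qqs] wq.
  have uq' : uniq q.
    apply: uniq_count_le uq => a; elim: (qs) qqs => //= r rs IH; rewrite inE count_cat.
    by case/orP => [/eqP ->|/IH]; lia.
  have wn : w \notin [:: u; v].
    apply/negP => wc; have : 0 < count center q by rewrite -has_count; apply/hasP; exists w.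
    by rewrite c0.
  split=> //; rewrite inE; have wt : part w \in touched q.
    by rewrite mem_undup; apply: map_f; rewrite mem_filter wn.
  have := touched_size (allP sq q qqs); rewrite c0.
  case E : (touched q) wt => [|i [|? ?]] //; rewrite inE => /eqP -> _.
  apply/negPn/negP => i0; have al : all (fun i => 1 <= i) (touched q) by rewrite E /= lt0n i0.
  have := touched_bound uq' (allP sq q qqs) al; rewrite c0 big_ord1 (eqP (allP ql q qqs)) !addn0; move: s1; clear; lia.
rewrite big_cons big_nil addn0 sz; have := leq_mul tfree (leqnn l); lia.
Qed.

End Touched.

(** * Planar drawings of joins *)

Local Open Scope ring_scope.

Definition segment (p q : pt) (s : RR) : pt :=
  ((1 - s) * p.1 + s * q.1, (1 - s) * p.2 + s * q.2).

Lemma segment_rev p q s : segment p q s = segment q p (1 - s).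
Proof. by rewrite /segment; congr (_, _); ring. Qed.

Lemma sqdist_ge0 p q : 0 <= sqdist p q.
Proof. by rewrite addr_ge0 // sqr_ge0. Qed.

Lemma segment_cont p q : cont01 (segment p q).
Proof.
move=> t _ eps e0; pose D := sqdist p q + 1.
have D1 : 1 <= D by rewrite lerDr sqdist_ge0.
exists (eps / D); first by rewrite divr_gt0 //; lra.
move=> s _; rewrite ltr_pdivlMr; last by lra.
move=> h.
have -> : sqdist (segment p q s) (segment p q t) = (s - t) ^+ 2 * sqdist p q.
  by rewrite /sqdist /segment /=; ring.
have h2 : (`|s - t| * D) ^+ 2 < eps ^+ 2.
  by rewrite ltr_pXn2r ?nnegrE ?mulr_ge0 ?normr_ge0 //; lra.
apply: le_lt_trans h2; rewrite exprMn real_normK ?num_real //; apply: ler_wpM2l; first exact: sqr_ge0.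
by have := sqdist_ge0 p q; rewrite /D; nra.
Qed.

Lemma segment_inj p q : p <> q -> inj01 (segment p q).
Proof.
move=> pq s t _ _ []; rewrite -/(_ * _) => h1 h2.
have e1 : (s - t) * (q.1 - p.1) = 0 by lra.
have e2 : (s - t) * (q.2 - p.2) = 0 by lra.
apply/eqP; rewrite -subr_eq0; apply/negPn/negP => st; case: pq.
move/eqP: e1; rewrite mulf_eq0 (negbTE st) subr_eq0 => /eqP e1.
move/eqP: e2; rewrite mulf_eq0 (negbTE st) subr_eq0 => /eqP e2.
by apply/eqP; rewrite -pair_eqE /= /pair_eq e1 e2 !eqxx.
Qed.

(* The paths are drawn on a line, with the two centers on either side of it. *)
Definition spot (i : nat) : pt :=
  (i.-1%:R, if i == 0%N then 1 else if i == 1%N then -1 else 0).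

Lemma spot_inj : injective spot.
Proof.
move=> i j [] /eqP; rewrite eqr_nat => /eqP; move: i j => [|[|i]] [|[|j]] //= ij h.
- by exfalso; clear ij; lra.
- by exfalso; clear ij; lra.
- by case: ij => ->.
Qed.

Definition edge_kind (a b : nat) : Prop :=
  [\/ a = 0%N /\ b = 1%N, a = 0%N /\ (1 < b)%N, a = 1%N /\ (1 < b)%N | (1 < a)%N /\ b = a.+1].

Lemma segment_spot a b s : edge_kind a b -> segment (spot a) (spot b) s =
  if (a == 0)%N && (b == 1)%N then (0, 1 - 2 * s) else
  if (a == 0)%N then (s * b.-1%:R, 1 - s) else
  if (a == 1)%N then (s * b.-1%:R, s - 1) else (a.-1%:R + s, 0).
Proof.
case=> [[-> ->]|[-> b1]|[-> b1]|[a1 ->]]; rewrite /segment /spot /=.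
- by congr (_, _); ring.
- by case: b b1 => [|[|b]] // _ /=; congr (_, _); ring.
- by case: b b1 => [|[|b]] // _ /=; congr (_, _); ring.
- by case: a a1 => [|[|a]] // _ /=; congr (_, _); rewrite -?(natr1 a.+1); ring.
Qed.

Lemma nat_between (i j : nat) (t : RR) : in01o t -> i%:R + t = j%:R -> False.
Proof.
move=> /andP[t0 t1] h; have [ij|ij] := leqP j i.
  by move: ij; rewrite -(ler_nat RR); lra.
by move: ij; rewrite -(ler_nat RR) -natr1; lra.
Qed.

Lemma nat_plus_frac (i j : nat) (t r : RR) : in01o t -> in01o r -> i%:R + t = j%:R + r -> i = j.
Proof.
move=> /andP[t0 t1] /andP[r0 r1] h; apply/eqP; rewrite eqn_leq; apply/andP; split; rewrite leqNgt; apply/negP.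
  by rewrite -(ler_nat RR) -natr1; lra.
by rewrite -(ler_nat RR) -natr1; lra.
Qed.

(** The vertices of the paths start at abscissa 1, which leaves the vertical axis to the edge
    between the centers. *)
Lemma pred_ge1 (b : nat) : (1 < b)%N -> 1 <= b.-1%:R :> RR.
Proof. by case: b => [|[|b]] // _; rewrite (ler_nat RR 1). Qed.

Lemma segment_avoid a b z s : edge_kind a b -> in01o s -> segment (spot a) (spot b) s <> spot z.
Proof.
move=> k s01; rewrite segment_spot //; have /andP[s0 s1] := s01.
case: k => [[-> ->]|[-> b1]|[-> b1]|[a1 ->]] /=.
- case: z => [|[|z]] [] /=; [lra|lra|move=> h _].
  by have := ltr0Sn RR z; rewrite -h ltxx.
- rewrite (gtn_eqF b1) /=; have b2 := mulr_gt0 s0 (lt_le_trans ltr01 (pred_ge1 b1)).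
  by case: z => [|[|z]] [] /=; lra.
- have b2 := mulr_gt0 s0 (lt_le_trans ltr01 (pred_ge1 b1)).
  by case: z => [|[|z]] [] /=; lra.
- rewrite (gtn_eqF a1) (gtn_eqF (ltnW a1)) /=.
  by case=> h _; exact: nat_between s01 h.
Qed.

Lemma segment_cross a b c d s r : edge_kind a b -> edge_kind c d -> in01o s -> in01o r ->
  segment (spot a) (spot b) s = segment (spot c) (spot d) r -> a = c /\ b = d.
Proof.
move=> k k' s01 r01; rewrite !segment_spot //; have /andP[s0 s1] := s01; have /andP[r0 r1] := r01.
have p1 m : (1 < m)%N -> 0 < s * m.-1%:R /\ 0 < r * m.-1%:R.
  by move=> m1; have := lt_le_trans ltr01 (pred_ge1 m1); split; apply: mulr_gt0.
have pos m : (1 < m)%N -> 1 <= m.-1%:R :> RR := @pred_ge1 m.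
have same m m' : (1 < m)%N -> (1 < m')%N -> s * m.-1%:R = r * m'.-1%:R -> s = r -> m = m'.
  move=> m1 m1' + sr; rewrite -sr => /(mulfI (lt0r_neq0 s0)) /eqP; rewrite eqr_nat => /eqP.
  by case: m m' m1 m1' => [|[|m]] [|[|m']] //= _ _ ->.
case: k => [[-> ->]|[-> b1]|[-> b1]|[a1 ->]]; case: k' => [[-> ->]|[-> d1]|[-> d1]|[c1 ->]] //=;
  rewrite ?(gtn_eqF b1) ?(gtn_eqF d1) ?(gtn_eqF a1) ?(gtn_eqF (ltnW a1)) ?(gtn_eqF c1) ?(gtn_eqF (ltnW c1)) /=.
- by case=> h1 h2; have [_ h] := p1 _ d1; exfalso; lra.
- by case=> h1 h2; have [_ h] := p1 _ d1; exfalso; lra.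
- by case=> h1 h2; have h := pos _ c1; exfalso; lra.
- by case=> h1 h2; have [h _] := p1 _ b1; exfalso; lra.
- by case=> h1 h2; rewrite (same _ _ b1 d1 h1) //; lra.
- by case=> h1 h2; exfalso; lra.
- by case=> h1 h2; exfalso; lra.
- by case=> h1 h2; have [h _] := p1 _ b1; exfalso; lra.
- by case=> h1 h2; exfalso; lra.
- by case=> h1 h2; rewrite (same _ _ b1 d1 h1) //; lra.
- by case=> h1 h2; exfalso; lra.
- by case=> h1 h2; have h := pos _ a1; exfalso; lra.
- by case=> h1 h2; exfalso; lra.
- by case=> h1 h2; exfalso; lra.
case=> h1; have := nat_plus_frac s01 r01 h1.
by case: a c a1 c1 {h1} => [|[|a]] [|[|c]] //= _ _ [->].
Qed.

Lemma K2_join_simple s : simple_graph (K2_join s).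
Proof.
split=> [x|x y]; first by rewrite /K2_join eqxx.
rewrite /K2_join eq_sym; congr (_ && _); rewrite orbCA; congr [|| _, _ | _].
by rewrite /path_adj orbC.
Qed.

Lemma K2_join_edge_kind s (x y : 'I_(sumn s).+2) : K2_join s x y ->
  edge_kind (minn x y) (maxn x y).
Proof.
move=> /andP[xy h]; have {}xy : (x : nat) <> y by move=> /ord_inj/eqP; apply/negP.
have h' : [\/ (x < 2)%N, (y < 2)%N, (y - 2 = (x - 2).+1)%N | (x - 2 = (y - 2).+1)%N].
  case/or3P: h => [h|h|]; [constructor 1|constructor 2|]; rewrite // /path_adj.
  by case/orP => /andP[/eqP h _]; [constructor 3|constructor 4].
move: (x : nat) (y : nat) xy h' => m k mk h'; clear h.
have [m0|[m1|m2]] : (m = 0 \/ m = 1 \/ 1 < m)%N by lia.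
- have [k1|k2] : (k = 1 \/ 1 < k)%N by lia.
    by constructor 1; rewrite m0 k1.
  by constructor 2; split; lia.
- have [k0|k2] : (k = 0 \/ 1 < k)%N by lia.
    by constructor 1; rewrite m1 k0.
  by constructor 3; split; lia.
have [k0|[k1|k2]] : (k = 0 \/ k = 1 \/ 1 < k)%N by lia.
- by constructor 2; split; lia.
- by constructor 3; split; lia.
by constructor 4; case: h' => h'; split; lia.
Qed.

Lemma segment_oriented (x y : nat) s : in01o s -> exists2 r, in01o r &
  segment (spot x) (spot y) s = segment (spot (minn x y)) (spot (maxn x y)) r.
Proof.
move=> s01; have [xy|yx] := leqP x y; first by exists s.
exists (1 - s); first by move: s01 => /andP[? ?]; apply/andP; split; lra.
exact: segment_rev.
Qed.

Theorem K2_join_planar s : planar (K2_join s).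
Proof.
exists (fun x : 'I_(sumn s).+2 => spot x), (fun x y : 'I_(sumn s).+2 => segment (spot x) (spot y)); split.
  by move=> x y /spot_inj /ord_inj.
split=> [x y xy|x y a b xy ab ne r1 r2 h1 h2 E].
  split; first exact: segment_cont.
  - apply: segment_inj => /spot_inj/ord_inj e; move: xy; rewrite e.
    by rewrite (proj1 (K2_join_simple s)).
  - by rewrite /segment subr0 !mul0r !mul1r !addr0; case: (spot x).
  - by rewrite /segment subrr !mul0r !mul1r !add0r; case: (spot y).
  move=> r z r01; have [r' r'01 ->] := segment_oriented x y r01.
  exact: segment_avoid (K2_join_edge_kind xy) r'01.
have [r1' h1' E1] := segment_oriented x y h1; have [r2' h2' E2] := segment_oriented a b h2.
move: E; rewrite E1 E2 => /(segment_cross (K2_join_edge_kind xy) (K2_join_edge_kind ab) h1' h2').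
case=> mn mx; case/negP: ne; rewrite -!val_eqE /=.
move: (x : nat) (y : nat) (a : nat) (b : nat) mn mx => i j k l mn mx; clear -mn mx; lia.
Qed.

(** * Spectral radii *)

Definition rayleigh_bound {T : finType} (e : rel T) (rho : RR) : Prop :=
  forall Y : T -> RR, \sum_a \sum_b (e a b)%:R * Y a * Y b <= rho * \sum_a Y a ^+ 2.

Definition eigenfunction {T : finType} (e : rel T) (rho : RR) (X : T -> RR) : Prop :=
  forall a, \sum_b (e a b)%:R * X b = rho * X a.

Lemma adj_mx_sym n (e : rel 'I_n) : symmetric e -> (adj_mx e)^T = adj_mx e.
Proof. by move=> sym; apply/matrixP => i j; rewrite !mxE sym. Qed.

Lemma qform_adj n (e : rel 'I_n) (y : 'rV[RR]_n) :
  qform (adj_mx e) y y = \sum_a \sum_b (e a b)%:R * y 0 a * y 0 b.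
Proof. by apply: eq_bigr => a _; apply: eq_bigr => b _; rewrite mxE. Qed.

Lemma dotv_sq n (y : 'rV[RR]_n) : dotv y y = \sum_a y 0 a ^+ 2.
Proof. by apply: eq_bigr => a _; rewrite expr2. Qed.

Lemma eigenfunction_form (T : finType) (e : rel T) rho X : eigenfunction e rho X ->
  \sum_a \sum_b (e a b)%:R * X a * X b = rho * \sum_a X a ^+ 2.
Proof.
move=> eig; rewrite mulr_sumr; apply: eq_bigr => a _.
rewrite expr2 mulrA -eig mulr_suml; apply: eq_bigr => b _; ring.
Qed.

Lemma sum_sq_gt0 (T : finType) (X : T -> RR) : (exists w, X w != 0) -> 0 < \sum_a X a ^+ 2.
Proof.
move=> [w wn]; rewrite (bigD1 w) //= ltr_wpDr ?sumr_ge0 //; first by move=> i _; rewrite sqr_ge0.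
by rewrite lt_neqAle sqr_ge0 eq_sym sqrf_eq0 wn.
Qed.

Lemma eigenvalue_adj n (e : rel 'I_n) rho : symmetric e ->
  eigenvalue (adj_mx e) rho <-> exists2 X : 'I_n -> RR, (exists w, X w != 0) & eigenfunction e rho X.
Proof.
move=> sym; split.
  move=> /eigenvalueP[y yA yn]; exists (y 0).
    by case/rV0Pn: yn => w wn; exists w.
  move=> a; have := congr1 (fun M : 'rV[RR]_n => M 0 a) yA; rewrite !mxE => <-.
  by apply: eq_bigr => b _; rewrite mxE mulrC sym.
case=> X [w wn] eig; apply/eigenvalueP; exists (\row_i X i).
  apply/rowP => a; rewrite !mxE -eig; apply: eq_bigr => b _; by rewrite !mxE mulrC sym.
by apply/rV0Pn; exists w; rewrite mxE.
Qed.

Theorem spectral_data n (e : rel 'I_n.+1) : symmetric e ->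
  exists rho X, [/\ spectral_radius e rho, forall w, 0 <= X w, exists w, X w != 0,
    eigenfunction e rho X & rayleigh_bound e rho].
Proof.
move=> sym; have [|rho [x [xn x0 eig ub]]] := @perron_vector RR n (adj_mx e) (adj_mx_sym sym).
  by move=> i j; rewrite mxE ler0n.
have bound : rayleigh_bound e rho.
  move=> Y; have := ub (\row_i Y i); rewrite qform_adj dotv_sq.
  under eq_bigr do under eq_bigr do rewrite !mxE.
  by under [in X in _ <= X]eq_bigr do rewrite !mxE.
have eigf : eigenfunction e rho (x 0).
  by move=> a; rewrite -eig; apply: eq_bigr => b _; rewrite mxE.
have xw : exists w, x 0 w != 0 by case/rV0Pn: xn => w wn; exists w.
exists rho, (x 0); split=> //; split; first by apply/(eigenvalue_adj _ sym); exists (x 0).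
move=> a /(eigenvalue_adj _ sym)[Y Yn eigY].
have := bound Y; rewrite (eigenfunction_form eigY) ler_pM2r //; exact: sum_sq_gt0.
Qed.

Lemma spectral_radius_uniq n (e : rel 'I_n) r r' : spectral_radius e r -> spectral_radius e r' -> r = r'.
Proof. by move=> [h1 h2] [h1' h2']; apply/eqP; rewrite eq_le h2 // h2'. Qed.

Lemma rayleigh_attained n (e : rel 'I_n) rho (X : 'I_n -> RR) : symmetric e -> rayleigh_bound e rho ->
  rho * \sum_a X a ^+ 2 <= \sum_a \sum_b (e a b)%:R * X a * X b -> eigenfunction e rho X.
Proof.
move=> sym ub lb a; pose x := \row_i X i.
have xE i : x 0 i = X i by rewrite mxE.
have := @rayleigh_stationary RR n (adj_mx e) rho x (adj_mx_sym sym) _ _ a.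
rewrite xE; under eq_bigr do rewrite mxE xE.
apply.
  by move=> y; rewrite qform_adj dotv_sq; exact: ub.
rewrite qform_adj dotv_sq; under eq_bigr do rewrite xE.
by under [in X in _ <= X]eq_bigr do under eq_bigr do rewrite !xE.
Qed.

Lemma isomorphic_rayleigh (T T' : finType) (g : rel T) (g' : rel T') r :
  isomorphic g g' -> rayleigh_bound g' r -> rayleigh_bound g r.
Proof.
move=> [f [fbij fE]] ub Y; have [h hK fK] := fbij.
have := ub (Y \o h); rewrite (reindex f) /=; last by apply: onW_bij.
rewrite [in X in _ <= X](reindex f) /=; last by apply: onW_bij.
under [in X in X <= _]eq_bigr => a _ do (rewrite (reindex f) /=; last by apply: onW_bij).
under [in X in X <= _]eq_bigr => a _ do under eq_bigr => b _ do rewrite -fE !hK.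
by under [in X in _ <= X]eq_bigr => a _ do rewrite hK.
Qed.

(** * The extremal graph *)

Lemma join_rayleigh_lower (s : seq nat) (r : RR) : rayleigh_bound (K2_join s) r ->
  0 < r /\ 2 * ((sumn s).+2)%:R - 4 <= r ^+ 2.
Proof.
move=> ub; have [u [v [ps [dec shE]]]] := K2_join_decomp s.
have szf : size (flatten ps) = sumn s by rewrite size_flatten /shape shE.
have [un cov gE] := dec; have uv : u != v by move: un; rewrite /= inE negb_or => /andP[/andP[]].
have sumK (F : 'I_(sumn s).+2 -> RR) := join_decomp_sum F dec.
have off w : w \in flatten ps -> (w != u) /\ (w != v).
  move=> wf; move: un; rewrite /= inE negb_or => /and3P[/andP[_ uf] vf _].
  by split; apply/eqP => wE; [move: uf|move: vf]; rewrite -wE wf.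
pose M : RR := (sumn s)%:R.
have test (c : RR) : 0 <= c -> 4 * M * c + 2 * c ^+ 2 <= r * (2 * c ^+ 2 + M).
  move=> c0; pose Y w : RR := if (w == u) || (w == v) then c else 1.
  have Yu : Y u = c by rewrite /Y eqxx.
  have Yv : Y v = c by rewrite /Y eqxx orbT.
  have Yw w : w \in flatten ps -> Y w = 1 by move=> /off[/negbTE wu /negbTE wv]; rewrite /Y wu wv.
  have Y0 w : 0 <= Y w by rewrite /Y; case: ifP.
  have -> : 2 * c ^+ 2 + M = \sum_a Y a ^+ 2.
    rewrite (sumK (fun a => Y a ^+ 2)) Yu Yv.
    have -> : \sum_(w <- flatten ps) Y w ^+ 2 = M.
      rewrite (eq_big_seq (fun=> 1)); last by move=> w wf; rewrite Yw // expr1n.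
      by rewrite big_const_seq count_predT szf iter_addr_0.
    by ring.
  apply: le_trans (ub Y).
  have SY : \sum_(w <- flatten ps) Y w = M.
    rewrite (eq_big_seq (fun=> 1)); last by move=> w wf; rewrite Yw.
    by rewrite big_const_seq count_predT szf iter_addr_0.
  have -> : \sum_a \sum_b (K2_join s a b)%:R * Y a * Y b = \sum_a Y a * (\sum_b (K2_join s a b)%:R * Y b).
    by apply: eq_bigr => a _; rewrite mulr_sumr; apply: eq_bigr => b _; ring.
  rewrite (sumK (fun a => Y a * (\sum_b (K2_join s a b)%:R * Y b))).
  rewrite (join_row_center dec Y (c := u) (c' := v)) ?inE ?eqxx //.
  rewrite (join_row_center dec Y (c := v) (c' := u)) ?inE ?eqxx ?orbT // Yu Yv SY.
  have : 2 * c * M <= \sum_(w <- flatten ps) Y w * (\sum_b (K2_join s w b)%:R * Y b).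
    rewrite -SY mulr_sumr big_seq_cond [in X in _ <= X]big_seq_cond; apply: ler_sum => w /andP[wf _].
    rewrite (join_row dec Y wf) Yu Yv Yw // mulr1 mul1r.
    have : 0 <= \sum_(y <- flatten ps) (fadj ps w y)%:R * Y y.
      by apply: sumr_ge0 => y _; rewrite mulr_ge0 ?ler0n.
    lra.
  lra.
have M0 : 0 <= M by rewrite ler0n.
have r0 : 0 < r.
  by rewrite ltNge; apply/negP => rn; have := test 1 ler01; have := mulr_le0_ge0 rn M0; lra.
(* The value [r / 2] is what the eigenvalue equation [r * 1 = 2 * c] suggests at a vertex adjacent
   to the centers only. *)
split=> //; have := test (r / 2) ltac:(lra).
rewrite -[(sumn s).+2]addn2 natrD -/M => h.
suff : r * (2 * M + r - r ^+ 2) <= r * 0 by rewrite ler_pM2l //; lra.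
by move: h; rewrite expr_div_n !expr2; lra.
Qed.

Lemma exists_q (r : RR) : 2 < r -> exists q : RR, [/\ 0 < q, q < 1 & q + q^-1 = r].
Proof.
move=> r2; have d0 : 0 <= r ^+ 2 - 4 by nra.
set d := Num.sqrt (r ^+ 2 - 4).
have dd : d ^+ 2 = r ^+ 2 - 4 by rewrite sqr_sqrtr.
have dge : 0 <= d by apply: sqrtr_ge0.
pose q := (r - d) / 2.
have qq : q * (r - q) = 1.
  have -> : q * (r - q) = (r ^+ 2 - d ^+ 2) / 4 by rewrite /q; field.
  by rewrite dd; lra.
have q0 : 0 < q by rewrite /q; nra.
have q1 : q < 1 by rewrite /q; nra.
exists q; split=> //.
have -> : q^-1 = r - q by apply: (mulfI (lt0r_neq0 q0)); rewrite qq divff // lt0r_neq0.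
by ring.
Qed.

Lemma forest_large (t c K m : nat) : (3 <= K)%N -> (c <= K)%N -> (t <= K)%N ->
  (100 * K ^ 3 <= m.+2)%N -> (2 * c * ((t + 4) * K + 3 * c) < m)%N.
Proof.
move=> K3 cK tK h; have K0 : (27 <= K ^ 3)%N by rewrite (@leq_exp2r 3 K 3).
have : (2 * c * ((t + 4) * K + 3 * c) <= 2 * K * ((K + 4) * K + 3 * K))%N.
  by apply: leq_mul; rewrite ?leq_mul2l ?cK ?orbT // leq_add // ?leq_mul2l ?leq_mul2r ?leq_add2r ?tK ?cK ?orbT.
have -> : (2 * K * ((K + 4) * K + 3 * K) = 2 * K ^ 3 + 14 * K ^ 2)%N by rewrite !expnS !expn0; ring.
have : (K ^ 2 * 3 <= K ^ 3)%N by rewrite [X in (_ <= X)%N]expnSr leq_mul2l K3 orbT.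
by move: (K ^ 3)%N (K ^ 2)%N K0 h => a b; lia.
Qed.

(** [c] is the order of the repeated part. The [+ 3] in the bound on [size s0] allows for two
    leading paths and a remainder, and [t + 4] long paths are enough for the constructions of all
    three cases. *)
Theorem extremal_core (t l c : nat) (s0 : seq nat) (e : rel 'I_(sumn s0).+2) :
  let n := (sumn s0).+2 in
  (3 <= t * l)%N -> (0 < c <= t * l)%N -> (t <= t * l)%N -> (100 * (t * l) ^ 3 <= n)%N ->
  4 * 10 ^+ 16 <= n%:R :> RR ->
  all (fun a => 0 < a)%N s0 -> (size s0 <= sumn s0 %/ c + 3)%N ->
  ~ contains_sub (tP t l) (K2_join s0) ->
  (forall (g : rel 'I_n) u v ps, join_decomp g u v ps -> sorted geq (map size ps) ->
     (forall p, p \in ps -> p != [::]) -> sumn (map size ps) = sumn s0 ->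
     (forall i, i < t + 4 -> c <= nth 0 (map size ps) i)%N ->
     ~ contains_sub (tP t l) (off_axis g u v) ->
     forall k, (prefix_sum (map size ps) k <= prefix_sum s0 k)%N) ->
  spex_extremal n t l e -> isomorphic e (K2_join s0).
Proof.
move=> n tl3 /andP[c0 cK] tK nK nbig pos0 size0 free0 hcase [[[irr sym] [pl free]] [rho [sr rmax]]].
set K := (t * l)%N in tl3 cK tK nK.
have vk := planar_van_kampen pl.
have [irr0 sym0] := K2_join_simple s0.
have [rho' [X [sr' X0 Xn eigX ubX]]] := spectral_data sym.
have E := spectral_radius_uniq sr sr'; subst rho'.
have [r0 [_ [sr0 _ _ _ ub0]]] := spectral_data sym0.
have r0rho : r0 <= rho.
  by apply: rmax sr0; split=> //; split=> //; exact: K2_join_planar.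
have [r0pos r0low] := join_rayleigh_lower ub0.
have rho0 : 0 < rho by exact: lt_le_trans r0rho.
have rho_low : 2 * n%:R - 4 <= rho ^+ 2.
  by apply: le_trans r0low _; rewrite ler_pXn2r // ?nnegrE ltW.

have [w0 w0n] := Xn.
pose u := [arg max_(i > w0) X i]%O.
have umax w : X w <= X u by rewrite /u; case: arg_maxP => // i _ h; exact: h.
have Xu : 0 < X u by apply: lt_le_trans (umax w0); rewrite lt_neqAle X0 eq_sym w0n.
pose x w := X w / X u.
have x0 w : 0 <= x w by rewrite divr_ge0 // ltW.
have x1 w : x w <= 1 by rewrite ler_pdivrMr // mul1r.
have xu : x u = 1 by rewrite /x divff // gt_eqF.
have eigx : eigenfunction e rho x.
  move=> a; rewrite /x mulrA -eigX mulr_suml; apply: eq_bigr => b _; by rewrite mulrA.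
have eigx' w : \sum_(y in nbr e w) x y = rho * x w.
  rewrite -eigx [LHS]big_mkcond; apply: eq_bigr => y _; rewrite inE.
  by case: (e w y); rewrite ?mul1r ?mul0r.
have cT : #|'I_n|%:R = n%:R :> RR by rewrite card_ord.
have [|| v [uv xv xs dom]] := @two_dominating RR 'I_n e x rho u irr sym vk x0 x1 xu rho0 eigx'.
- by rewrite cT.
- by rewrite cT.
have goodK : (1 < K <= #|good e u v|)%N.
  rewrite (leq_trans _ tl3) //= -(ler_nat RR); rewrite cT in dom; apply: le_trans dom.
  have : (100 * K <= n)%N.
    apply: leq_trans nK; rewrite leq_mul2l expnS -[X in (X <= _)%N]muln1 leq_mul2l expn_gt0.
    by rewrite (leq_trans _ tl3) ?orbT.
  by rewrite -(ler_nat RR) natrM; have := ler0n RR K; lra.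
have [ps0 dec0 ne0] := star_join_decomp irr sym vk uv free goodK.
pose G := star e u v; have symG : symmetric G by exact: star_sym.
pose ps := sort (fun p q : seq 'I_n => size q <= size p)%N ps0.
have pp : perm_eq ps0 ps by rewrite perm_sym; exact/permEl/perm_sort.
have dec : join_decomp G u v ps := join_decomp_perm pp dec0.
have ne p : p \in ps -> p != [::] by rewrite -(perm_mem pp); exact: ne0.
pose s := map size ps.
have srt : sorted geq s.
  by rewrite sorted_map; apply: sort_sorted => p q; exact: leq_total.
have tot : sumn s = sumn s0 by have := join_decomp_card dec; rewrite card_ord => -[].
have pos : all (fun a => 0 < a)%N s.
  by apply/allP => a /mapP[p /ne pn ->]; rewrite lt0n size_eq0.
have freeG : ~ contains_sub (tP t l) (off_axis G u v).
  move=> /(contains_tP _ _ (off_axis_sym dec))[qs [qt ql qu qsrt]]; apply: free.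
  by apply: (star_tP sym qt ql qu qsrt); case/andP: goodK.
have [rG [XG [_ XG0 XGn eigG ubG]]] := spectral_data symG.
have Sx : 0 < \sum_a x a ^+ 2 by apply: sum_sq_gt0; exists u; rewrite xu oner_eq0.
have gain : rho * \sum_a x a ^+ 2 <= \sum_a \sum_b (G a b)%:R * x a * x b.
  rewrite -(eigenfunction_form eigx); apply: le_trans (star_weight irr sym vk uv x0 xu xv xs).
  rewrite lerDl; apply: sumr_ge0 => w _; apply: divr_ge0 => //.
have rhoG : rho <= rG by rewrite -(ler_pM2r Sx); apply: le_trans gain (ubG x).
have KR : 3 <= K%:R :> RR by rewrite (ler_nat RR 3).
have nKR : 100 * K%:R ^+ 3 <= n%:R :> RR by rewrite -natrX -natrM ler_nat.
have K3 : K%:R ^+ 2 * 3 <= K%:R ^+ 3 :> RR by rewrite [X in _ <= X]exprSr ler_wpM2l // sqr_ge0.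
(* The [+ 1] absorbs [q < 1], so that [4 * c <= rG - q = q^-1]. *)
have rGK : 4 * K%:R + 1 <= rG.
  apply: le_trans rhoG; rewrite -(ler_pXn2r (n := 2)) ?nnegrE; [|by []| |exact: ltW]; last by lra.
  by apply: le_trans rho_low; nra.
have [q [q0 q1 qE]] := exists_q (ltac:(lra) : 2 < rG).
have cq : 4 * c%:R * q <= 1.
  have cKR : c%:R <= K%:R :> RR by rewrite ler_nat.
  have : 4 * c%:R * q <= (rG - q) * q by apply: ler_wpM2r; [exact: ltW|lra].
  suff -> : (rG - q) * q = 1 by [].
  by rewrite -qE addrAC subrr add0r mulVf // gt_eqF.
have [u' [v' [ps' [dec' shE']]]] := K2_join_decomp s0.
have cost : \sum_(a <- s) zeta q a <= \sum_(a <- s0) zeta q a.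
  have := @join_cost_le RR q _ _ G (K2_join s0) u v ps u' v' ps' XG r0 q0 q1 dec dec'.
  rewrite shE'; apply=> //; rewrite qE //; exact: le_trans rhoG.
have cost1 : \sum_(a <- s) zeta q a <= (size s0)%:R.
  apply: le_trans cost _; rewrite -[(size s0)%:R]/(1 *+ size s0) -iter_addr_0 -(count_predT s0) -big_const_seq.
  by apply: ler_sum => a _; apply/ltW/zeta_lt1.
have sB : all (fun a => a < K)%N s.
  apply/allP => a /mapP[p pps ->]; rewrite ltnNge; apply/negP => Kp.
  exact: freeG (long_part_tP dec pps Kp).
have large : (2 * c * ((t + 4) * K + 3 * c) < sumn s)%N.
  by rewrite tot; apply: forest_large nK; rewrite ?c0 ?cK ?tK ?tl3.
have size0' : (size s0 <= sumn s %/ c + 3)%N by rewrite tot.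
have many := many_large_parts q0 q1 c0 cq sB size0' large cost1.
have bigparts i : (i < t + 4)%N -> (c <= nth 0 s i)%N by apply: sorted_geq_count.
have pre := hcase G u v ps dec srt ne tot bigparts freeG.
have sE : s = s0 by apply: (zeta_majorization q0 q1).
have isoG : isomorphic G (K2_join s0) := join_decomp_iso dec sE.
(* This closes the chain [rG <= r0 <= rho <= rG], so all three values agree. *)
have rGr0 : rG <= r0.
  have := isomorphic_rayleigh isoG ub0 XG; rewrite (eigenfunction_form eigG) ler_pM2r //.
  exact: sum_sq_gt0.
have rE : rG = rho by apply/eqP; rewrite eq_le rhoG andbT (le_trans rGr0).
(* By [gain], [x] attains the maximal Rayleigh quotient of [G], so it is an eigenfunction of both
   graphs. *)
have eigGx : eigenfunction G rho x.
  by rewrite -rE; apply: rayleigh_attained => //; rewrite rE.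
have eG := star_eigen_eq irr sym vk uv x0 xu xv xs eigx eigGx.
have [f [fb fE]] := isoG; exists f; split=> // a b.
by rewrite (eG a b) -fE.
Qed.

(** * Numerical thresholds and the three cases *)

Local Open Scope nat_scope.

Lemma cube_exp2_le k : 30 <= k -> (100 * k%:R ^+ 3 <= 2 ^+ k :> RR)%R.
Proof.
move=> k30; rewrite -(subnKC k30); elim: (k - 30) => [|m IH]; first by rewrite addn0; lra.
rewrite addnS (exprS 2) -(natr1 (30 + m)).
have : (30 <= (30 + m)%:R :> RR)%R by rewrite (ler_nat RR 30) leq_addr.
move: (30 + m)%:R%R (2 ^+ (30 + m))%R IH => x y IH x30.
have xx : (30 * x <= x ^+ 2)%R by rewrite expr2 ler_wpM2r //; lra.
have : (30 * x ^+ 2 <= x ^+ 3)%R by rewrite [X in (_ <= X)%R]exprS ler_wpM2r // sqr_ge0.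
lra.
Qed.

(** The first term of [N0] is about [4.45 * 10^16], which exceeds the cubic bound as long as
    [t * l < 30]. From 30 on the exponential term, [1.275 * 2 ^ (t * l)] up to a summand 2, takes
    over. *)
Lemma n_large_bounds n t l c : 3 <= t * l -> n_large n (Nth t l c) ->
  (4 * 10 ^+ 16 <= n%:R :> RR)%R /\ 100 * (t * l) ^ 3 <= n.
Proof.
move=> K3 big; set K := t * l in K3 *.
have big0 : (Nth t l c <= n%:R)%R.
  apply: le_trans big; rewrite lerDl; have := sqrtr_ge0 (2 * Nth t l c - 6)%R; lra.
have N0n : (N0 t l <= n%:R)%R by apply: le_trans big0; rewrite /Nth le_max lexx.
have b1 : (267 / 100 * 9 ^+ 17 <= n%:R :> RR)%R by apply: le_trans N0n; rewrite /N0 le_max lexx.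
have b2 : (102 / 10 * 2 ^+ (K - 3) + 2 <= n%:R :> RR)%R.
  by apply: le_trans N0n; rewrite /N0 le_max lexx orbT.
have b3 : (4 * 10 ^+ 16 <= n%:R :> RR)%R.
  apply: le_trans b1; lra.
split=> //; rewrite -(ler_nat RR).
have [K30|K30] := leqP 30 K.
  rewrite natrM natrX; apply: le_trans (cube_exp2_le K30) _; apply: le_trans b2.
  rewrite -[X in (2 ^+ X <= _)%R](subnK K3) exprD.
  have := exprn_ge0 (K - 3) (ler0n RR 2); lra.
apply: le_trans b3; rewrite natrM natrX.
have : (K%:R ^+ 3 <= 30 ^+ 3 :> RR)%R by rewrite ler_pXn2r ?nnegrE ?ler0n // ler_nat ltnW.
lra.
Qed.

Lemma extremal_graph_isI n t l c c' s : 3 <= t * l -> n_large n (Nth t l c') ->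
  0 < c <= t * l -> t <= t * l ->
  ((100 * (t * l) ^ 3 <= n) -> sumn s = n - 2) -> all (fun a => 0 < a) s -> size s <= sumn s %/ c + 3 ->
  ~ contains_sub (tP t l) (K2_join s) ->
  (forall (T : finType) (g : rel T) u v ps, join_decomp g u v ps -> sorted geq (map size ps) ->
     (forall p, p \in ps -> p != [::]) -> sumn (map size ps) = n - 2 ->
     (forall i, i < t + 4 -> c <= nth 0 (map size ps) i) ->
     ~ contains_sub (tP t l) (off_axis g u v) ->
     forall k, prefix_sum (map size ps) k <= prefix_sum s k) ->
  extremal_graph_is n t l s.
Proof.
move=> K3 big cK tK sumE pos sz free hcase; have [b3 K3n] := n_large_bounds K3 big.
have sE := sumE K3n.
have E : (sumn s).+2 = n.
  rewrite sE; have : 2 <= n.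
    by apply: leq_trans K3n; rewrite (@leq_trans (100 * 1)) // leq_mul2l expn_gt0; lia.
  by move: sE => _; clear; lia.
have [irr sym] := K2_join_simple s.
split=> //; first exact: K2_join_planar.
(* Eliminating this equation turns ['I_n] into the vertex type of [K2_join s]. *)
case: _ / E b3 K3n hcase {big sumE sE} => b3 K3n hcase e.
apply: extremal_core K3 cK tK K3n b3 pos sz free _.
by move=> g u v ps dec srt ne tot; apply: (hcase _ g u v ps) => //; rewrite tot subn2.
Qed.

Lemma HP2_sum n n1 c : n1 <= n - 2 -> sumn (HP2 n n1 c) = n - 2.
Proof. by move=> h; rewrite HP2E /= equal_parts_sum subnKC. Qed.

Lemma HP3_sum n n1 n2 c : n1 + n2 <= n - 2 -> sumn (HP3 n n1 n2 c) = n - 2.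
Proof. by move=> h; rewrite HP3E /= equal_parts_sum; lia. Qed.

Lemma cons_decr a b s : b <= a -> (forall i j, i <= j -> nth 0 s j <= nth 0 s i <= b) ->
  forall i j, i <= j -> nth 0 (a :: s) j <= nth 0 (a :: s) i <= a.
Proof.
move=> ba decr [|i] [|j] //=; rewrite ?leqnn ?andbT // => ij.
  by have /andP[_ /leq_trans] := decr _ _ (leqnn j); apply.
by have /andP[-> /leq_trans] := decr i j ij; apply.
Qed.

Lemma extremal1 n l : 6 <= l -> n_large n (Nth 1 l ((l - 3) %/ 3)) ->
  extremal_graph_is n 1 l (HP2 n (l - 3 - 2 * ((l - 3) %/ 3)) ((l - 3) %/ 3)).
Proof.
move=> l6 big; set c := (l - 3) %/ 3; set n1 := l - 3 - 2 * c.
have [c0 cl cn1 n1l] : [/\ 0 < c, c <= l, c <= n1 & n1 + c + c + 3 = l].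
  by rewrite /n1 /c; split; lia.
have K3 : 3 <= 1 * l by rewrite mul1n (leq_trans _ l6).
have nE : sumn (HP2 n n1 c) = n - 2.
  apply: HP2_sum; have [_] := n_large_bounds K3 big; rewrite mul1n.
  have : l <= l ^ 3 by rewrite -[X in X <= _]expn1 leq_exp2l //; lia.
  by move: (l ^ 3) n1l => x; clear; lia.
have decr := cons_decr cn1 (fun i j => @equal_parts_decr (n - 2 - n1) c i j c0).
rewrite -HP2E in decr.
apply: (extremal_graph_isI (c := c) K3 big) => //.
- by rewrite c0 mul1n.
- by rewrite mul1n (leq_trans _ l6).
- by rewrite HP2E /= (leq_trans c0 cn1) equal_parts_pos.
- rewrite nE HP2E /=; apply: leq_trans (_ : ((n - 2 - n1) %/ c).+2 <= _); first by rewrite ltnS equal_parts_size.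
  by rewrite -addn2 leq_add // leq_div2r // leq_subr.
- have [u [v [ps [dec sE]]]] := K2_join_decomp (HP2 n n1 c).
  apply: (join_free1 dec); rewrite sE; first by move=> i j /decr/andP[].
  rewrite HP2E /=.
  have /andP[_ h0] := equal_parts_decr (n - 2 - n1) c0 (leqnn 0).
  have /andP[_ h1] := equal_parts_decr (n - 2 - n1) c0 (leqnn 1).
  by move: n1l h0 h1; clear; lia.
move=> T g u v ps dec srt ne sn bigp free.
apply: prefix_case1 => // [i i3|]; first by apply: bigp; lia.
rewrite leqNgt; apply/negP => h; apply: free.
have sz : 2 < size ps.
  by have := bigp 2 isT; rewrite ltnNge; apply: contraL => s2; rewrite nth_default ?size_map // -ltnNge.
case: ps dec srt ne sn bigp h sz => [|p1 [|p2 [|p3 rest]]] //= dec _ ne _ _ h _.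
apply: (three_parts_tP dec erefl); first by apply: ne; rewrite !inE eqxx orbT.
by move: l6 h; clear; lia.
Qed.

Lemma nth_sizes_neq0 (T : eqType) (ps : seq (seq T)) i : 0 < nth 0 (map size ps) i -> i < size ps.
Proof. by apply: contraTltn => s; rewrite nth_default // size_map. Qed.

Lemma extremal2 n l : 4 <= l -> n_large n (Nth 2 l ((l - 2) %/ 2)) ->
  extremal_graph_is n 2 l (HP3 n (l - 1) ((l - 2).+1 %/ 2) ((l - 2) %/ 2)).
Proof.
move=> l4 big; set c := (l - 2) %/ 2; set n2 := (l - 2).+1 %/ 2; set n1 := l - 1.
have [c0 cl cn2 n1l] : [/\ 0 < c, c <= l, c <= n2 & n1 + 1 = l].
  by rewrite /n1 /n2 /c; split; lia.
have n2n1 : n2 <= n1 by rewrite /n1 /n2; lia.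
have n2c : n2 + c + 2 = l by rewrite /n2 /c; lia.
have K3 : 3 <= 2 * l by clear -l4; lia.
have nE : sumn (HP3 n n1 n2 c) = n - 2.
  apply: HP3_sum; have [_] := n_large_bounds K3 big.
  have : 2 * l <= (2 * l) ^ 3 by rewrite -[X in X <= _]expn1 leq_exp2l //; clear -l4; lia.
  by move: ((2 * l) ^ 3) n1l n2n1 l4 => x; clear; lia.
have decr := cons_decr n2n1 (cons_decr cn2 (fun i j => @equal_parts_decr (n - 2 - n1 - n2) c i j c0)).
rewrite -HP3E in decr.
apply: (extremal_graph_isI (c := c) K3 big) => //.
- by rewrite c0 (leq_trans cl) // leq_pmull.
- by clear -l4; lia.
- by rewrite HP3E /= equal_parts_pos // (leq_trans c0 cn2) (leq_trans (leq_trans c0 cn2)).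
- rewrite nE HP3E /=; apply: leq_trans (_ : ((n - 2 - n1 - n2) %/ c).+3 <= _).
    by rewrite !ltnS equal_parts_size.
  by rewrite -addn3 leq_add // leq_div2r // -subnDA leq_subr.
- have [u [v [ps [dec sE]]]] := K2_join_decomp (HP3 n n1 n2 c).
  apply: (join_free2 dec); rewrite sE; first by move=> i j /decr/andP[].
    by rewrite HP3E /= -n1l addn1.
  rewrite HP3E /=.
  have /andP[_ h0] := equal_parts_decr (n - 2 - n1 - n2) c0 (leqnn 0).
  by move: n2c h0; clear; lia.
move=> T g u v ps dec srt ne sn bigp free.
have sz : 3 < size ps by apply: nth_sizes_neq0; apply: leq_trans c0 (bigp 3 isT).
have [n1p n4p] : [/\ nth 0 (map size ps) 0 <= l - 1 &
    ~~ ((l - 1 <= nth 0 (map size ps) 0 + nth 0 (map size ps) 3) &&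
        (l - 1 <= nth 0 (map size ps) 1 + nth 0 (map size ps) 2))].
  case: ps dec srt ne sn bigp sz => [|p1 [|p2 [|p3 [|p4 rest]]]] //= dec _ ne _ bigp _.
  have [c2 c3 c4] : [/\ c <= size p2, c <= size p3 & c <= size p4].
    by split; [apply: (bigp 1)|apply: (bigp 2)|apply: (bigp 3)].
  split.
    (* A first part with [l] vertices contains a [P_l]; the next three parts and both centers give
       another one, as [3 * c + 2 >= l]. *)
    rewrite leqNgt; apply/negP => h; apply: free.
    apply: (long_and_three_tP dec erefl); first by apply: ne; rewrite !inE eqxx !orbT.
      by move: h l4; clear; lia.
    by move: c2 c3 c4; rewrite /c; clear -l4; move: (size p2) (size p3) (size p4) => *; lia.
  apply/negP => /andP[h1 h2]; apply: free.
  by apply: (two_pairs_tP dec erefl); rewrite addn1; move: h1 h2 l4; clear; lia.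
by apply: prefix_case2 => // i i4; apply: bigp; lia.
Qed.

Lemma extremal3 n t l c' : 3 <= t -> 3 <= l -> n_large n (Nth t l c') ->
  extremal_graph_is n t l (HP2 n (t * l - 2 * l - 1) (l - 1)).
Proof.
move=> t3 l3 big; set c := l - 1; set n1 := t * l - 2 * l - 1.
have [c0 cl] : 0 < c /\ c.+1 = l by rewrite /c; lia.
(* The first path is one vertex short of [t - 2] copies of [P_l], the number of copies that must do
   without a center. *)
have n1E : n1.+1 = (t - 2) * l.
  rewrite mulnBl /n1 subn1 prednK // subn_gt0 ltn_mul2r t3 andbT; exact: leq_trans l3.
have cn1 : c <= n1 by rewrite -ltnS cl n1E leq_pmull // subn_gt0.
have K3 : 3 <= t * l by rewrite -[3]muln1 leq_mul // (leq_trans _ l3).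
have n1K : n1 < t * l by rewrite n1E leq_mul2r leq_subr orbT.
have nE : sumn (HP2 n n1 c) = n - 2.
  apply: HP2_sum; have [_] := n_large_bounds K3 big.
  have : t * l <= (t * l) ^ 3 by rewrite -[X in X <= _]expn1 leq_exp2l // (leq_trans _ K3).
  by move: ((t * l) ^ 3) (t * l) K3 n1K => x y; clear; lia.
have decr := cons_decr cn1 (fun i j => @equal_parts_decr (n - 2 - n1) c i j c0).
rewrite -HP2E in decr.
apply: (extremal_graph_isI (c := c) K3 big) => //.
- by rewrite c0 (leq_trans _ (leq_pmull l _)) ?leq_subr // (leq_trans _ t3).
- by rewrite leq_pmulr // (leq_trans _ l3).
- by rewrite HP2E /= (leq_trans c0 cn1) equal_parts_pos.
- rewrite nE HP2E /=; apply: leq_trans (_ : ((n - 2 - n1) %/ c).+2 <= _); first by rewrite ltnS equal_parts_size.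
  by rewrite -addn2 leq_add // leq_div2r // leq_subr.
- have [u [v [ps [dec sE]]]] := K2_join_decomp (HP2 n n1 c).
  apply: (join_free3 dec); rewrite ?sE; first by move=> i j /decr/andP[].
  + exact: ltnW.
  + rewrite HP2E /= -cl ltnS.
    by have /andP[] := equal_parts_decr (n - 2 - n1) c0 (leqnn 0).
  + by rewrite HP2E /= -n1E.
move=> T g u v ps dec srt ne sn bigp free.
apply: prefix_case3 => //; rewrite leqNgt; apply/negP => h; apply: free.
have sz : t - 1 < size ps by apply: nth_sizes_neq0; apply: leq_trans c0 (bigp _ _); lia.
have big_nth i : i < t -> c <= size (nth [::] ps i).
  move=> it; rewrite -(nth_map [::] 0 size); first by apply: bigp; lia.
  by move: it sz t3; clear; lia.
apply: (many_chunks_tP dec); [exact: ltnW|exact: leq_trans l3| | | |].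
- apply: leq_trans (_ : _ <= \sum_(i < t - 2) nth 0 [seq size i | i <- ps] i %/ l) _.
    by move: h; move: (\sum_(i < _) _) => S; clear -t3; lia.
  apply: leq_sum => i _; rewrite (nth_map [::]) //.
  by have := ltn_ord i; move: sz t3; clear; lia.
- by apply: big_nth; lia.
- by apply: big_nth; lia.
- by move: sz t3; clear; lia.
Qed.

Theorem theorem4 (t l n : nat) :
  [/\ (t = 1%N -> (6 <= l)%N -> n_large n (Nth t l ((l - 3) %/ 3)) ->
        extremal_graph_is n t l
          (HP2 n (l - 3 - 2 * ((l - 3) %/ 3)) ((l - 3) %/ 3))),
      (t = 2%N -> (4 <= l)%N -> n_large n (Nth t l ((l - 2) %/ 2)) ->
        extremal_graph_is n t l
          (HP3 n (l - 1) ((l - 2).+1 %/ 2) ((l - 2) %/ 2))) &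
      ((3 <= t)%N -> (3 <= l)%N -> n_large n (Nth t l ((l - 2) %/ 2).+1) ->
        extremal_graph_is n t l (HP2 n (t * l - 2 * l - 1) (l - 1)))].
Proof.
split=> [->|->|]; [exact: extremal1|exact: extremal2|exact: extremal3].
Qed.
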